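(* Let $d=1$, and let $f$ satisfy Assumptions (F) and (T)$_1$ (recalled in the context), with $\alpha_1\ge 1$. Then for any finite $\rho>0$ there is a constant $\lambda_0>0$ such that for every $\lambda$ with $\lambda_0\le\lambda<\infty$ there exist an infinite soliton profile $T=\sum_{j\in\mathbb N}R_j$ (as described in the context, for some choice of frequencies, velocities and phases) and a function $\eta:[0,\infty)\times\mathbb R\to\mathbb C$ such that $u=T+\eta$ is a solution of $$i\partial_t u+\Delta u+f(u)=0\quad\text{for } t\ge 0,$$ and $$\sup_{t\ge 0}e^{\lambda t}\|\eta(t)\|_{L^2_x\cap L^\infty_x}\le\rho .$$
   Context: Assumption (F): $f:\mathbb C\to\mathbb C$ has the form $f(z)=g(|z|^2)z$, where $g\in C([0,\infty),\mathbb R)\cap C^2((0,\infty),\mathbb R)$, $g(0)=0$, and $|sg'(s)|+|s^2g''(s)|\le C_0(s^{\alpha_1/2}+s^{\alpha_2/2})$ for all $s>0$, for some $C_0>0$ and some $0<\alpha_1\le\alpha_2<\alpha_{\max}$, where $\alpha_{\max}=\infty$ if $d=1,2$ and $\alpha_{\max}=\frac4{d-2}$ if $d\ge3$. Assumption (T)$_d$: there are $\omega_*>0$, $0<a<1$, $D>0$ (depending only on $d,f$) such that for every $0<\omega<\omega_*$ there is a nontrivial solution $\varphi=\varphi_\omega\in H^1(\mathbb R^d,\mathbb R)$ of $-\Delta\varphi+\omega\varphi=f(\varphi)$ satisfying $|\varphi(x)|+\omega^{-1/2}|\nabla\varphi(x)|\le D\,\omega^{1/\alpha_1}e^{-a\omega^{1/2}|x|}$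 for all $x\in\mathbb R^d$. Infinite soliton profile (dimension $d$): $T=\sum_{j\in\mathbb N}R_j$, where $R_j(t,x)=e^{i(\omega_jt+\frac12v_j\cdot x-\frac14|v_j|^2t+\gamma_j)}\varphi_{\omega_j}(x-v_jt)$, with frequencies $\omega_j\in(0,\omega_* )$, velocities $v_j\in\mathbb R^d$, phases $\gamma_j\in\mathbb R$, and bound states $\varphi_{\omega_j}$ as in (T)$_d$. Each $R_j$ (a soliton with initial position $0$) solves $i\partial_tu+\Delta u+f(u)=0$. Solutions $u=T+\eta$ are understood in the Duhamel sense: $\eta(t)=-i\int_t^\infty e^{i(t-\tau)\Delta}\big[f(T+\eta)-\sum_jf(R_j)\big](\tau)\,d\tau$. The norm of an intersection of spaces is the usual one (e.g. the maximum of the norms). *)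

(* Defs.v *)
From HB Require Import structures.
From mathcomp Require Import all_boot all_order all_algebra.
From mathcomp Require Import all_classical all_reals all_analysis.
From mathcomp Require Import complex.

Set Implicit Arguments.
Unset Strict Implicit.
Unset Printing Implicit Defensive.

Import Order.TTheory GRing.Theory Num.Theory.
Import numFieldNormedType.Exports.


Local Open Scope ring_scope.
Local Open Scope complex_scope.
Local Open Scope classical_set_scope.

Section ComplexLebesgue.
Variable R : realType.
Local Notation mu := (@lebesgue_measure R).

Definition cmod (z : R[i]) : R := Normc.normc z.

Definition cexpi (theta : R) : R[i] := cos theta +i* sin theta.

Definition cintegrable (D : set R) (h : R -> R[i]) : Prop :=
  mu.-integrable D (fun x => (complex.Re (h x))%:E) /\
  mu.-integrable D (fun x => (complex.Im (h x))%:E).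

Definition cintegral (D : set R) (h : R -> R[i]) : R[i] :=
  (\int[mu]_(x in D) complex.Re (h x)) +i* (\int[mu]_(x in D) complex.Im (h x)).

(* Convergence of a complex series, through its real and imaginary parts. *)
Definition cseries_cvg (u : nat -> R[i]) (l : R[i]) : Prop :=
  (series (fun j => complex.Re (u j)) @ \oo --> complex.Re l) /\
  (series (fun j => complex.Im (u j)) @ \oo --> complex.Im l).

Definition cLnorm (p : \bar R) (h : R -> R[i]) : \bar R :=
  Lnorm mu p (fun x => (cmod (h x))%:E).

Definition in_L2 (h : R -> R[i]) : Prop :=
  (fun x => complex.Re (h x)) \in Lfun mu 2%:E /\ (fun x => complex.Im (h x)) \in Lfun mu 2%:E.

(* The usual norm of an intersection: the maximum of the two norms. *)
Definition normL2Loo (h : R -> R[i]) : \bar R :=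
  maxe (cLnorm 2%:E h) (cLnorm +oo%E h).

Definition L2inner (h k : R -> R[i]) : R[i] :=
  cintegral setT (fun x => h x * conjc (k x)).

(* V is the integral over D of the L^2(R; C)-valued map G, as an identity in
   L^2: G is norm-integrable and weakly measurable (which, L^2 being separable,
   is Bochner integrability by the Pettis theorem), and V is the vector given
   by <V, psi> = int_D <G tau, psi> dtau for all psi in L^2. *)
Definition is_L2_integral (D : set R) (G : R -> R -> R[i]) (V : R -> R[i]) :
    Prop :=
  [/\ {ae mu, forall tau, D tau -> in_L2 (G tau)},
      mu.-integrable D (fun tau => cLnorm 2%:E (G tau)),
      in_L2 V &
      forall psi, in_L2 psi ->
        cintegrable D (fun tau => L2inner (G tau) psi) /\
        L2inner V psi = cintegral D (fun tau => L2inner (G tau) psi)].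

(* (4 pi i t)^(-1/2) exp(i x^2 / (4 t)) for t <> 0, with the principal
   branch: (i t)^(-1/2) = |t|^(-1/2) exp(- i sgn(t) pi / 4). *)
Definition schrodinger_kernel (t x : R) : R[i] :=
  ((Num.sqrt (4 * pi * `|t|))^-1)%:C *
  cexpi (x ^+ 2 / (4 * t) - Num.sg t * (pi / 4)).

(* psi = exp(i t Delta) phi in L^2(R; C).  For t <> 0 the kernel is not
   absolutely integrable against a general phi in L^2; as for the
   Fourier-Plancherel transform, psi is the L^2-limit of the integrals over
   [-n, n]. *)
Definition is_free_evolution (t : R) (phi psi : R -> R[i]) : Prop :=
  [/\ in_L2 phi, in_L2 psi &
    if t == 0 then {ae mu, forall x, psi x = phi x}
    else (fun n : nat => cLnorm 2%:E (fun x => psi x -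
            cintegral `[- n%:R, n%:R]
              (fun y => schrodinger_kernel t (x - y) * phi y))) @ \oo
         --> 0%E].

End ComplexLebesgue.

Section BoundStates.
Variable R : realType.
Local Notation mu := (@lebesgue_measure R).

Definition test_function (psi : R -> R) : Prop :=
  (forall n x, derivable (derive1n n psi) x 1) /\
  compact (closure [set x | psi x != 0]).

Definition weak_derivative (phi dphi : R -> R) : Prop :=
  forall psi, test_function psi ->
    \int[mu]_x (phi x * derive1 psi x) = - \int[mu]_x (dphi x * psi x).

Definition in_H1 (phi : R -> R) : Prop :=
  phi \in Lfun mu 2%:E /\
  exists dphi, dphi \in Lfun mu 2%:E /\ weak_derivative phi dphi.

(* - phi'' + omega phi = f(phi) in the sense of distributions. *)
Definition bound_state_eq (f : R[i] -> R[i]) (omega : R) (phi : R -> R) : Prop :=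
  forall psi, test_function psi ->
    (\int[mu]_x (- (phi x * derive1n 2 psi x) + omega * phi x * psi x))%:C =
    cintegral setT (fun x => f (phi x)%:C * (psi x)%:C).

(* Dimension 1, where alpha_max = +oo puts no upper bound on alpha2. *)
Definition assumption_F (f : R[i] -> R[i]) (alpha1 alpha2 : R) : Prop :=
  [/\ 0 < alpha1, alpha1 <= alpha2 &
   exists g : R -> R,
   [/\ forall z, f z = (g (cmod z ^+ 2))%:C * z,
       {within `[0, +oo[, continuous g},
       forall s, 0 < s -> [/\ derivable g s 1, derivable (derive1 g) s 1 &
                             {for s, continuous (derive1n 2 g)}],
       g 0 = 0 &
       exists2 C0, 0 < C0 & forall s, 0 < s ->
         `|s * derive1 g s| + `|s ^+ 2 * derive1n 2 g s| <=
         C0 * (s `^ (alpha1 / 2) + s `^ (alpha2 / 2))]].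

(* phi omega is the bound state of frequency omega.  The pointwise bound on its
   gradient at every x selects the everywhere differentiable representative. *)
Definition assumption_T (f : R[i] -> R[i]) (alpha1 omega_star a D : R)
    (phi : R -> R -> R) : Prop :=
  [/\ 0 < omega_star, 0 < a < 1, 0 < D &
   forall omega, 0 < omega < omega_star ->
   [/\ in_H1 (phi omega),
       exists x, phi omega x != 0,
       bound_state_eq f omega (phi omega),
       forall x, derivable (phi omega) x 1 &
       forall x, `|phi omega x| + omega `^ (- 2^-1) * `|derive1 (phi omega) x| <=
         D * omega `^ alpha1^-1 * expR (- (a * omega `^ 2^-1 * `|x|))]].

End BoundStates.

Section Solitons.
Variable R : realType.
Local Notation mu := (@lebesgue_measure R).

Definition soliton (phi : R -> R -> R) (omega v gamma t x : R) : R[i] :=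
  cexpi (omega * t + 2^-1 * v * x - 4^-1 * v ^+ 2 * t + gamma) *
  (phi omega (x - v * t))%:C.

Definition soliton_train (phi : R -> R -> R) (omega v gamma : nat -> R)
    (j : nat) (t x : R) : R[i] :=
  soliton phi (omega j) (v j) (gamma j) t x.

(* The velocities are pairwise distinct: otherwise consecutive solitons could
   be chosen to cancel, R_{2k+1} = - R_{2k}, leaving no train at all. *)
Definition infinite_soliton_profile (omega_star : R) (phi : R -> R -> R)
    (omega v gamma : nat -> R) (T : R -> R -> R[i]) : Prop :=
  [/\ forall j, 0 < omega j < omega_star,
      injective v &
      forall t x,
        cseries_cvg (fun j => soliton_train phi omega v gamma j t x) (T t x)].

(* u = T + eta solves i u_t + u_xx + f(u) = 0 for t >= 0, for a profile
   T = sum_j Rj, in the Duhamel sense: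
   eta(t) = - i int_t^oo e^{i(t - tau) Delta}
                         [f(T + eta) - sum_j f(Rj)](tau) dtau  in L^2. *)
Definition duhamel_solution (f : R[i] -> R[i]) (Rj : nat -> R -> R -> R[i])
    (T eta : R -> R -> R[i]) : Prop :=
  exists SfR : R -> R -> R[i],
    (forall t x, 0 <= t -> cseries_cvg (fun j => f (Rj j t x)) (SfR t x)) /\
    forall t, 0 <= t -> exists G : R -> R -> R[i], exists V : R -> R[i],
      [/\ {ae mu, forall tau, t < tau ->
             is_free_evolution (t - tau)
               (fun x => f (T tau x + eta tau x) - SfR tau x) (G tau)},
          is_L2_integral `]t, +oo[ G V &
          in_L2 (eta t) /\ {ae mu, forall x, eta t x = - 'i * V x}].

End Solitons.

(* Main.v *)
Require Import Defs.
From mathcomp Require Import all_boot all_order all_algebra.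
From mathcomp Require Import all_classical all_reals all_analysis.
From mathcomp Require Import ess_sup_inf measurable_realfun complex ring lra.

(** The train is built from solitons whose amplitudes decrease geometrically
    and whose speeds are proportional to the decay rate and to their widths, and
    the perturbation is found by Picard iteration in a space of functions that
    decay like [exp (- l t)] in [L^2] and in [Loo].

    For the train, write [R_j] for the solitons. Two of them separate so fast
    that at any point all but one are smaller than [exp (- l t)]
    ([dominant_soliton]). Since [f] is Lipschitz on discs, with a constant that
    grows at least linearly in the radius ([nonlinearity_lipschitz], where
    [1 <= alpha1] enters), the interaction [f (T) - sum f (R_j)] is at most
    [exp (- l t)] times a potential, a sum of the profiles of the solitons
    weighted by their Lipschitz constants ([interaction_source]). Wide solitons
    are so small that the potential is bounded and integrable, uniformly in time
    and in [l] ([potential_le4], [ibound_potential]). The same potential controls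
    the dependence on the perturbation ([interaction_lipschitz]).

    For the Duhamel operator, the source is integrable and square-integrable.
    The kernel of the free evolution is bounded by [(4 pi |s|)^(-1/2)], and
    integrating this against [exp (- l s)] gains [l^(-1/2)] in the supremum norm.
    The [L^2] norm is controlled by boundedness of the free evolution on [L^2],
    which amounts to a Plancherel inequality for the chirps [exp (i k (x - y)^2)]:
    composing the transform with its adjoint, weighted by a parabola, leaves a
    kernel dominated by a Cauchy kernel of fixed mass ([chirp_plancherel]). Together these say that the Duhamel operator maps
    sources to states with a factor of order [l^(-1/2)] ([duh_state]), so that
    for large [l] the Duhamel map is a contraction of a ball
    ([duhamel_fixed_point]).

    All functions are defined everywhere and all estimates hold at every point;
    complex integrals are split into real and imaginary parts. That the pointwise
    Duhamel integral is also the integral in [L^2] of the free evolutions is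
    Fubini's theorem ([cduh_is_L2_integral]). *)

Set Implicit Arguments.
Unset Strict Implicit.
Unset Printing Implicit Defensive.

Import Order.TTheory GRing.Theory Num.Theory.
Import numFieldNormedType.Exports.

Local Open Scope ring_scope.
Local Open Scope complex_scope.
Local Open Scope classical_set_scope.

(** * Integration on the line *)

Section RealIntegrals.
Variable R : realType.
Local Notation mu := (@lebesgue_measure R).

Lemma integral_EFin_pos_neg d (T : measurableType d) (m : {measure set T -> \bar R})
    (D : set T) (f : T -> R) :
  (\int[m]_(x in D) (f x)%:E =
   \int[m]_(x in D) (Num.max (f x) 0)%:E - \int[m]_(x in D) (Num.max (- f x) 0)%:E)%E.
Proof.
rewrite integralE; congr (_ - _)%E; apply: eq_integral => x _.
  by rewrite funeposE EFin_max.
by rewrite funenegE EFin_max EFinN.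
Qed.

Lemma measurable_fun_ge0_integral d (T : measurableType d) (f : T * R -> R) :
  measurable_fun setT f -> (forall z, 0 <= f z) ->
  measurable_fun setT ((fun x => \int[mu]_y (f (x, y))%:E) : T -> \bar R)%E.
Proof.
move=> mf f0.
apply: (@measurable_fun_fubini_tonelli_F _ _ _ _ _ mu (EFin \o f)) => //.
by exact/measurable_EFinP.
Qed.

Lemma measurable_fun_Rintegral d (T : measurableType d) (f : T * R -> R) :
  measurable_fun setT f ->
  measurable_fun setT (fun x => \int[mu]_y f (x, y)).
Proof.
move=> mf; rewrite /Rintegral.
apply: (measurableT_comp (fine_measurable measurableT)).
under eq_fun do rewrite integral_EFin_pos_neg.
apply: emeasurable_funB.
  apply: (measurable_fun_ge0_integral (f := fun z => Num.max (f z) 0)).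
    exact: measurable_maxr.
  by move=> z; rewrite le_max lexx orbT.
apply: (measurable_fun_ge0_integral (f := fun z => Num.max (- f z) 0)).
  by apply: measurable_maxr => //; exact: measurableT_comp.
by move=> z; rewrite le_max lexx orbT.
Qed.

Lemma Rintegral_swap (f : R * R -> R) :
  measurable_fun setT f ->
  (\int[mu]_x \int[mu]_y `|f (x, y)|%:E < +oo)%E ->
  \int[mu]_x \int[mu]_y f (x, y) = \int[mu]_y \int[mu]_x f (x, y).
Proof.
move=> mf foo.
have mEf : measurable_fun setT (EFin \o f) by exact/measurable_EFinP.
have itf : (mu \x mu)%E.-integrable setT (EFin \o f).
  exact: (integrable12ltyP mu mu mEf).2 foo.
have e1 : (\int[mu]_x (\int[mu]_y f (x, y))%:E =
           \int[mu]_x \int[mu]_y (f (x, y))%:E)%E.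
  apply: ae_eq_integral => //.
  - by apply/measurable_EFinP; exact: measurable_fun_Rintegral.
  - exact: (measurable_fubini_F itf).
  - apply: filterS (ae_integrable1 itf) => x ix _.
    by rewrite /Rintegral fineK//; apply: integrable_fin_num.
have e2 : (\int[mu]_y (\int[mu]_x f (x, y))%:E =
           \int[mu]_y \int[mu]_x (f (x, y))%:E)%E.
  apply: ae_eq_integral => //.
  - apply/measurable_EFinP.
    apply: (measurable_fun_Rintegral (f := fun z => f (z.2, z.1))).
    by apply: measurableT_comp => //; exact: measurable_fun_pair.
  - exact: (measurable_fubini_G itf).
  - apply: filterS (ae_integrable2 itf) => x ix _.
    by rewrite /Rintegral fineK//; apply: integrable_fin_num.
exact: (congr1 fine (etrans e1 (etrans (Fubini itf) (esym e2)))).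
Qed.

Lemma integrable_lty (f : R -> R) : measurable_fun setT f ->
  (\int[mu]_x `|f x|%:E < +oo)%E -> mu.-integrable setT (EFin \o f).
Proof. by move=> mf foo; apply/integrableP; split => //; exact/measurable_EFinP. Qed.

Lemma le_ge0_integral (D : set R) (f g : R -> R) : measurable D ->
  measurable_fun setT f -> measurable_fun setT g ->
  (forall x, D x -> 0 <= f x <= g x) ->
  (\int[mu]_(x in D) (f x)%:E <= \int[mu]_(x in D) (g x)%:E)%E.
Proof.
move=> mD mf mg fg; apply: ge0_le_integral => //.
- by move=> x /fg /andP[]; rewrite lee_fin.
- by apply/measurable_EFinP; exact: measurable_funTS.
- by apply/measurable_EFinP; exact: measurable_funTS.
- by move=> x /fg /andP[]; rewrite lee_fin.
Qed.

Lemma integrable_dominated (f g : R -> R) : measurable_fun setT f ->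
  mu.-integrable setT (EFin \o g) -> (forall x, `|f x| <= g x) ->
  mu.-integrable setT (EFin \o f).
Proof.
move=> mf ig fg; apply: (le_integrable measurableT _ _ ig).
  exact/measurable_EFinP.
by move=> x _ /=; rewrite lee_fin (le_trans (fg x))// ler_norm.
Qed.

Lemma derivable_cvg_right (F : R -> R) (b : R) :
  derivable F b 1 -> F x @[x --> b^'+] --> F b.
Proof.
move=> /derivable1_diffP dF; apply: cvg_at_right_filter.
exact: (differentiable_continuous dF).
Qed.

Lemma ge0_integral_affine (G : R -> R) (k b : R) : 0 < k ->
  continuous G -> (forall x, 0 <= G x) ->
  (\int[mu]_x (G x)%:E = \int[mu]_x (k * G (k * (x - b)))%:E)%E.
Proof.
move=> k0 cG G0.
have dF (x : R) : is_derive x (1 : R) (fun x : R => k * (x - b)) k.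
  by apply: is_derive_eq; rewrite subr0 /GRing.scale /= mulr1.
have dFE : (fun x : R => k * (x - b))^`() = cst k.
  by apply/funext => x; rewrite derive1E; have [_ ->] := dF x.
rewrite (@increasing_ge0_integration_by_substitutionT R (fun x => k * (x - b)) G) //.
- rewrite dFE; apply: eq_integral => x _.
  by congr EFin; rewrite /= mulrC.
- by move=> x y xy; rewrite ltr_pM2l// ltrD2r.
- by rewrite dFE => x; exact: cst_continuous.
- by rewrite dFE; exact: is_cvg_cst.
- by rewrite dFE; exact: is_cvg_cst.
- apply/cvgrNyPle => M; near=> x.
  rewrite -ler_pdivlMl// lerBlDr; near: x.
  by apply: nbhs_ninfty_le; rewrite num_real.
- apply/cvgryPge => M; near=> x.
  rewrite -ler_pdivrMl// lerBrDr; near: x.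
  by apply: nbhs_pinfty_ge; rewrite num_real.
Unshelve. all: end_near. Qed.

Lemma integral_Cauchy_kernel (k b : R) : 0 < k ->
  (\int[mu]_x ((1 + (k * (x - b)) ^+ 2)^-1)%:E = (pi / k)%:E)%E.
Proof.
move=> k0.
have cG : continuous (fun x : R => (1 + x ^+ 2)^-1) by exact: continuous_oneDsqrV.
have G0 (x : R) : 0 <= (1 + x ^+ 2)^-1 by rewrite invr_ge0 addr_ge0// sqr_ge0.
have key : (\int[mu]_x ((1 + x ^+ 2)^-1)%:E = pi%:E)%E.
  rewrite ge0_symfun_integralT//; last by move=> x /=; rewrite sqrrN.
  by rewrite -set_itvcy integral0y_oneDsqr -EFinM mulrC mulfVK.
have mG : measurable_fun setT (fun x : R => (1 + (k * (x - b)) ^+ 2)^-1).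
  apply: (measurableT_comp (continuous_measurable_fun cG)).
  by apply: measurable_funM => //; exact: measurable_funB.
rewrite (ge0_integral_affine b k0 cG G0) in key.
rewrite (_ : (pi / k)%:E = (k^-1)%:E * pi%:E)%E; last by rewrite -EFinM mulrC.
rewrite -key -ge0_integralZl//.
- by apply: eq_integral => x _; rewrite -EFinM mulKf// gt_eqF.
- by apply/measurable_EFinP; apply: measurable_funM.
- by move=> x _; rewrite lee_fin mulr_ge0// ltW.
- by rewrite lee_fin invr_ge0 ltW.
Qed.

Lemma integral_expR_abs (k b : R) : 0 < k ->
  (\int[mu]_x (expR (- (k * `|x - b|)))%:E = (2 / k)%:E)%E.
Proof.
move=> k0.
have cG : continuous (fun x : R => expR (- `|x|)).
  move=> x; apply: continuous_comp; last exact: continuous_expR.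
  by apply: cvgN; exact: norm_continuous.
have G0 (x : R) : 0 <= expR (- `|x|) by exact: expR_ge0.
have key : (\int[mu]_x (expR (- `|x|))%:E = 2%:E)%E.
  rewrite ge0_symfun_integralT//; last by move=> x /=; rewrite normrN.
  rewrite -set_itvcy.
  rewrite (_ : (\int[mu]_(x in `[0%R, +oo[) (expR (- `|x|))%:E)%E = 1%:E) ?mule1//.
  transitivity (\int[mu]_(x in `[0%R, +oo[) (expR (- x))%:E)%E.
    apply: eq_integral => x; rewrite inE/= in_itv/= andbT => x0.
    by rewrite ger0_norm.
  have dF (x : R) : is_derive x 1 (fun x : R => - expR (- x)) (expR (- x)).
    by apply: is_derive_eq; rewrite /GRing.scale /= mulrN1 opprK.
  rewrite (@ge0_continuous_FTC2y R (fun x => expR (- x)) (fun x => - expR (- x)) 0 0).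
  - by rewrite oppr0 expR0 EFinN sub0e oppeK.
  - by move=> x _; exact: expR_ge0.
  - apply: continuous_subspaceT => x; apply: continuous_comp; last exact: continuous_expR.
    exact: opp_continuous.
  - rewrite -oppr0; apply: cvgN; exact: cvgr_expR.
  - by move=> x _; have [] := dF x.
  - by apply: derivable_cvg_right; have [] := dF 0.
  - by move=> x _; rewrite derive1E; have [_ ->] := dF x.
have mG : measurable_fun setT (fun x : R => expR (- (k * `|x - b|))).
  apply: (measurableT_comp (f := @expR R) (@measurable_expR R)).
  apply: measurableT_comp => //; apply: measurable_funM => //.
  by apply: measurableT_comp => //; exact: measurable_funB.
rewrite (ge0_integral_affine b k0 cG G0) in key.
rewrite (_ : (2 / k)%:E = (k^-1)%:E * 2%:E)%E; last by rewrite -EFinM mulrC.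
rewrite -key -ge0_integralZl//.
- by apply: eq_integral => x _; rewrite -EFinM mulKf ?gt_eqF// normrM gtr0_norm.
- apply/measurable_EFinP; apply: measurable_funM => //.
  by under eq_fun do rewrite normrM gtr0_norm//.
- by move=> x _; rewrite lee_fin mulr_ge0 ?expR_ge0// ltW.
- by rewrite lee_fin invr_ge0 ltW.
Qed.

Lemma integral_expR_tail (k t : R) : 0 < k ->
  (\int[mu]_(x in `]t, +oo[) (expR (- (k * x)))%:E = (expR (- (k * t)) / k)%:E)%E.
Proof.
move=> k0; rewrite integral_itv_obnd_cbnd; last first.
  apply/measurable_EFinP/measurable_funTS.
  apply: (measurableT_comp (f := @expR R) (@measurable_expR R)).
  by apply: measurableT_comp => //; exact: measurable_funM.
have dF (x : R) : is_derive x 1 (fun x : R => - (expR (- (k * x)) / k)) (expR (- (k * x))).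
  apply: is_derive_eq; rewrite /GRing.scale /=.
  by field; rewrite gt_eqF.
rewrite (@ge0_continuous_FTC2y R (fun x => expR (- (k * x)))
  (fun x => - (expR (- (k * x)) / k)) t 0).
- by rewrite EFinN sub0e oppeK.
- by move=> x _; exact: expR_ge0.
- apply: continuous_subspaceT => x; apply: continuous_comp; last exact: continuous_expR.
  by apply: cvgN; apply: cvgMl_tmp; exact: cvg_id.
- rewrite -oppr0 -(mul0r k^-1); apply: cvgN; apply: cvgMr_tmp.
  apply: (cvg_comp (fun x => k * x) (fun x => expR (- x)) _ (@cvgr_expR R)).
  apply/cvgryPge => M; near=> x.
  by rewrite -ler_pdivrMl//; near: x.
- by move=> x _; have [] := dF x.
- by apply: derivable_cvg_right; have [] := dF t.
- by move=> x _; rewrite derive1E; have [_ ->] := dF x.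
Unshelve. all: end_near. Qed.

End RealIntegrals.

(** * Measurability and explicit integrals *)

Section Measurability.
Variable R : realType.
Local Notation mu := (@lebesgue_measure R).
Variables (d : measure_display) (T : measurableType d).
Implicit Types f g h k : T -> R.

Lemma measurable_fun_cos f : measurable_fun setT f ->
  measurable_fun setT (fun x => cos (f x)).
Proof. by apply: measurableT_comp; apply: continuous_measurable_fun; exact: continuous_cos. Qed.

Lemma measurable_fun_sin f : measurable_fun setT f ->
  measurable_fun setT (fun x => sin (f x)).
Proof. by apply: measurableT_comp; apply: continuous_measurable_fun; exact: continuous_sin. Qed.

Lemma measurable_fun_expR f : measurable_fun setT f ->
  measurable_fun setT (fun x => expR (f x)).
Proof. by apply: measurableT_comp; exact: measurable_expR. Qed.

Lemma measurable_fun_sqrt f : measurable_fun setT f ->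
  measurable_fun setT (fun x => Num.sqrt (f x)).
Proof. by apply: measurableT_comp; apply: continuous_measurable_fun; exact: sqrt_continuous. Qed.

Lemma measurable_fun_normr f : measurable_fun setT f ->
  measurable_fun setT (fun x => `|f x|).
Proof. by move=> mf; exact: measurableT_comp. Qed.

Lemma measurable_fun_oppr f : measurable_fun setT f ->
  measurable_fun setT (fun x => - f x).
Proof. by move=> mf; exact: measurableT_comp. Qed.

Lemma measurable_fun_invr f : measurable_fun setT f ->
  measurable_fun setT (fun x => (f x)^-1).
Proof.
(* Real powers are measurable, but only agree with inversion at nonnegative
   bases: hence the square; at 0 both sides are 0. *)
move=> mf; rewrite (_ : (fun x => _) = fun x => f x * (f x ^+ 2) `^ (-1)).
  apply: measurable_funM => //; apply: (measurableT_comp (measurable_powR (-1))).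
  exact: measurable_funX.
apply/funext => x; rewrite powR_inv1 ?sqr_ge0//.
have [->|fx0] := eqVneq (f x) 0; first by rewrite invr0 mul0r.
by rewrite -exprVn expr2 mulrA divff// mul1r.
Qed.

Lemma measurable_fun_ltr_if f g h k : measurable_fun setT f -> measurable_fun setT g ->
  measurable_fun setT h -> measurable_fun setT k ->
  measurable_fun setT (fun x => if f x < g x then h x else k x).
Proof. by move=> mf mg mh mk; apply: measurable_fun_ifT => //; exact: measurable_fun_ltr. Qed.

Lemma measurable_fun_sg f : measurable_fun setT f ->
  measurable_fun setT (fun x => Num.sg (f x)).
Proof.
move=> mf; rewrite (_ : (fun x => _) =
    fun x => if f x < 0 then -1 else if 0 < f x then 1 else 0).
  by do ![done|exact: measurable_cst|apply: measurable_fun_ltr_if].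
by apply/funext => x; case: sgrP.
Qed.

End Measurability.

(** Follows the head symbol of the function, which is much faster than trying
    all the lemmas by unification; the latter is left for compositions. *)
Ltac meas_step := lazymatch goal with
  | |- measurable_fun _ (fun x => cos _) => apply: measurable_fun_cos
  | |- measurable_fun _ (fun x => sin _) => apply: measurable_fun_sin
  | |- measurable_fun _ (fun x => expR _) => apply: measurable_fun_expR
  | |- measurable_fun _ (fun x => Num.sqrt _) => apply: measurable_fun_sqrt
  | |- measurable_fun _ (fun x => `|_|) => apply: measurable_fun_normr
  | |- measurable_fun _ (fun x => - _) => apply: measurable_fun_oppr
  | |- measurable_fun _ (fun x => _ + _) => apply: measurable_funD
  | |- measurable_fun _ (fun x => _ * _) => apply: measurable_funM
  | |- measurable_fun _ (fun x => _^-1) => apply: measurable_fun_invr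
  | |- measurable_fun _ (fun x => _ ^+ _) => apply: measurable_funX
  | |- measurable_fun _ (fun x => if _ < _ then _ else _) =>
      apply: measurable_fun_ltr_if
  | |- measurable_fun _ (fun x => Num.max _ _) => apply: measurable_maxr
  | |- measurable_fun _ (fun x => Num.sg _) => apply: measurable_fun_sg
  | |- measurable_fun _ (fun x => (_, _)) => apply: measurable_fun_pair
  | |- _ => first
    [ done | exact: measurable_cst | exact: measurable_fst
    | exact: measurable_snd | assumption
    | apply: measurable_fun_normr
    | apply: measurable_funB | apply: measurable_funD
    | apply: measurable_funM | apply: measurable_fun_oppr
    | (apply: measurableT_comp; first assumption)
    | apply: (measurableT_comp measurable_fst)
    | apply: (measurableT_comp measurable_snd)
    | apply: measurable_fun_pair ]
  end.

Ltac meas := repeat first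
  [ match goal with h : ?G |- ?G => exact h end | meas_step ].

Section Elementary.
Variable R : realType.
Local Notation mu := (@lebesgue_measure R).

Lemma normr_Rintegral_le (f : R -> R) : measurable_fun setT f ->
  (`|\int[mu]_x f x|%:E <= \int[mu]_x `|f x|%:E)%E.
Proof.
move=> mf; have mEf : measurable_fun setT (EFin \o f) by exact/measurable_EFinP.
apply: le_trans (le_abse_integral mu measurableT mEf).
rewrite /Rintegral; case: (\int[mu]_x _)%E => [r| |] //=; rewrite ?normr0 ?leey//.
Qed.

Lemma Rintegral_FTC (f F : R -> R) (b c : R) : b < c -> continuous f ->
  (forall x, is_derive x (1 : R) F (f x)) ->
  \int[mu]_(x in `[b, c]) f x = F c - F b.
Proof.
move=> bc cf dF; rewrite /Rintegral (@continuous_FTC2 _ f F)//.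
- exact: continuous_subspaceT.
- split.
  + by move=> x _; have [] := dF x.
  + by apply: derivable_cvg_right; have [] := dF b.
  + apply: cvg_at_left_filter; have [/derivable1_diffP dc _] := dF c.
    exact: (differentiable_continuous dc).
- by move=> x _; rewrite derive1E; have [_ ->] := dF x.
Qed.

(** The time integral of the dispersive factor. Since [expR y >= 1 + y], the
    exponential may be replaced by a rational function whose product with the
    inverse square root has an arctangent as primitive. The resulting power of
    [l] is the small factor of the whole construction. *)
Lemma integral_invsqrt_expR (l t : R) : 0 < l ->
  (\int[mu]_(x in `]t, +oo[) ((Num.sqrt (x - t))^-1 * expR (- (l * (x - t))))%:E
   <= (pi / Num.sqrt l)%:E)%E.
Proof.
move=> l0; have sl0 : 0 < Num.sqrt l by rewrite sqrtr_gt0.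
pose g x := (Num.sqrt (x - t))^-1 * (1 + l * (x - t))^-1.
pose G x := 2 / Num.sqrt l * atan (Num.sqrt l * Num.sqrt (x - t)).
have mg : measurable_fun setT g by rewrite /g; meas.
apply: (@le_trans _ _ (\int[mu]_(x in `]t, +oo[) (g x)%:E)%E).
  apply: le_ge0_integral => //; first by meas.
  move=> x; rewrite /= in_itv/= andbT => tx.
  have st0 : 0 < Num.sqrt (x - t) by rewrite sqrtr_gt0 subr_gt0.
  have lx0 : 0 < l * (x - t) by rewrite mulr_gt0// subr_gt0.
  apply/andP; split; first by rewrite mulr_ge0 ?invr_ge0 ?expR_ge0 ?ltW.
  apply: ltW; rewrite /g expRN ltr_pM2l ?invr_gt0// ltf_pV2 ?posrE ?expR_gt0//.
    by apply: expR_gt1Dx; rewrite gt_eqF.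
  by rewrite addr_gt0.
have dG x : t < x -> is_derive x (1 : R) G (g x).
  move=> tx; have st0 : 0 < Num.sqrt (x - t) by rewrite sqrtr_gt0 subr_gt0.
  have d1 : is_derive x (1:R) (fun x => Num.sqrt (x - t)) (2 * Num.sqrt (x - t))^-1.
    have h : is_derive (x - t) (1:R) (@Num.sqrt R) (2 * Num.sqrt (x - t))^-1.
      by apply: is_derive1_sqrt; rewrite subr_gt0.
    have h1 : is_derive x (1:R) (fun x : R => x - t) 1 by apply: is_derive_eq; rewrite subr0.
    by rewrite -[X in is_derive _ _ _ X]mulr1; exact: (@is_derive1_comp R Num.sqrt (fun x : R => x - t)).
  rewrite /G; apply: is_derive_eq.
  rewrite /GRing.scale/= /g exprMn !sqr_sqrtr ?ltW// ?subr_gt0//.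
  have := gt_eqF sl0; have := gt_eqF st0.
  have : 1 + l * (x - t) != 0 by rewrite gt_eqF// addr_gt0// mulr_gt0// subr_gt0.
  move=> h1 h2 h3; field.
  by rewrite h1 h2 h3.
pose F n := `[t + n.+1%:R^-1, +oo[%classic : set R.
have FU : `]t, +oo[%classic = \bigcup_n F n :> set R.
  apply/seteqP; split => x /=.
    rewrite in_itv/= andbT => tx.
    have [n hn] := ltr_add_invr tx.
    by exists n => //; rewrite /F/= in_itv/= ltW.
  move=> [n _]; rewrite /F/= !in_itv/= !andbT; apply: lt_le_trans.
  by rewrite ltrDl.
have cv : (\int[mu]_(x in F n) (g x)%:E)%E @[n --> \oo] --> (\int[mu]_(x in `]t, +oo[) (g x)%:E)%E.
  rewrite FU; apply: ge0_nondecreasing_set_cvg_integral.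
  - move=> m n mn; apply/subsetPset => x; rewrite /F/= !in_itv/= !andbT.
    by apply: le_trans; rewrite lerD2l lef_pV2 ?posrE// ler_nat.
  - by move=> n; exact: measurable_itv.
  - by move=> n; apply/measurable_EFinP; exact: measurable_funTS.
  - move=> n x; rewrite /F/= in_itv/= andbT => tx; rewrite lee_fin.
    have : 0 <= x - t by rewrite subr_ge0 (le_trans _ tx)// lerDl.
    by move=> xt0; rewrite /g mulr_ge0 ?invr_ge0 ?sqrtr_ge0// addr_ge0// mulr_ge0// ltW.
rewrite -(cvg_lim _ cv)//; apply: lime_le; first exact: cvgP cv.
apply: nearW => n; rewrite /F.
have tn : t < t + n.+1%:R^-1 by rewrite ltrDl.
rewrite (@ge0_continuous_FTC2y R g G _ (2 / Num.sqrt l * (pi / 2))).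
- rewrite -EFinB lee_fin.
  rewrite (_ : 2 / Num.sqrt l * (pi / 2) = pi / Num.sqrt l); last first.
    by field; rewrite gt_eqF.
  rewrite gerBl /G mulr_ge0 ?divr_ge0 ?(ltW sl0)//.
  have := @le_atan R 0 (Num.sqrt l * Num.sqrt (t + n.+1%:R^-1 - t)).
  by rewrite atan0; apply; rewrite mulr_ge0 ?sqrtr_ge0.
- move=> x tx; have : 0 <= x - t by rewrite subr_ge0 (le_trans _ tx)// ltW.
  by move=> xt0; rewrite /g mulr_ge0 ?invr_ge0 ?sqrtr_ge0// addr_ge0// mulr_ge0// ltW.
- apply: continuous_in_subspaceT => x; rewrite inE/= in_itv/= andbT => tx.
  have xt0 : 0 < x - t by rewrite subr_gt0 (lt_le_trans tn).
  have cs : {for x, continuous (fun x => x - t)}.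
    by apply: cvgB; [exact: cvg_id|exact: cvg_cst].
  rewrite /g; apply: cvgM.
    apply: cvgV; first by rewrite gt_eqF// sqrtr_gt0.
    by apply: continuous_comp => //; exact: sqrt_continuous.
  apply: cvgV; first by rewrite gt_eqF// addr_gt0// mulr_gt0.
  by apply: cvgD; [exact: cvg_cst|apply: cvgMl_tmp].
- apply: cvgMl_tmp; apply: (cvg_comp (fun x => Num.sqrt l * Num.sqrt (x - t)) _ _ (@cvgy_atan R)).
  apply/cvgryPge => M; near=> x.
  rewrite -ler_pdivrMl// (le_trans (ler_norm _))// -sqrtr_sqr.
  apply: ler_wsqrtr; rewrite lerBrDr; near: x.
  by apply: nbhs_pinfty_ge; rewrite num_real.
- by move=> x tx; have [] := dG x (lt_trans tn tx).
- by apply: derivable_cvg_right; have [] := dG _ tn.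
- move=> x; rewrite in_itv/= andbT => tx.
  by rewrite derive1E; have [_ ->] := dG x (lt_trans tn tx).
Unshelve. all: end_near. Qed.

(** The cut-off of the Plancherel argument. Continuity at the end points makes
    its cosine transform decay quadratically, and a parabola is the simplest
    such profile with an elementary antiderivative against a cosine. *)
Definition pweight (N x : R) : R := Num.max 0 (1 - (x / N) ^+ 2).

Lemma pweight_ge0 (N x : R) : 0 <= pweight N x.
Proof. by rewrite le_max lexx. Qed.

Lemma pweight_le1 (N x : R) : pweight N x <= 1.
Proof. by rewrite ge_max ler01 gerBl sqr_ge0. Qed.

Lemma pweight_in (N x : R) : 0 < N -> -N <= x <= N -> pweight N x = 1 - (x / N) ^+ 2.
Proof.
move=> N0 /andP[Nx xN]; apply/max_idPr.
have : -1 <= x / N by rewrite ler_pdivlMr// mulN1r.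
have : x / N <= 1 by rewrite ler_pdivrMr// mul1r.
by move: (x / N) => u; nra.
Qed.

Lemma pweight_out (N x : R) : 0 < N -> ~ (-N <= x <= N) -> pweight N x = 0.
Proof.
move=> N0 xN; apply/max_idPl.
have [Nx|] := leP (-N) x; last first.
  rewrite -mulN1r -ltr_pdivrMr//; move: (x / N) => u; nra.
have [xN'|] := leP x N; first by exfalso; apply: xN; rewrite Nx.
by rewrite -[X in X < _]mul1r -ltr_pdivlMr//; move: (x / N) => u; nra.
Qed.

Lemma measurable_pweight (N : R) : measurable_fun setT (pweight N).
Proof. by rewrite /pweight; meas. Qed.

Lemma integral_pweight_le (N : R) : 0 < N -> (\int[mu]_x (pweight N x)%:E <= (2 * N)%:E)%E.
Proof.
move=> N0; have -> : (2 * N)%:E = (\int[mu]_(x in `[(- N)%R, N]) 1)%E.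
  rewrite integral_cst// mul1e; have /= -> := @lebesgue_measure_itv R `[- N, N]%R.
  rewrite lte_fin ifT; last by lra.
  by rewrite -EFinB; congr EFin; ring.
rewrite [leRHS]integral_mkcond; apply: ge0_le_integral => //.
- by move=> x _; rewrite lee_fin pweight_ge0.
- by apply/measurable_EFinP; exact: measurable_pweight.
- by apply/(measurable_restrictT _ _).1 => //; exact: measurable_cst.
move=> x _; rewrite patchE; case: ifPn => [_|]; first by rewrite lee_fin pweight_le1.
by rewrite notin_setE/= in_itv/= => /(pweight_out N0) ->.
Qed.

Lemma integrable_pweight (N : R) : 0 < N -> mu.-integrable setT (EFin \o pweight N).
Proof.
move=> N0; apply: integrable_lty; first exact: measurable_pweight.
apply: le_lt_trans (ltry (2 * N)); rewrite (le_trans _ (integral_pweight_le N0))//.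
by under eq_integral do rewrite ger0_norm ?pweight_ge0//.
Qed.

(** For [N |be| < 1] the mass of the weight suffices; otherwise two integrations
    by parts, in which the first boundary term vanishes with the weight, gain
    [(N be)^-2]. The bound is the Cauchy kernel because its integral in [be]
    does not depend on [N]. *)
Lemma Rintegral_pweight_cos (N al be : R) : 0 < N ->
  `|\int[mu]_x (pweight N x * cos (al - be * x))| <= 16 * N / (1 + (N * be) ^+ 2).
Proof.
move=> N0; have D0 : 0 < 1 + (N * be) ^+ 2 by rewrite ltr_wpDr ?sqr_ge0.
have [small|large] := ltP ((N * be) ^+ 2) 1.
  apply: (@le_trans _ _ (2 * N)).
    rewrite -lee_fin; apply: (le_trans (normr_Rintegral_le _)).
      by apply: measurable_funM; [exact: measurable_pweight|meas].
    apply: le_trans (integral_pweight_le N0).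
    apply: le_ge0_integral => //; [|exact: measurable_pweight|].
      by apply: measurable_fun_normr; apply: measurable_funM; [exact: measurable_pweight|meas].
    move=> x _; rewrite normr_ge0/= normrM (ger0_norm (pweight_ge0 _ _)).
    by rewrite ler_piMr ?pweight_ge0// cos_max.
  rewrite ler_pdivlMr//.
  have : 0 <= N * (1 - (N * be)^+2) by rewrite mulr_ge0 ?subr_ge0 ?ltW.
  by move: ((N*be)^+2) => u; nra.
have be0 : be != 0 by apply: contraTneq large => ->; rewrite mulr0 expr0n/= -ltNge.
have Nn0 : N != 0 by rewrite gt_eqF.
pose w x := 1 - (x / N) ^+ 2.
(* The antiderivative of [w x * cos (al - be * x)]. *)
pose P x := - (w x * sin (al - be * x) / be)
  - (2 * x / (N ^+ 2 * be ^+ 2)) * cos (al - be * x)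
  - 2 / (N ^+ 2 * be ^+ 3) * sin (al - be * x).
have -> : \int[mu]_x (pweight N x * cos (al - be * x)) =
          \int[mu]_(x in `[-N, N]) (w x * cos (al - be * x)).
  rewrite [RHS]Rintegral_mkcond; apply: eq_Rintegral => x _.
  rewrite patchE; case: ifPn.
    by rewrite inE/= in_itv/= => /(pweight_in N0) ->.
  by rewrite notin_setE/= in_itv/= => /(pweight_out N0) ->; rewrite mul0r.
have -> : \int[mu]_(x in `[-N, N]) (w x * cos (al - be * x)) = P N - P (- N).
  apply: Rintegral_FTC; first by lra.
    have cx : continuous (fun x : R => al - be * x).
      by move=> x; apply: cvgB; [exact: cvg_cst|apply: cvgMl_tmp].
    move=> x; apply: cvgM; last first.
      by apply: (continuous_comp (cx x)); exact: continuous_cos.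
    apply: cvgB; first exact: cvg_cst.
    apply: (cvg_comp (fun x => x / N) (fun y => y ^+ 2)); last exact: exprn_continuous.
    exact: cvgMr_tmp.
  move=> x; rewrite /P /w; apply: is_derive_eq.
  rewrite /GRing.scale/=; field.
  by rewrite Nn0 be0.
have PE (y : R) : y ^+ 2 = N ^+ 2 ->
    P y = - (2 * y / (N ^+ 2 * be ^+ 2)) * cos (al - be * y)
          - 2 / (N ^+ 2 * be ^+ 3) * sin (al - be * y).
  by move=> yN; rewrite /P /w exprMn exprVn yN divff ?expf_neq0// subrr; ring.
have sN (x : R) : `|sin x| <= 1.
  by rewrite ler_norml sin_geN1 sin_le1.
have nb0 : 0 < `|be| by rewrite normr_gt0.
have large' : 1 <= N * `|be|.
  rewrite -(@ler_pXn2r _ 2)// ?nnegrE ?mulr_ge0 ?(ltW N0)// expr1n.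
  by rewrite exprMn real_normK ?num_real// -exprMn.
have PB (y : R) : `|y| = N -> `|P y| <= 4 / (N * be ^+ 2).
  move=> yN; have yN2 : y ^+ 2 = N ^+ 2 by rewrite -[LHS]real_normK ?num_real// yN.
  rewrite PE//; rewrite (le_trans (ler_normB _ _))//.
  rewrite !(normrM, normfV, normrN, normrX) yN (gtr0_norm N0).
  rewrite (gtr0_norm (_ : 0 < 2 :> R))//.
  apply: (@le_trans _ _ (2 * N / (N ^+ 2 * `|be| ^+ 2) + 2 / (N ^+ 2 * `|be| ^+ 3))).
    by rewrite lerD// ler_piMr ?cos_max ?divr_ge0 ?mulr_ge0 ?exprn_ge0 ?(ltW N0).
  rewrite -subr_ge0 -[be ^+ 2]real_normK ?num_real//.
  rewrite (_ : _ - _ = 2 * (N * `|be| - 1) / (N ^+ 2 * `|be| ^+ 3)); last first.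
    by field; rewrite Nn0 gt_eqF.
  by rewrite divr_ge0 ?mulr_ge0 ?exprn_ge0 ?subr_ge0 ?(ltW N0).
rewrite (le_trans (ler_normB _ _))//.
apply: (@le_trans _ _ (4 / (N * be ^+ 2) + 4 / (N * be ^+ 2))).
  by rewrite lerD ?PB ?normrN ?gtr0_norm.
rewrite -subr_ge0.
rewrite (_ : _ - _ = 8 * ((N * be) ^+ 2 - 1) / (N * be ^+ 2 * (1 + (N * be) ^+ 2))).
  apply: divr_ge0; first by rewrite mulr_ge0// subr_ge0.
  by apply: mulr_ge0; [apply: mulr_ge0; [exact: ltW|exact: sqr_ge0]|exact: ltW].
move: D0; rewrite exprMn => /lt0r_neq0; move: be0 => /(expf_neq0 2).
move: (be ^+ 2) => b2 b0 D1; field.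
by rewrite Nn0 b0 D1.
Qed.

End Elementary.

(** * A Plancherel inequality for chirps *)

Section ChirpPlancherel.
Variable R : realType.
Local Notation mu := (@lebesgue_measure R).

Lemma integrable_scale (r : R) (f : R -> R) : mu.-integrable setT (EFin \o f) ->
  mu.-integrable setT (EFin \o (fun x => r * f x)).
Proof. by move=> h; exact: (integrableZl measurableT r h). Qed.

Lemma Rintegral_swap_tensor (f : R * R -> R) (u v : R -> R) :
  measurable_fun setT f -> measurable_fun setT u -> measurable_fun setT v ->
  (forall x, 0 <= u x) -> (forall x, 0 <= v x) ->
  (forall x y, `|f (x, y)| <= u x * v y) ->
  (\int[mu]_x (u x)%:E < +oo)%E -> (\int[mu]_x (v x)%:E < +oo)%E ->
  \int[mu]_x \int[mu]_y f (x, y) = \int[mu]_y \int[mu]_x f (x, y).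
Proof.
move=> mf mu_ mv u0 v0 fuv uoo voo; apply: Rintegral_swap => //.
have iv0 : (0 <= \int[mu]_x (v x)%:E)%E by apply: integral_ge0 => x _; rewrite lee_fin.
apply: (@le_lt_trans _ _ (\int[mu]_x ((u x)%:E * \int[mu]_y (v y)%:E))%E).
  apply: ge0_le_integral => //.
  - by move=> x _; apply: integral_ge0.
  - apply: (measurable_fun_ge0_integral (f := fun z => `|f z|)) => //.
    exact: measurable_fun_normr.
  - by apply: emeasurable_funM => //; exact/measurable_EFinP.
  move=> x _; rewrite -ge0_integralZl//; last 3 first.
  - exact/measurable_EFinP.
  - by move=> y _; rewrite lee_fin.
  - by rewrite lee_fin.
  apply: ge0_le_integral => //.
  - apply/measurable_EFinP; apply: measurable_fun_normr.
    by apply: measurableT_comp => //; exact: measurable_pair1.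
  - apply/measurable_EFinP; exact: measurable_funM.
  - by move=> y _; rewrite -EFinM lee_fin.
rewrite ge0_integralZr//.
- have iu0 : (0 <= \int[mu]_x (u x)%:E)%E by apply: integral_ge0 => x _; rewrite lee_fin.
  by apply: lte_mul_pinfty => //; rewrite ge0_fin_numE.
- exact/measurable_EFinP.
- by move=> x _; rewrite lee_fin.
Qed.

Variables (p : R -> R) (k c : R).
Hypothesis mp : measurable_fun setT p.
Hypothesis p1 : (\int[mu]_x `|p x|%:E < +oo)%E.
Hypothesis k0 : k != 0.

Let ph x y := k * (x - y) ^+ 2 + c.
Let C x := \int[mu]_y (p y * cos (ph x y)).
Let S x := \int[mu]_y (p y * sin (ph x y)).
Let P1 := fine (\int[mu]_x `|p x|%:E)%E.

Let P1E : (\int[mu]_x `|p x|%:E)%E = P1%:E.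
Proof. by rewrite /P1 fineK// ge0_fin_numE//; exact: integral_ge0. Qed.

Let P10 : 0 <= P1. Proof. by rewrite /P1 fine_ge0//; exact: integral_ge0. Qed.

Lemma Rintegral_bounded_factor (h : R -> R) : measurable_fun setT h ->
  (forall x, `|h x| <= 1) -> `|\int[mu]_y (p y * h y)| <= P1.
Proof.
move=> mh h1; rewrite -lee_fin -P1E.
apply: (le_trans (normr_Rintegral_le _)); first by meas.
apply: le_ge0_integral => //; [by meas|by meas|] => x _.
by rewrite normr_ge0 normrM ler_piMr.
Qed.

Lemma integrable_bounded_factor (h : R -> R) : measurable_fun setT h ->
  (forall x, `|h x| <= 1) -> mu.-integrable setT (EFin \o (fun y => p y * h y)).
Proof.
move=> mh h1; apply: integrable_lty; first by meas.
apply: le_lt_trans p1; apply: le_ge0_integral => //; [by meas|by meas|] => x _.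
by rewrite normr_ge0 normrM ler_piMr.
Qed.

Let sin_max (x : R) : `|sin x| <= 1.
Proof. by rewrite ler_norml sin_geN1 sin_le1. Qed.

Let mC : measurable_fun setT C.
Proof.
apply: (measurable_fun_Rintegral (f := fun z => p z.2 * cos (ph z.1 z.2))).
by rewrite /ph; meas.
Qed.

Let mS : measurable_fun setT S.
Proof.
apply: (measurable_fun_Rintegral (f := fun z => p z.2 * sin (ph z.1 z.2))).
by rewrite /ph; meas.
Qed.

Let mcos x : measurable_fun setT (fun y => cos (ph x y)).
Proof. by rewrite /ph; meas. Qed.

Let msin x : measurable_fun setT (fun y => sin (ph x y)).
Proof. by rewrite /ph; meas. Qed.

Let CP x : `|C x| <= P1.
Proof. exact: (Rintegral_bounded_factor (mcos x) (fun=> cos_max _)). Qed.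

Let SP x : `|S x| <= P1.
Proof. exact: (Rintegral_bounded_factor (msin x) (fun=> sin_max _)). Qed.

Let icos x : mu.-integrable setT (EFin \o (fun y => p y * cos (ph x y))).
Proof. exact: (integrable_bounded_factor (mcos x) (fun=> cos_max _)). Qed.

Let isin x : mu.-integrable setT (EFin \o (fun y => p y * sin (ph x y))).
Proof. exact: (integrable_bounded_factor (msin x) (fun=> sin_max _)). Qed.

Section Weighted.
Variable N : R.
Hypothesis N0 : 0 < N.
Let w := pweight N.
Let mw : measurable_fun setT w := measurable_pweight N.
Let w0 x : 0 <= w x := pweight_ge0 N x.
Let w1 : (\int[mu]_x (w x)%:E < +oo)%E.
Proof. by apply: le_lt_trans (integral_pweight_le N0) _; exact: ltry. Qed.

(* [Q] is the weighted adjoint transform of [(C, S)], and [kap] the kernel that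
   dominates the composition of the transform with its adjoint. *)
Let Q y := \int[mu]_x (w x * (C x * cos (ph x y) + S x * sin (ph x y))).
Let kap y z := 16 * N / (1 + (2 * N * `|k| * (z - y)) ^+ 2).

Let kap_ge0 y z : 0 <= kap y z.
Proof. by apply: divr_ge0; [rewrite mulr_ge0// ltW|rewrite addr_ge0// sqr_ge0]. Qed.

Let mkap : measurable_fun setT (fun z : R * R => kap z.1 z.2).
Proof. by rewrite /kap; meas. Qed.

Let kapC y z : kap y z = kap z y.
Proof. by rewrite /kap !exprMn -opprB sqrrN. Qed.

Let integral_kap y : (\int[mu]_z (kap y z)%:E = (8 * pi / `|k|)%:E)%E.
Proof.
have nk0 : 0 < `|k| by rewrite normr_gt0.
have K0 : 0 < 2 * N * `|k| by rewrite !mulr_gt0.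
rewrite /kap; under eq_integral do rewrite EFinM.
rewrite ge0_integralZl//.
- rewrite integral_Cauchy_kernel// -EFinM; congr EFin.
  by field; rewrite !gt_eqF.
- by apply/measurable_EFinP; meas.
- by move=> x _; rewrite lee_fin invr_ge0 addr_ge0 ?sqr_ge0.
- by rewrite lee_fin mulr_ge0// ltW.
Qed.

(* By the addition formula the two quadratic phases subtract. *)
Let QE y : Q y = \int[mu]_z (p z * \int[mu]_x (w x * cos (ph x z - ph x y))).
Proof.
transitivity (\int[mu]_x \int[mu]_z (p z * (w x * cos (ph x z - ph x y)))).
  apply: eq_Rintegral => x _.
  transitivity (\int[mu]_z (w x * cos (ph x y) * (p z * cos (ph x z)) +
                            w x * sin (ph x y) * (p z * sin (ph x z)))).
    rewrite RintegralD//; last 2 first.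
    - exact: integrable_scale (icos x).
    - exact: integrable_scale (isin x).
    rewrite !RintegralZl//.
    by rewrite -/(C x) -/(S x); ring.
  by apply: eq_Rintegral => z _; rewrite cosB; ring.
rewrite (Rintegral_swap_tensor (f := fun q => p q.2 * (w q.1 * cos (ph q.1 q.2 - ph q.1 y)))
   (u := w) (v := fun z => `|p z|))//.
- apply: eq_Rintegral => z _ /=; rewrite RintegralZl//.
  apply: (integrable_dominated (g := w)) => //; first by rewrite /ph; meas.
    exact: integrable_pweight.
  by move=> x; rewrite normrM (ger0_norm (w0 _)) ler_piMr// cos_max.
- by rewrite /ph; meas; apply: measurableT_comp => //.
- by meas.
- move=> x z /=; rewrite mulrC normrM ler_wpM2r// normrM (ger0_norm (w0 _)).
  by rewrite ler_piMr// cos_max.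
Qed.

(* In [ph x z - ph x y] the square of [x] cancels: the phase is affine in [x],
   with frequency proportional to [z - y]. *)
Let Q_le y : (`|Q y|%:E <= \int[mu]_z (`|p z| * kap y z)%:E)%E.
Proof.
rewrite QE; apply: (le_trans (normr_Rintegral_le _)).
  apply: measurable_funM => //.
  apply: (measurable_fun_Rintegral (f := fun q => w q.2 * cos (ph q.2 q.1 - ph q.2 y))).
  by rewrite /ph; meas; apply: measurableT_comp.
apply: le_ge0_integral => //.
- apply: measurable_fun_normr; apply: measurable_funM => //.
  apply: (measurable_fun_Rintegral (f := fun q => w q.2 * cos (ph q.2 q.1 - ph q.2 y))).
  by rewrite /ph; meas; apply: measurableT_comp.
- by rewrite /kap; meas.
move=> z _; rewrite normr_ge0/= normrM ler_wpM2l//.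
have -> : \int[mu]_x (w x * cos (ph x z - ph x y)) =
   \int[mu]_x (w x * cos (k * (z ^+ 2 - y ^+ 2) - 2 * k * (z - y) * x)).
  by apply: eq_Rintegral => x _; congr (_ * cos _); rewrite /ph; ring.
apply: (le_trans (Rintegral_pweight_cos _ _ N0)).
rewrite /kap !exprMn real_normK ?num_real// le_eqVlt; apply/orP; left; apply/eqP.
by congr (_ / (1 + _)); ring.
Qed.

(** A [TT*] argument: the left-hand side is the integral of [p Q], and [Q] is
    dominated by the integral operator with symmetric kernel [kap] applied to
    [|p|], so that Schur's test bounds it by the integral of [kap y], which is
    the same for all [y] and all [N]. *)
Lemma weighted_chirp_plancherel :
  (\int[mu]_x (w x * (C x ^+ 2 + S x ^+ 2))%:E <=
   (8 * pi / `|k|)%:E * \int[mu]_x (p x ^+ 2)%:E)%E.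
Proof.
have CS x : `|C x * C x + S x * S x| <= 2 * P1 ^+ 2.
  rewrite (le_trans (ler_normD _ _))// !normrM mulrDl !mul1r expr2.
  by rewrite lerD// ler_pM.
have iI : mu.-integrable setT (EFin \o (fun x => w x * (C x ^+ 2 + S x ^+ 2))).
  apply: (integrable_dominated (g := fun x => 2 * P1 ^+ 2 * w x)); first by meas.
    by apply: integrable_scale; exact: integrable_pweight.
  by move=> x; rewrite normrM (ger0_norm (w0 _)) mulrC ler_wpM2r// !expr2.
rewrite -(fineK (integrable_fin_num measurableT iI)).
rewrite -/(Rintegral mu setT (fun x => w x * (C x ^+ 2 + S x ^+ 2))).
have CSxy x y : `|C x * cos (ph x y) + S x * sin (ph x y)| <= 2 * P1.
  rewrite (le_trans (ler_normD _ _))// !normrM mulrDl !mul1r.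
  by rewrite lerD// -[leRHS]mulr1 ler_pM// cos_max.
have mfQ : measurable_fun setT
    (fun q : R * R => w q.2 * (C q.2 * cos (ph q.2 q.1) + S q.2 * sin (ph q.2 q.1))).
  by rewrite /ph; meas; apply: measurableT_comp.
have -> : \int[mu]_x (w x * (C x ^+ 2 + S x ^+ 2)) = \int[mu]_y (p y * Q y).
  transitivity (\int[mu]_x \int[mu]_y
      (p y * (w x * (C x * cos (ph x y) + S x * sin (ph x y))))).
    apply: eq_Rintegral => x _.
    transitivity (\int[mu]_y (w x * C x * (p y * cos (ph x y)) +
                              w x * S x * (p y * sin (ph x y)))).
      rewrite RintegralD//; last 2 first.
      - exact: integrable_scale (icos x).
      - exact: integrable_scale (isin x).
      by rewrite !RintegralZl// -/(C x) -/(S x); ring.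
    by apply: eq_Rintegral => y _; ring.
  rewrite (Rintegral_swap_tensor (f := fun q => p q.2 *
     (w q.1 * (C q.1 * cos (ph q.1 q.2) + S q.1 * sin (ph q.1 q.2))))
     (u := fun x => 2 * P1 * w x) (v := fun z => `|p z|))//.
  - apply: eq_Rintegral => y _ /=; rewrite RintegralZl//.
    apply: (integrable_dominated (g := fun x => 2 * P1 * w x)).
    + by rewrite /ph; meas.
    + by apply: integrable_scale; exact: integrable_pweight.
    + by move=> x; rewrite normrM (ger0_norm (w0 _)) mulrC ler_wpM2r.
  - by rewrite /ph; meas; apply: measurableT_comp.
  - by meas.
  - by meas.
  - by move=> x; rewrite !mulr_ge0.
  - move=> x y /=; rewrite mulrC normrM ler_wpM2r// normrM (ger0_norm (w0 _)).
    by rewrite mulrC ler_wpM2r.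
  - under eq_integral do rewrite EFinM.
    rewrite ge0_integralZl//; last 3 first.
    + exact/measurable_EFinP.
    + by move=> x _; rewrite lee_fin.
    + by rewrite lee_fin mulr_ge0.
    have iw0 : (0 <= \int[mu]_x (w x)%:E)%E by apply: integral_ge0 => x _; rewrite lee_fin.
    by apply: lte_mul_pinfty; rewrite // lee_fin mulr_ge0.
have mQ : measurable_fun setT Q by exact: measurable_fun_Rintegral mfQ.
apply: (@le_trans _ _ (\int[mu]_y `|p y * Q y|%:E)%E).
  apply: le_trans (normr_Rintegral_le _); first by rewrite lee_fin ler_norm.
  exact: measurable_funM.
pose a y z := p y ^+ 2 * kap y z; pose b y z := p z ^+ 2 * kap y z.
have ma : measurable_fun setT (fun q : R * R => a q.1 q.2).
  by apply: measurable_funM => //; meas.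
have mb : measurable_fun setT (fun q : R * R => b q.1 q.2).
  by apply: measurable_funM => //; meas.
have mpair (g : R -> R -> R) y : measurable_fun setT (fun q : R * R => g q.1 q.2) ->
    measurable_fun setT (g y).
  by move=> mg; exact: (measurableT_comp mg (measurable_pair1 y)).
have a0 y z : 0 <= a y z by rewrite mulr_ge0 ?sqr_ge0.
have b0 y z : 0 <= b y z by rewrite mulr_ge0 ?sqr_ge0.
pose J := (\int[mu]_x (p x ^+ 2)%:E)%E.
have Ea : (\int[mu]_y \int[mu]_z (a y z)%:E = (8 * pi / `|k|)%:E * J)%E.
  rewrite /J -ge0_integralZl//.
  - apply: eq_integral => y _; rewrite /a; under eq_integral do rewrite EFinM.
    rewrite ge0_integralZl ?lee_fin ?sqr_ge0//.
    + by rewrite integral_kap muleC.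
    + by apply/measurable_EFinP; exact: mpair.
    + by move=> z _; rewrite lee_fin.
  - by apply/measurable_EFinP; meas.
  - by move=> x _; rewrite lee_fin sqr_ge0.
  - by rewrite lee_fin divr_ge0// mulr_ge0// pi_ge0.
have Eb : (\int[mu]_y \int[mu]_z (b y z)%:E = (8 * pi / `|k|)%:E * J)%E.
  rewrite -Ea.
  apply: (etrans (fubini_tonelli (m1 := mu) (m2 := mu) (fun q => (b q.1 q.2)%:E) _ _)).
  - exact/measurable_EFinP.
  - by move=> q; rewrite lee_fin.
  - apply: eq_integral => y _; apply: eq_integral => z _.
    by rewrite /a /b /= kapC.
have mEb : measurable_fun setT ((fun y => \int[mu]_z (b y z)%:E) : R -> \bar R)%E.
  exact: (measurable_fun_ge0_integral mb).
have mEa : measurable_fun setT ((fun y => \int[mu]_z (a y z)%:E) : R -> \bar R)%E.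
  exact: (measurable_fun_ge0_integral ma).
apply: (@le_trans _ _ (\int[mu]_y (2^-1%:E * (\int[mu]_z (a y z)%:E + \int[mu]_z (b y z)%:E)))%E).
  apply: ge0_le_integral => //.
  - by apply/measurable_EFinP; meas.
  - by apply: emeasurable_funM => //; exact: emeasurable_funD.
  move=> y _; rewrite normrM EFinM.
  apply: (le_trans (lee_wpmul2l _ (Q_le y))); first by rewrite lee_fin.
  have mky : measurable_fun setT (kap y) by exact: mpair.
  rewrite -ge0_integralZl//; last 2 first.
  - by apply/measurable_EFinP; meas.
  - by move=> z _; rewrite lee_fin mulr_ge0.
  rewrite -ge0_integralD//; last 4 first.
  - by move=> z _; rewrite lee_fin.
  - by apply/measurable_EFinP; exact: mpair.
  - by move=> z _; rewrite lee_fin.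
  - by apply/measurable_EFinP; exact: mpair.
  rewrite -ge0_integralZl//; last 2 first.
  - by apply: emeasurable_funD; apply/measurable_EFinP; exact: mpair.
  - by move=> z _; rewrite -EFinD lee_fin addr_ge0.
  apply: ge0_le_integral => //.
  - by move=> z _; rewrite -EFinM lee_fin mulr_ge0// mulr_ge0.
  - by apply/measurable_EFinP; meas.
  - apply: emeasurable_funM => //.
    by apply: emeasurable_funD; apply/measurable_EFinP; exact: mpair.
  move=> z _; rewrite -EFinM -EFinD -EFinM lee_fin /a /b.
  rewrite -(real_normK (num_real (p y))) -(real_normK (num_real (p z))) -subr_ge0.
  rewrite (_ : _ - _ = (`|p y| - `|p z|) ^+ 2 / 2 * kap y z); last by field.
  by apply: mulr_ge0 => //; apply: divr_ge0 => //; exact: sqr_ge0.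
rewrite ge0_integralZl//; last 2 first.
- exact: emeasurable_funD.
- by move=> y _; rewrite adde_ge0// integral_ge0// => z _; rewrite lee_fin.
rewrite ge0_integralD//; last 2 first.
- by move=> y _; rewrite integral_ge0// => z _; rewrite lee_fin.
- by move=> y _; rewrite integral_ge0// => z _; rewrite lee_fin.
rewrite Ea Eb -/J -[X in (X + X)%E]mul1e -ge0_muleDl// muleA -EFinD -EFinM.
by rewrite (_ : 2^-1 * (1 + 1) = 1) ?mul1e//; field.
Qed.

End Weighted.

(** Let [N] tend to infinity in the weighted estimate. On [[-n, n]] the weight
    of size [2 n] is at least [3 / 4], and [4 / 3 * 8 < 11]. *)
Lemma chirp_plancherel :
  (\int[mu]_x (C x ^+ 2 + S x ^+ 2)%:E <=
   (11 * pi / `|k|)%:E * \int[mu]_x (p x ^+ 2)%:E)%E.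
Proof.
pose F n := `[- n.+1%:R, n.+1%:R]%classic : set R.
have h0 x : 0 <= C x ^+ 2 + S x ^+ 2 by rewrite addr_ge0 ?sqr_ge0.
have J0 : (0 <= \int[mu]_x (p x ^+ 2)%:E)%E.
  by apply: integral_ge0 => x _; rewrite lee_fin sqr_ge0.
have FU : \bigcup_n F n = setT.
  apply/seteqP; split => // x _.
  exists (Num.truncn `|x|) => //=; rewrite /F/= in_itv/= -ler_norml.
  by apply/ltW/truncnS_gt.
have cv : (\int[mu]_(x in F n) (C x ^+ 2 + S x ^+ 2)%:E)%E @[n --> \oo] -->
          (\int[mu]_x (C x ^+ 2 + S x ^+ 2)%:E)%E.
  rewrite -FU; apply: ge0_nondecreasing_set_cvg_integral.
  - move=> m n mn; apply/subsetPset => x; rewrite /F/= !in_itv/= -!ler_norml.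
    by move=> /le_trans; apply; rewrite ler_nat.
  - by move=> n; exact: measurable_itv.
  - by move=> n; apply/measurable_EFinP; apply: measurable_funTS; meas.
  - by move=> n x _; rewrite lee_fin.
rewrite -(cvg_lim _ cv)//; apply: lime_le; first exact: cvgP cv.
apply: nearW => n; rewrite /F.
pose N : R := 2 * n.+1%:R; have N0 : 0 < N by rewrite mulr_gt0.
have n0 : 0 < n.+1%:R :> R by [].
apply: (@le_trans _ _ ((4 / 3)%:E * \int[mu]_x (pweight N x * (C x ^+ 2 + S x ^+ 2))%:E)%E).
  rewrite -ge0_integralZl//; last 2 first.
  - by apply/measurable_EFinP; apply: measurable_funM; [exact: measurable_pweight|meas].
  - by move=> x _; rewrite lee_fin mulr_ge0 ?pweight_ge0.
  rewrite [leLHS]integral_mkcond; apply: ge0_le_integral => //.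
  - by move=> x _; rewrite patchE; case: ifPn => // _; rewrite lee_fin.
  - apply/(measurable_restrictT _ _).1 => //.
    by apply/measurable_EFinP; apply: measurable_funTS; meas.
  - apply: emeasurable_funM => //; apply/measurable_EFinP.
    by apply: measurable_funM; [exact: measurable_pweight|meas].
  move=> x _; rewrite patchE; case: ifPn; last first.
    by rewrite -EFinM lee_fin !mulr_ge0 ?pweight_ge0.
  rewrite inE/= in_itv/= => /andP[x1 x2].
  rewrite -EFinM lee_fin mulrA ler_peMl// pweight_in//; last by rewrite /N; lra.
  have : - 2^-1 <= x / N by rewrite ler_pdivlMr// /N; lra.
  have : x / N <= 2^-1 by rewrite ler_pdivrMr// /N; lra.
  by move: (x / N) => u; nra.
apply: (le_trans (lee_wpmul2l _ (weighted_chirp_plancherel N0))).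
  by rewrite lee_fin.
rewrite muleA -EFinM; apply: lee_wpmul2r => //.
rewrite lee_fin !mulrA ler_wpM2r ?invr_ge0// ler_wpM2r ?pi_ge0//.
by lra.
Qed.

End ChirpPlancherel.

(** * The free Schrodinger evolution *)

Section FreeEvolution.
Variable R : realType.
Local Notation mu := (@lebesgue_measure R).

(** One real family for both parts of the Schrodinger kernel: the real part is
    at phase shift [c = 0] and the imaginary part at [c = - pi / 2], so that each
    estimate below is proved once for both. *)
Definition rkernel (c s x : R) : R :=
  (Num.sqrt (4 * pi * `|s|))^-1 * cos (x ^+ 2 / (4 * s) - Num.sg s * (pi / 4) + c).

Definition rconv (c s : R) (q : R -> R) (x : R) : R :=
  \int[mu]_y (rkernel c s (x - y) * q y).

Lemma Re_schrodinger_kernel s x :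
  complex.Re (schrodinger_kernel s x) = rkernel 0 s x.
Proof. by rewrite /schrodinger_kernel /cexpi /rkernel /= mul0r subr0 addr0. Qed.

Lemma Im_schrodinger_kernel s x :
  complex.Im (schrodinger_kernel s x) = rkernel (- (pi / 2)) s x.
Proof.
rewrite /schrodinger_kernel /cexpi /rkernel /= mul0r addr0.
by rewrite cosB cos_pihalf sin_pihalf mulr0 mulr1 add0r.
Qed.

Lemma measurable_rkernel c d (T : measurableType d) (f g : T -> R) :
  measurable_fun setT f -> measurable_fun setT g ->
  measurable_fun setT (fun x => rkernel c (f x) (g x)).
Proof. by move=> mf mg; rewrite /rkernel; meas. Qed.

Lemma rkernel_le c s x : `|rkernel c s x| <= (Num.sqrt (4 * pi * `|s|))^-1.
Proof.
rewrite /rkernel normrM ger0_norm ?invr_ge0 ?sqrtr_ge0//.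
by rewrite ler_piMr ?cos_max// invr_ge0 sqrtr_ge0.
Qed.

Section Convolution.
Variables (c s : R) (q : R -> R).
Hypothesis mq : measurable_fun setT q.

(** Dispersion: the modulus of the kernel is bounded uniformly in space. *)
Lemma rconv_sup x : (`|rconv c s q x|%:E <=
  ((Num.sqrt (4 * pi * `|s|))^-1)%:E * \int[mu]_y `|q y|%:E)%E.
Proof.
have mk : measurable_fun setT (fun y : R => rkernel c s (x - y)).
  by apply: measurable_rkernel; meas.
apply: (le_trans (normr_Rintegral_le _)); first by meas.
rewrite -ge0_integralZl//; last by apply/measurable_EFinP; meas.
under [leRHS]eq_integral do rewrite -EFinM.
apply: le_ge0_integral => //; [by meas|by meas|] => y _.
by rewrite normr_ge0 normrM ler_wpM2r// rkernel_le.
Qed.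

Hypothesis q1 : (\int[mu]_x `|q x|%:E < +oo)%E.

Lemma integrable_rconv x :
  mu.-integrable setT (EFin \o (fun y => rkernel c s (x - y) * q y)).
Proof.
have mk : measurable_fun setT (fun y : R => rkernel c s (x - y)).
  by apply: measurable_rkernel; meas.
apply: (integrable_dominated (g := fun y => (Num.sqrt (4 * pi * `|s|))^-1 * `|q y|)).
- by meas.
- apply: integrable_scale; apply: integrable_lty; first by meas.
  by under eq_integral do rewrite normr_id.
- by move=> y; rewrite normrM ler_wpM2r// rkernel_le.
Qed.

(** As [(x - y)^2 / (4 s)] is the phase of a chirp of rate [k = (4 s)^-1], the
    factor [|k|^-1] of the Plancherel inequality cancels the square of the
    prefactor of the kernel. *)
Lemma rconv_L2 : s != 0 ->
  (\int[mu]_x (rconv c s q x ^+ 2)%:E <= 11%:E * \int[mu]_x (q x ^+ 2)%:E)%E.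
Proof.
move=> s0; have ns0 : 0 < `|s| by rewrite normr_gt0.
pose k := (4 * s)^-1; pose c' := - (Num.sg s * (pi / 4)) + c.
have k0 : k != 0 by rewrite invr_neq0// mulf_neq0.
pose C x := \int[mu]_y (q y * cos (k * (x - y) ^+ 2 + c')).
pose S x := \int[mu]_y (q y * sin (k * (x - y) ^+ 2 + c')).
pose A := (Num.sqrt (4 * pi * `|s|))^-1.
have pi0 : 0 < pi :> R by exact: pi_gt0.
have A2 : A ^+ 2 = (4 * pi * `|s|)^-1.
  by rewrite /A exprVn sqr_sqrtr// !mulr_ge0// ltW.
have mC : measurable_fun setT C.
  by apply: (measurable_fun_Rintegral (f := fun z : R * R => q z.2 * cos (k * (z.1 - z.2) ^+ 2 + c'))); meas.
have mS : measurable_fun setT S.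
  by apply: (measurable_fun_Rintegral (f := fun z : R * R => q z.2 * sin (k * (z.1 - z.2) ^+ 2 + c'))); meas.
have cE x : rconv c s q x = A * C x.
  rewrite /C -RintegralZl//.
    apply: eq_Rintegral => y _; rewrite /rkernel -/A -mulrA; congr (_ * _).
    by rewrite mulrC; congr (_ * cos _); rewrite /k /c'; ring.
  apply: integrable_bounded_factor => // [|y]; first by meas.
  exact: cos_max.
have mr : measurable_fun setT (rconv c s q).
  by rewrite (_ : rconv c s q = fun x => A * C x); [meas|apply/funext].
apply: (@le_trans _ _ (\int[mu]_x ((A ^+ 2)%:E * (C x ^+ 2 + S x ^+ 2)%:E))%E).
  under [leRHS]eq_integral do rewrite -EFinM.
  apply: le_ge0_integral => //; [by meas|by meas|] => x _.
  by rewrite sqr_ge0 cE exprMn ler_wpM2l ?sqr_ge0// lerDl sqr_ge0.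
rewrite ge0_integralZl//; last 3 first.
- by apply/measurable_EFinP; meas.
- by move=> x _; rewrite lee_fin addr_ge0 ?sqr_ge0.
- by rewrite lee_fin sqr_ge0.
apply: (le_trans (lee_wpmul2l _ (chirp_plancherel c' mq q1 k0))).
  by rewrite lee_fin sqr_ge0.
rewrite muleA -EFinM A2 /k normfV normrM (ger0_norm (_ : 0 <= 4 :> R))//.
rewrite (_ : _ * (11 * pi / _) = 11)//.
move: pi0 ns0 => /lt0r_neq0 + /lt0r_neq0; move: (pi : R) `|s| => u v u0 v0.
by field; rewrite u0 v0.
Qed.

End Convolution.

Lemma rconvB c s (q r : R -> R) x :
  measurable_fun setT q -> measurable_fun setT r ->
  (\int[mu]_x `|q x|%:E < +oo)%E -> (\int[mu]_x `|r x|%:E < +oo)%E ->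
  rconv c s (fun y => q y - r y) x = rconv c s q x - rconv c s r x.
Proof.
move=> mq mr q1 r1; rewrite /rconv -RintegralB//; last 2 first.
- exact: integrable_rconv.
- exact: integrable_rconv.
by apply: eq_Rintegral => y _; rewrite mulrBr.
Qed.

End FreeEvolution.

(** * Square-integrable complex functions *)

Section ComplexL2.
Variable R : realType.
Local Notation mu := (@lebesgue_measure R).
Implicit Types (z w : R[i]) (h : R -> R[i]) (q : R -> R).

Lemma Re_mul z w : complex.Re (z * w) =
  complex.Re z * complex.Re w - complex.Im z * complex.Im w.
Proof. by case: z w => [? ?] [? ?]. Qed.

Lemma Im_mul z w : complex.Im (z * w) =
  complex.Re z * complex.Im w + complex.Im z * complex.Re w.
Proof. by case: z w => [? ?] [? ?]. Qed.

Lemma Re_add z w : complex.Re (z + w) = complex.Re z + complex.Re w.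
Proof. by case: z w => [? ?] [? ?]. Qed.

Lemma Im_add z w : complex.Im (z + w) = complex.Im z + complex.Im w.
Proof. by case: z w => [? ?] [? ?]. Qed.

Lemma Re_sub z w : complex.Re (z - w) = complex.Re z - complex.Re w.
Proof. by case: z w => [? ?] [? ?]. Qed.

Lemma Im_sub z w : complex.Im (z - w) = complex.Im z - complex.Im w.
Proof. by case: z w => [? ?] [? ?]. Qed.

Lemma cmod_sqr z : cmod z ^+ 2 = complex.Re z ^+ 2 + complex.Im z ^+ 2.
Proof. by case: z => a b; rewrite /cmod/= sqr_sqrtr// addr_ge0 ?sqr_ge0. Qed.

Lemma cmod_ge0 z : 0 <= cmod z.
Proof. by case: z => a b; exact: sqrtr_ge0. Qed.

Lemma cLnorm2E h : cLnorm 2%:E h =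
  ((\int[mu]_x (complex.Re (h x) ^+ 2 + complex.Im (h x) ^+ 2)%:E) `^ 2^-1)%E.
Proof.
rewrite /cLnorm unlock /Lnorm; congr (_ `^ _)%E; apply: eq_integral => x _.
by rewrite abse_EFin poweR_EFin ger0_norm ?cmod_ge0// powR_mulrn ?cmod_ge0// cmod_sqr.
Qed.

Lemma cLnorm2_le h (B : R) : 0 <= B ->
  (\int[mu]_x (complex.Re (h x) ^+ 2 + complex.Im (h x) ^+ 2)%:E <= (B ^+ 2)%:E)%E ->
  (cLnorm 2%:E h <= B%:E)%E.
Proof.
move=> B0 hB; rewrite cLnorm2E.
have -> : B%:E = ((B ^+ 2)%:E `^ 2^-1)%E.
  by rewrite poweR_EFin powR12_sqrt ?sqr_ge0// sqrtr_sqr ger0_norm.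
have h0 : (0 <= \int[mu]_x (complex.Re (h x) ^+ 2 + complex.Im (h x) ^+ 2)%:E)%E.
  by apply: integral_ge0 => x _; rewrite lee_fin addr_ge0 ?sqr_ge0.
apply: gt0_ler_poweR => //.
- by rewrite in_itv/= h0 leey.
- by rewrite in_itv/= lee_fin sqr_ge0 leey.
Qed.

Lemma integral_sqr_ge0 q : (0 <= \int[mu]_x (q x ^+ 2)%:E)%E.
Proof. by apply: integral_ge0 => x _; rewrite lee_fin sqr_ge0. Qed.

Lemma Lfun2_sqr_lty q : measurable_fun setT q ->
  (\int[mu]_x (q x ^+ 2)%:E < +oo)%E -> q \in Lfun mu 2%:E.
Proof.
move=> mq q2; apply/andP; split; rewrite inE//= /finite_norm.
rewrite unlock /Lnorm.
rewrite (_ : (\int[mu]_x _)%E = (\int[mu]_x (q x ^+ 2)%:E)%E); last first.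
  apply: eq_integral => x _.
  by rewrite abse_EFin poweR_EFin powR_mulrn// real_normK ?num_real.
move: (integral_sqr_ge0 q) q2; case: (\int[mu]_x _)%E => [r| |]//= _ _.
by rewrite ltry.
Qed.

Lemma integral_sqr_bound_add (u v : R -> R) (A B : \bar R) :
  measurable_fun setT u -> measurable_fun setT v ->
  (\int[mu]_x (u x ^+ 2)%:E <= A)%E -> (\int[mu]_x (v x ^+ 2)%:E <= B)%E ->
  (\int[mu]_x ((u x + v x) ^+ 2)%:E <= 2%:E * (A + B))%E.
Proof.
move=> m_u m_v uA vB.
apply: (@le_trans _ _ (\int[mu]_x (2%:E * ((u x ^+ 2)%:E + (v x ^+ 2)%:E)))%E).
  under [leRHS]eq_integral do rewrite -EFinD -EFinM.
  apply: le_ge0_integral => //; [by meas|by meas|] => x _.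
  rewrite sqr_ge0/= -subr_ge0 (_ : _ - _ = (u x - v x) ^+ 2) ?sqr_ge0//; ring.
rewrite ge0_integralZl//; last 2 first.
- by apply: emeasurable_funD; apply/measurable_EFinP; meas.
- by move=> x _; rewrite -EFinD lee_fin addr_ge0 ?sqr_ge0.
apply: lee_wpmul2l => //; rewrite ge0_integralD//.
- exact: leeD.
- by move=> x _; rewrite lee_fin sqr_ge0.
- by apply/measurable_EFinP; meas.
- by move=> x _; rewrite lee_fin sqr_ge0.
- by apply/measurable_EFinP; meas.
Qed.

End ComplexL2.

Section FreeEvolutionOfL1L2.
Variable R : realType.
Local Notation mu := (@lebesgue_measure R).
Variable s : R.
Hypothesis s0 : s != 0.
Implicit Types (q : R -> R) (h : R -> R[i]).

Definition in_L1L2 q := [/\ measurable_fun setT q,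
  (\int[mu]_x `|q x|%:E < +oo)%E & (\int[mu]_x (q x ^+ 2)%:E < +oo)%E].

(** For integrable [h], the free evolution as an everywhere defined function. *)
Definition cconv (s : R) h (x : R) : R[i] :=
  (rconv 0 s (fun y => complex.Re (h y)) x
   - rconv (- (pi / 2)) s (fun y => complex.Im (h y)) x) +i*
  (rconv 0 s (fun y => complex.Im (h y)) x
   + rconv (- (pi / 2)) s (fun y => complex.Re (h y)) x).

Definition tail (n : nat) q (y : R) : R := if n%:R < `|y| then q y else 0.

Lemma measurable_rconv c q : measurable_fun setT q ->
  measurable_fun setT (rconv c s q).
Proof.
move=> mq; apply: (measurable_fun_Rintegral
  (f := fun z : R * R => rkernel c s (z.1 - z.2) * q z.2)).
by apply: measurable_funM; [apply: measurable_rkernel; meas|meas].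
Qed.

Lemma measurable_tail n q : measurable_fun setT q -> measurable_fun setT (tail n q).
Proof. by move=> mq; rewrite /tail; meas. Qed.

Lemma tail_abs_le n q y : `|tail n q y| <= `|q y|.
Proof. by rewrite /tail; case: ifP => // _; rewrite normr0. Qed.

Lemma tail_sqr_le n q y : tail n q y ^+ 2 <= q y ^+ 2.
Proof. by rewrite /tail; case: ifP => // _; rewrite expr0n/= sqr_ge0. Qed.

Lemma in_L1L2_tail n q : in_L1L2 q -> in_L1L2 (tail n q).
Proof.
move=> [mq q1 q2]; have mt := measurable_tail n mq; split => //.
  apply: le_lt_trans q1; apply: le_ge0_integral => //; [by meas|by meas|].
  by move=> x _; rewrite normr_ge0 tail_abs_le.
apply: le_lt_trans q2; apply: le_ge0_integral => //; [by meas|by meas|].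
by move=> x _; rewrite sqr_ge0 tail_sqr_le.
Qed.

Lemma integral_tail_cvg0 q : in_L1L2 q ->
  (\int[mu]_x (tail n q x ^+ 2)%:E)%E @[n --> \oo] --> 0%E.
Proof.
move=> [mq q1 q2].
rewrite -(integral0 mu setT); apply: (@dominated_cvg _ _ _ mu setT measurableT
  (fun n x => (tail n q x ^+ 2)%:E) (cst 0)%E (fun x => (q x ^+ 2)%:E)) => //.
- by move=> n; apply/measurable_EFinP; apply: measurable_funX; exact: measurable_tail.
- move=> x _; apply: cvg_near_cst; near=> n.
  rewrite /tail ifF ?expr0n//; apply/negbTE; rewrite -leNgt.
  near: n; exact: nbhs_infty_ger.
- apply: integrable_lty; first by meas.
  by under eq_integral do rewrite ger0_norm ?sqr_ge0//.
- by move=> n x _; rewrite /= lee_fin ger0_norm ?sqr_ge0// tail_sqr_le.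
Unshelve. all: end_near. Qed.

Lemma rconv_tail c n q x : in_L1L2 q ->
  rconv c s q x - \int[mu]_(y in `[- n%:R, n%:R]) (rkernel c s (x - y) * q y) =
  rconv c s (tail n q) x.
Proof.
move=> [mq q1 q2]; rewrite Rintegral_mkcond /rconv -RintegralB//; last 2 first.
- exact: integrable_rconv.
- apply: (integrable_dominated (g := fun y => `|rkernel c s (x - y) * q y|)).
  + apply/(measurable_restrictT _ _).1 => //; apply: measurable_funTS.
    by apply: measurable_funM; [apply: measurable_rkernel; meas|meas].
  + exact: (integrable_norm (integrable_rconv c s mq q1 x)).
  + by move=> y; rewrite patchE; case: ifPn => //; rewrite normr0.
apply: eq_Rintegral => y _; rewrite patchE /tail; case: ifPn.
  by rewrite inE/= in_itv/= -ler_norml => yn; rewrite ltNge yn/= subrr mulr0.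
by rewrite notin_setE/= in_itv/= -ler_norml => /negP; rewrite -ltNge => ->; rewrite subr0.
Qed.

Lemma rconv_L2_bound c q : in_L1L2 q ->
  (\int[mu]_x (rconv c s q x ^+ 2)%:E <= 11%:E * \int[mu]_x (q x ^+ 2)%:E)%E.
Proof. by move=> [mq q1 q2]; exact: rconv_L2. Qed.

Lemma rconv_L2_lty c q : in_L1L2 q ->
  (\int[mu]_x (rconv c s q x ^+ 2)%:E < +oo)%E.
Proof.
move=> gq; apply: le_lt_trans (rconv_L2_bound c gq) _.
by apply: lte_mul_pinfty => //; case: gq.
Qed.

Lemma cconv_L2 h : in_L1L2 (fun x => complex.Re (h x)) ->
  in_L1L2 (fun x => complex.Im (h x)) ->
  (\int[mu]_x (complex.Re (cconv s h x) ^+ 2 + complex.Im (cconv s h x) ^+ 2)%:E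
   <= 44%:E * (\int[mu]_x (complex.Re (h x) ^+ 2)%:E + \int[mu]_x (complex.Im (h x) ^+ 2)%:E))%E.
Proof.
move=> ga gb; have [ma _ _] := ga; have [mb _ _] := gb.
set a := fun x => complex.Re (h x); set b := fun x => complex.Im (h x).
have m0a := measurable_rconv 0 ma; have m0b := measurable_rconv 0 mb.
have m1a := measurable_rconv (- (pi / 2)) ma.
have m1b := measurable_rconv (- (pi / 2)) mb.
under eq_integral do rewrite EFinD.
rewrite ge0_integralD//=; last 4 first.
- by move=> x _; rewrite lee_fin sqr_ge0.
- by apply/measurable_EFinP; meas.
- by move=> x _; rewrite lee_fin sqr_ge0.
- by apply/measurable_EFinP; meas.
set A := (\int[mu]_x (a x ^+ 2)%:E)%E; set B := (\int[mu]_x (b x ^+ 2)%:E)%E.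
have A0 : (0 <= A)%E by exact: integral_sqr_ge0.
have B0 : (0 <= B)%E by exact: integral_sqr_ge0.
apply: (@le_trans _ _ (2%:E * (11%:E * A + 11%:E * B) + 2%:E * (11%:E * B + 11%:E * A)))%E.
  apply: leeD.
    apply: (integral_sqr_bound_add (v := fun x => - rconv (- (pi / 2)) s b x)) => //.
    - by meas.
    - exact: rconv_L2_bound.
    - by under eq_integral do rewrite sqrrN; exact: rconv_L2_bound.
  apply: integral_sqr_bound_add => //; exact: rconv_L2_bound.
rewrite (addeC (11%:E * B)%E) -[(11%:E * A + _)%E]ge0_muleDr// muleA -ge0_muleDl//.
have -> : (2%:E * 11%:E + 2%:E * 11%:E = 44%:E :> \bar R)%E; last by [].
by rewrite -!EFinM -EFinD; congr EFin; ring.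
Qed.

(** For integrable data the kernel integral converges absolutely, and the
    truncation at [n] errs by the evolution of the part of the data outside
    [[-n, n]], which is small in [L^2] because the data are. *)
Lemma free_evolution_cconv h : in_L1L2 (fun x => complex.Re (h x)) ->
  in_L1L2 (fun x => complex.Im (h x)) -> is_free_evolution s h (cconv s h).
Proof.
move=> ga gb; have [ma a1 a2] := ga; have [mb b1 b2] := gb.
have m0a := measurable_rconv 0 ma; have m0b := measurable_rconv 0 mb.
have m1a := measurable_rconv (- (pi / 2)) ma.
have m1b := measurable_rconv (- (pi / 2)) mb.
have h44 : (\int[mu]_x (complex.Re (cconv s h x) ^+ 2 + complex.Im (cconv s h x) ^+ 2)%:E < +oo)%E.
  apply: le_lt_trans (cconv_L2 ga gb) _; apply: lte_mul_pinfty => //.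
  exact: lte_add_pinfty.
split.
- by split; exact: Lfun2_sqr_lty.
- split; apply: Lfun2_sqr_lty; rewrite /cconv/=; [by meas| |by meas|].
    apply: le_lt_trans h44; apply: le_ge0_integral => //; [by meas|by meas|].
    by move=> x _; rewrite sqr_ge0/= lerDl sqr_ge0.
  apply: le_lt_trans h44; apply: le_ge0_integral => //; [by meas|by meas|].
  by move=> x _; rewrite sqr_ge0/= lerDr sqr_ge0.
rewrite (negbTE s0).
pose ht n (y : R) : R[i] := tail n (fun x => complex.Re (h x)) y +i*
                           tail n (fun x => complex.Im (h x)) y.
pose r n := (\int[mu]_x (complex.Re (ht n x) ^+ 2)%:E + \int[mu]_x (complex.Im (ht n x) ^+ 2)%:E)%E.
have errE n x : cconv s h x - cintegral `[- n%:R, n%:R]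
     (fun y => schrodinger_kernel s (x - y) * h y) = cconv s (ht n) x.
  have kint c u : in_L1L2 u -> mu.-integrable `[- n%:R, n%:R]
      (EFin \o (fun y => rkernel c s (x - y) * u y)).
    move=> [mu_ u1 _]; apply: (@integrableS _ _ _ mu setT) => //.
    exact: integrable_rconv.
  pose a y := complex.Re (h y); pose b y := complex.Im (h y).
  have EA : complex.Re (cintegral `[- n%:R, n%:R] (fun y => schrodinger_kernel s (x - y) * h y)) =
      \int[mu]_(y in `[- n%:R, n%:R]) (rkernel 0 s (x - y) * a y) -
      \int[mu]_(y in `[- n%:R, n%:R]) (rkernel (- (pi / 2)) s (x - y) * b y).
    rewrite -RintegralB//; [|exact: kint|exact: kint].
    apply: eq_Rintegral => y _.
    by rewrite Re_mul Re_schrodinger_kernel Im_schrodinger_kernel.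
  have EB : complex.Im (cintegral `[- n%:R, n%:R] (fun y => schrodinger_kernel s (x - y) * h y)) =
      \int[mu]_(y in `[- n%:R, n%:R]) (rkernel 0 s (x - y) * b y) +
      \int[mu]_(y in `[- n%:R, n%:R]) (rkernel (- (pi / 2)) s (x - y) * a y).
    rewrite -RintegralD//; [|exact: kint|exact: kint].
    apply: eq_Rintegral => y _.
    by rewrite Im_mul Re_schrodinger_kernel Im_schrodinger_kernel.
  apply/eqP; rewrite eq_complex Re_sub Im_sub EA EB {EA EB} /cconv.
  apply/andP; split; apply/eqP => /=; rewrite -!rconv_tail//; ring.
have r0 n : (0 <= r n)%E by rewrite adde_ge0// integral_sqr_ge0.
have rcv : r n @[n --> \oo] --> 0%E.
  rewrite -[X in _ --> X](adde0 0%E); apply: cvgeD => //; exact: integral_tail_cvg0.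
have [rfin rfine] := (fine_cvgP _ _).1 rcv.
have bnd : \forall n \near \oo, (0 <= cLnorm 2%:E (fun x => cconv s h x -
    cintegral `[- n%:R, n%:R] (fun y => schrodinger_kernel s (x - y) * h y))%R
    <= (Num.sqrt (44 * fine (r n)))%:E)%E.
  near=> n; apply/andP; split; first exact: Lnorm_ge0.
  rewrite (_ : (fun x => _) = cconv s (ht n)); last by apply/funext => x; exact: errE.
  apply: cLnorm2_le; first exact: sqrtr_ge0.
  rewrite sqr_sqrtr; last by rewrite mulr_ge0// fine_ge0.
  rewrite EFinM fineK; last by near: n.
  by have := @cconv_L2 (ht n); move=> /(_ (in_L1L2_tail n ga) (in_L1L2_tail n gb)).
apply: (squeeze_cvge bnd); first exact: cvg_cst.
apply: cvg_EFin; first exact: nearW.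
rewrite -(sqrtr0 R) -(mulr0 44).
apply: (cvg_comp (fun n => 44 * fine (r n)) Num.sqrt); last exact: sqrt_continuous.
exact: cvgMl_tmp.
Unshelve. all: end_near. Qed.

End FreeEvolutionOfL1L2.

(** * The Duhamel operator *)

Section Duhamel.
Variable R : realType.
Local Notation mu := (@lebesgue_measure R).
Implicit Types (p u : R -> R -> R) (c A B l t x : R).

(** The forcing terms are measured in [L^1] and [L^2], the solutions in [Loo]
    and [L^2], all with the same exponential decay. The bound on a state holds
    at every point, so that iterates are functions and not classes of functions. *)
Definition source A l p := measurable_fun setT (fun z : R * R => p z.1 z.2) /\
  forall t, 0 <= t ->
  (\int[mu]_x `|p t x|%:E <= (A * expR (- (l * t)))%:E)%E /\
  (\int[mu]_x (p t x ^+ 2)%:E <= ((A * expR (- (l * t))) ^+ 2)%:E)%E.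

Definition state B l u := measurable_fun setT (fun z : R * R => u z.1 z.2) /\
  forall t, 0 <= t ->
  (forall x, `|u t x| <= B * expR (- (l * t))) /\
  (\int[mu]_x (u t x ^+ 2)%:E <= ((B * expR (- (l * t))) ^+ 2)%:E)%E.

(** The future [tau > t] is built into the integrand, so that the Duhamel
    integral runs over the whole line. *)
Definition duh_at c p t tau x : R :=
  if t < tau then rconv c (t - tau) (p tau) x else 0.

Definition duh c p t x : R := \int[mu]_tau duh_at c p t tau x.

Lemma integrable_add (f g : R -> R) :
  mu.-integrable setT (EFin \o f) -> mu.-integrable setT (EFin \o g) ->
  mu.-integrable setT (EFin \o (fun x => f x + g x)).
Proof. by move=> fi gi; exact: (integrableD measurableT fi gi). Qed.

Lemma patch_tail (f : R -> R) t :
  (f \_ `]t, +oo[) = (fun tau => if t < tau then f tau else 0).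
Proof.
apply/funext => tau; rewrite patchE; case: ifPn.
  by rewrite inE/= in_itv/= andbT => ->.
by rewrite notin_setE/= in_itv/= andbT => /negP/negbTE ->.
Qed.

Lemma integral_tail_if (f : R -> R) t :
  (\int[mu]_(tau in `]t, +oo[) (f tau)%:E =
   \int[mu]_tau (if t < tau then f tau else 0)%:E)%E.
Proof.
rewrite integral_mkcond; apply: eq_integral => tau _.
by have <- := congr1 (fun g => g tau) (patch_tail f t); rewrite !patchE; case: ifP.
Qed.

Lemma Rintegral_tail_if (f : R -> R) t :
  \int[mu]_(tau in `]t, +oo[) f tau = \int[mu]_tau (if t < tau then f tau else 0).
Proof. by rewrite /Rintegral integral_tail_if. Qed.

Lemma measurable_duh_at c p : measurable_fun setT (fun z : R * R => p z.1 z.2) ->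
  measurable_fun setT (fun z : (R * R) * R => duh_at c p z.1.1 z.2 z.1.2).
Proof.
move=> mp; rewrite /duh_at; apply: measurable_fun_ltr_if; [by meas|by meas| |by meas].
apply: (measurable_fun_Rintegral (f := fun z : ((R * R) * R) * R =>
  rkernel c (z.1.1.1 - z.1.2) (z.1.1.2 - z.2) * p z.1.2 z.2)).
apply: measurable_funM; first by apply: measurable_rkernel; meas.
apply: (measurableT_comp (f := fun z : R * R => p z.1 z.2) mp
  (g := fun z : ((R * R) * R) * R => (z.1.2, z.2))).
by meas.
Qed.

Lemma measurable_duh c p : measurable_fun setT (fun z : R * R => p z.1 z.2) ->
  measurable_fun setT (fun z : R * R => duh c p z.1 z.2).
Proof.
move=> mp; exact: (measurable_fun_Rintegral (f := fun z : (R * R) * R =>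
  duh_at c p z.1.1 z.2 z.1.2) (measurable_duh_at c mp)).
Qed.

Lemma measurable_slice d (T : measurableType d) (f : R * R -> T) t :
  measurable_fun setT f -> measurable_fun setT (fun x => f (t, x)).
Proof. by move=> mf; exact: (measurableT_comp mf (measurable_pair1 t)). Qed.

Lemma measurable_duh_at_time c p t x : measurable_fun setT (fun z : R * R => p z.1 z.2) ->
  measurable_fun setT (fun tau => duh_at c p t tau x).
Proof.
move=> mp; apply: (measurableT_comp (measurable_duh_at c mp)
  (g := fun tau : R => ((t, x), tau))).
by meas.
Qed.

Lemma measurable_duh_at_space c p t : measurable_fun setT (fun z : R * R => p z.1 z.2) ->
  measurable_fun setT (fun z : R * R => duh_at c p t z.1 z.2).
Proof.
move=> mp; apply: (measurableT_comp (measurable_duh_at c mp)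
  (g := fun z : R * R => ((t, z.2), z.1))).
by meas.
Qed.

Section Estimates.
Variables (c A l : R) (p : R -> R -> R).
Hypotheses (A0 : 0 <= A) (l1 : 1 <= l) (sp : source A l p).
Let mp : measurable_fun setT (fun z : R * R => p z.1 z.2) := sp.1.
Let l0 : 0 < l. Proof. exact: lt_le_trans l1. Qed.

Lemma source_in_L1L2 t : 0 <= t -> in_L1L2 (p t).
Proof.
move=> /sp.2 [h1 h2]; split.
- exact: (measurable_slice t mp).
- exact: le_lt_trans h1 (ltry _).
- exact: le_lt_trans h2 (ltry _).
Qed.

Definition invsqrt_tail t tau : R :=
  if t < tau then (Num.sqrt (tau - t))^-1 * expR (- (l * (tau - t))) else 0.

Lemma invsqrt_tail_ge0 t tau : 0 <= invsqrt_tail t tau.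
Proof. by rewrite /invsqrt_tail; case: ifP => // _; rewrite mulr_ge0 ?invr_ge0 ?expR_ge0. Qed.

Lemma integral_invsqrt_tail t :
  (\int[mu]_tau (invsqrt_tail t tau)%:E <= (pi / Num.sqrt l)%:E)%E.
Proof.
rewrite /invsqrt_tail -(integral_tail_if (fun tau =>
  (Num.sqrt (tau - t))^-1 * expR (- (l * (tau - t))))).
exact: integral_invsqrt_expR.
Qed.

(** Dispersion: [L^1] decay of the source at time [tau] gives pointwise decay,
    with the singular factor [(tau - t)^(-1/2)]. *)
Lemma duh_at_sup t tau x : 0 <= t ->
  `|duh_at c p t tau x| <= A * expR (- (l * t)) * invsqrt_tail t tau.
Proof.
move=> t0; rewrite /duh_at /invsqrt_tail; case: ifP => [ttau|_]; last by rewrite normr0 mulr0.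
have [tau0 s0] : 0 <= tau /\ 0 < tau - t by rewrite subr_gt0 (le_trans t0 (ltW ttau)).
have [mq _ _] := source_in_L1L2 tau0.
rewrite -lee_fin; apply: (le_trans (rconv_sup _ _ mq _)).
have h1 : (\int[mu]_x `|p tau x|%:E <= (A * expR (- (l * tau)))%:E)%E by have [] := sp.2 tau tau0.
apply: (le_trans (lee_wpmul2l _ h1)); first by rewrite lee_fin invr_ge0 sqrtr_ge0.
rewrite -EFinM lee_fin distrC (gtr0_norm s0).
rewrite (_ : expR (- (l * tau)) = expR (- (l * t)) * expR (- (l * (tau - t)))); last first.
  by rewrite -expRD; congr expR; ring.
have h : 0 <= A * expR (- (l * t)) * expR (- (l * (tau - t))) by rewrite !mulr_ge0 ?expR_ge0.
rewrite [leLHS](_ : _ = (Num.sqrt (4 * pi * (tau - t)))^-1 *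
   (A * expR (- (l * t)) * expR (- (l * (tau - t))))); last by ring.
rewrite [leRHS](_ : _ = (Num.sqrt (tau - t))^-1 *
   (A * expR (- (l * t)) * expR (- (l * (tau - t))))); last by ring.
rewrite ler_wpM2r// lef_pV2 ?posrE ?sqrtr_gt0// ?mulr_gt0 ?pi_gt0//.
rewrite ler_wsqrtr// ler_peMl ?(ltW s0)//.
by have := @pi_ge2 R; lra.
Qed.

Lemma integral_duh_at t x : 0 <= t ->
  (\int[mu]_tau `|duh_at c p t tau x|%:E <=
   (A * expR (- (l * t)) * (pi / Num.sqrt l))%:E)%E.
Proof.
move=> t0.
have mi : measurable_fun setT (invsqrt_tail t) by rewrite /invsqrt_tail; meas.
apply: (@le_trans _ _ (\int[mu]_tau ((A * expR (- (l * t)))%:E * (invsqrt_tail t tau)%:E))%E).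
  under [leRHS]eq_integral do rewrite -EFinM.
  apply: le_ge0_integral => //.
  - by apply: measurable_fun_normr; exact: measurable_duh_at_time.
  - by meas.
  - by move=> tau _; rewrite normr_ge0 duh_at_sup.
rewrite ge0_integralZl//; last 3 first.
- exact/measurable_EFinP.
- by move=> tau _; rewrite lee_fin invsqrt_tail_ge0.
- by rewrite lee_fin mulr_ge0 ?expR_ge0.
rewrite [leRHS]EFinM; apply: lee_wpmul2l; last exact: integral_invsqrt_tail.
by rewrite lee_fin mulr_ge0 ?expR_ge0.
Qed.

Lemma integrable_duh_at t x : 0 <= t ->
  mu.-integrable setT (EFin \o (fun tau => duh_at c p t tau x)).
Proof.
move=> t0; apply: integrable_lty; first exact: measurable_duh_at_time.
exact: le_lt_trans (integral_duh_at x t0) (ltry _).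
Qed.

Lemma duh_sup t x : 0 <= t ->
  `|duh c p t x| <= A * (pi / Num.sqrt l) * expR (- (l * t)).
Proof.
move=> t0; rewrite -lee_fin mulrAC.
apply: le_trans (integral_duh_at x t0).
by apply: normr_Rintegral_le; exact: measurable_duh_at_time.
Qed.

(** Cauchy-Schwarz in time against the weight [expR (- l tau)], which is half of
    the decay of the squared source. Pointwise in [x] it replaces Minkowski's
    integral inequality. *)
Lemma duh_sqr_le t x : 0 <= t ->
  ((duh c p t x ^+ 2)%:E <= (expR (- (l * t)) / l)%:E *
    \int[mu]_tau (expR (l * tau) * duh_at c p t tau x ^+ 2)%:E)%E.
Proof.
move=> t0; set a := expR (- (l * t)) / l; set m := duh c p t x.
have a0 : 0 < a by rewrite divr_gt0 ?expR_gt0.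
pose w tau : R := if t < tau then expR (- (l * tau)) else 0.
pose G tau := duh_at c p t tau x.
have mG : measurable_fun setT G by exact: measurable_duh_at_time.
have mw : measurable_fun setT w by rewrite /w; meas.
have wa : (\int[mu]_tau (w tau)%:E = a%:E)%E.
  by rewrite /w -(integral_tail_if (fun tau => expR (- (l * tau)))) integral_expR_tail.
have w0 tau : 0 <= w tau by rewrite /w; case: ifP => // _; rewrite expR_ge0.
have mE : measurable_fun setT (fun tau : R => expR (l * tau)) by meas.
set b := (\int[mu]_tau _)%E.
have b0 : (0 <= b)%E.
  by apply: integral_ge0 => tau _; rewrite lee_fin mulr_ge0 ?expR_ge0 ?sqr_ge0.
have [boo|] := eqVneq b +oo%E; first by rewrite boo gt0_muley ?leey// lte_fin.
rewrite -ltey => blt.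
have bE : b = (fine b)%:E by rewrite fineK// ge0_fin_numE.
have iw : mu.-integrable setT (EFin \o w).
  apply: integrable_lty => //; under eq_integral do rewrite ger0_norm//.
  by rewrite wa ltry.
have ib : mu.-integrable setT (EFin \o (fun tau => expR (l * tau) * G tau ^+ 2)).
  apply: integrable_lty; first by meas.
  have q0 tau : 0 <= expR (l * tau) * G tau ^+ 2 by rewrite mulr_ge0 ?expR_ge0 ?sqr_ge0.
  by under eq_integral do rewrite ger0_norm ?q0//.
have iG : mu.-integrable setT (EFin \o G) by exact: integrable_duh_at.
have e1 : m ^+ 2 = \int[mu]_tau (m * G tau) by rewrite RintegralZl// expr2.
have e2 : \int[mu]_tau (m ^+ 2 / a / 2 * w tau + a / 2 * (expR (l * tau) * G tau ^+ 2)) =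
   m ^+ 2 / 2 + a / 2 * fine b.
  rewrite RintegralD//; [|exact: integrable_scale|exact: integrable_scale].
  rewrite !RintegralZl// -/b; congr (_ + _).
  by rewrite /Rintegral wa /=; field; rewrite gt_eqF.
have : m ^+ 2 <= m ^+ 2 / 2 + a / 2 * fine b.
  rewrite [leLHS]e1 -e2; apply: le_Rintegral => //.
  - exact: integrable_scale.
  - by apply: integrable_add; exact: integrable_scale.
  move=> tau _; rewrite /w /G /duh_at; case: ifP => _; last first.
    by rewrite !mulr0 expr0n/= !mulr0 addr0.
  set g := rconv _ _ _ _.
  have e0 : 0 < expR (l * tau) by exact: expR_gt0.
  rewrite expRN -subr_ge0.
  rewrite (_ : _ - _ = (m - a * expR (l * tau) * g) ^+ 2 / (2 * a * expR (l * tau))).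
    apply: divr_ge0; first exact: sqr_ge0.
    by apply: mulr_ge0; [apply: mulr_ge0 => //|]; apply: ltW.
  by field; rewrite !gt_eqF.
by rewrite bE -EFinM lee_fin; lra.
Qed.

(** Integrated in space first, the squares are controlled by the [L^2] bound of
    the free evolution. *)
Lemma integral_duh_at_sqr t : 0 <= t ->
  (\int[mu]_tau \int[mu]_x (expR (l * tau) * duh_at c p t tau x ^+ 2)%:E <=
   (11 * A ^+ 2 * (expR (- (l * t)) / l))%:E)%E.
Proof.
move=> t0; set a := expR (- (l * t)) / l.
pose F (z : R * R) := expR (l * z.1) * duh_at c p t z.1 z.2 ^+ 2.
have mF : measurable_fun setT F.
  by apply: measurable_funM; [meas|apply: measurable_funX; exact: measurable_duh_at_space].
have F0 z : 0 <= F z by rewrite mulr_ge0 ?expR_ge0 ?sqr_ge0.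
pose w tau : R := if t < tau then expR (- (l * tau)) else 0.
have mw : measurable_fun setT w by rewrite /w; meas.
have w0 tau : 0 <= w tau by rewrite /w; case: ifP => // _; rewrite expR_ge0.
have wa : (\int[mu]_tau (w tau)%:E = a%:E)%E.
  by rewrite /w -(integral_tail_if (fun tau => expR (- (l * tau)))) integral_expR_tail.
apply: (@le_trans _ _ (\int[mu]_tau ((11 * A ^+ 2)%:E * (w tau)%:E))%E); last first.
  rewrite ge0_integralZl//; last 3 first.
  - exact/measurable_EFinP.
  - by move=> tau _; rewrite lee_fin.
  - by rewrite lee_fin mulr_ge0 ?sqr_ge0.
  by rewrite wa -!EFinM.
apply: ge0_le_integral; first by [].
- by move=> tau _; apply: integral_ge0 => x _; rewrite lee_fin; exact: (F0 (tau, x)).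
- exact: (measurable_fun_ge0_integral (f := F)).
- by apply: emeasurable_funM => //; exact/measurable_EFinP.
move=> tau _; rewrite /w /duh_at /=; case: ifP => [ttau|_]; last first.
  by rewrite mule0 integral0_eq// => x _; rewrite expr0n/= mulr0.
have tau0 : 0 <= tau by exact: le_trans t0 (ltW ttau).
have s0 : t - tau != 0 by rewrite subr_eq0 lt_eqF.
have gq := source_in_L1L2 tau0.
under eq_integral do rewrite EFinM.
have [mq _ _] := gq.
rewrite ge0_integralZl//; last 2 first.
- by apply/measurable_EFinP; apply: measurable_funX; exact: measurable_rconv.
- by move=> x _; rewrite lee_fin sqr_ge0.
apply: (le_trans (lee_wpmul2l _ (rconv_L2_bound s0 c gq))).
  by rewrite lee_fin expR_ge0.
have h2 : (\int[mu]_x (p tau x ^+ 2)%:E <= ((A * expR (- (l * tau))) ^+ 2)%:E)%E.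
  by have [] := sp.2 tau tau0.
rewrite muleA; apply: (le_trans (lee_wpmul2l _ h2)).
  by rewrite lee_fin mulr_ge0 ?expR_ge0.
rewrite -!EFinM lee_fin expRN exprMn.
have := expR_gt0 (l * tau); move: (expR _) => e e0.
by rewrite le_eqVlt; apply/orP; left; apply/eqP; field; rewrite gt_eqF.
Qed.

Lemma duh_L2 t : 0 <= t ->
  (\int[mu]_x (duh c p t x ^+ 2)%:E <= (11 * (A * (expR (- (l * t)) / l)) ^+ 2)%:E)%E.
Proof.
move=> t0; set a := expR (- (l * t)) / l.
have a0 : 0 < a by rewrite divr_gt0 ?expR_gt0.
pose F (z : R * R) := expR (l * z.2) * duh_at c p t z.2 z.1 ^+ 2.
have mF : measurable_fun setT F.
  apply: measurable_funM; first by meas.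
  apply: measurable_funX; apply: (measurableT_comp (measurable_duh_at_space c t mp)
    (g := fun z : R * R => (z.2, z.1))).
  by meas.
have F0 z : 0 <= F z by rewrite mulr_ge0 ?expR_ge0 ?sqr_ge0.
have mI : measurable_fun setT ((fun x => \int[mu]_tau (F (x, tau))%:E) : R -> \bar R)%E.
  exact: measurable_fun_ge0_integral.
apply: (@le_trans _ _ (\int[mu]_x (a%:E * \int[mu]_tau (F (x, tau))%:E))%E).
  apply: ge0_le_integral => //.
  - by move=> x _; rewrite lee_fin sqr_ge0.
  - apply/measurable_EFinP; apply: measurable_funX.
    exact: (measurable_slice t (measurable_duh c mp)).
  - by apply: emeasurable_funM.
  - by move=> x _; exact: duh_sqr_le.
rewrite ge0_integralZl//; last 2 first.
- by move=> x _; apply: integral_ge0 => tau _; rewrite lee_fin.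
- by rewrite lee_fin ltW.
have -> : (\int[mu]_x \int[mu]_tau (F (x, tau))%:E =
           \int[mu]_tau \int[mu]_x (F (x, tau))%:E)%E.
  apply: (fubini_tonelli (m1 := mu) (m2 := mu) (fun z => (F z)%:E)).
    exact/measurable_EFinP.
  by move=> z; rewrite lee_fin.
apply: (le_trans (lee_wpmul2l _ (integral_duh_at_sqr t0))); first by rewrite lee_fin ltW.
by rewrite -EFinM lee_fin exprMn -/a le_eqVlt; apply/orP; left; apply/eqP; ring.
Qed.

(** The gain [(sqrt l)^-1] comes from the dispersive estimate; the [L^2] norm
    even gains [l^-1]. The constant 4 is a common bound for [pi] and [sqrt 11]. *)
Lemma duh_state : state (4 * A / Num.sqrt l) l (duh c p).
Proof.
have sl0 : 0 < Num.sqrt l by rewrite sqrtr_gt0.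
split=> [|t t0]; first exact: measurable_duh.
split=> [x|].
  apply: (le_trans (duh_sup x t0)); rewrite ler_wpM2r ?expR_ge0//.
  rewrite mulrA ler_wpM2r ?invr_ge0 ?sqrtr_ge0// mulrC ler_wpM2r//.
  by have := @pihalf_lt2 R; lra.
apply: (le_trans (duh_L2 t0)); rewrite lee_fin.
rewrite [leLHS](_ : _ = 11 / l ^+ 2 * (A * expR (- (l * t))) ^+ 2); last first.
  by field; rewrite gt_eqF.
rewrite [leRHS](_ : _ = 16 / l * (A * expR (- (l * t))) ^+ 2); last first.
  by rewrite !exprMn exprVn sqr_sqrtr ?(ltW l0)//; field; rewrite gt_eqF.
rewrite ler_wpM2r ?sqr_ge0// ler_pdivrMr ?exprn_gt0//.
rewrite [leRHS](_ : _ = 16 * l); last by field; rewrite gt_eqF.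
apply: (@le_trans _ _ (16 * 1)); first by lra.
by rewrite ler_wpM2l.
Qed.

End Estimates.

Lemma duhB c A A' l p p' t x : 0 <= A -> 0 <= A' -> 1 <= l ->
  source A l p -> source A' l p' -> 0 <= t ->
  duh c (fun t x => p t x - p' t x) t x = duh c p t x - duh c p' t x.
Proof.
move=> A0 A0' l1 sp sp' t0; rewrite /duh -RintegralB//; last 2 first.
- exact: (integrable_duh_at c A0 l1 sp).
- exact: (integrable_duh_at c A0' l1 sp').
apply: eq_Rintegral => tau _; rewrite /duh_at; case: ifP => [ttau|]; last by rewrite subr0.
have tau0 : 0 <= tau by exact: le_trans t0 (ltW ttau).
have [mq q1 _] := source_in_L1L2 sp tau0; have [mq' q1' _] := source_in_L1L2 sp' tau0.
exact: rconvB.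
Qed.

End Duhamel.

(** * The Duhamel term as an integral with values in L^2 *)

Section DuhamelL2Integral.
Variable R : realType.
Local Notation mu := (@lebesgue_measure R).
Implicit Types (p u : R -> R -> R) (c A B l t x : R).

Lemma integrable_mul_L2 (u v : R -> R) :
  measurable_fun setT u -> measurable_fun setT v ->
  (\int[mu]_x (u x ^+ 2)%:E < +oo)%E -> (\int[mu]_x (v x ^+ 2)%:E < +oo)%E ->
  mu.-integrable setT (EFin \o (fun x => u x * v x)).
Proof.
move=> m_u m_v u2 v2.
have isq (f : R -> R) : measurable_fun setT f -> (\int[mu]_x (f x ^+ 2)%:E < +oo)%E ->
    mu.-integrable setT (EFin \o (fun x => f x ^+ 2)).
  move=> mf f2; apply: integrable_lty; first by meas.
  by under eq_integral do rewrite ger0_norm ?sqr_ge0//.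
apply: (integrable_dominated (g := fun x => u x ^+ 2 + v x ^+ 2)); first by meas.
  by apply: integrable_add; exact: isq.
move=> x; rewrite normrM -(real_normK (num_real (u x))) -(real_normK (num_real (v x))).
by have := sqr_ge0 (`|u x| - `|v x|); move: (normr_ge0 (u x)) (normr_ge0 (v x)); nra.
Qed.

Section Pairing.
Variables (c A l : R) (p : R -> R -> R).
Hypotheses (A0 : 0 <= A) (l1 : 1 <= l) (sp : source A l p).
Variables (t : R) (psi : R -> R).
Hypotheses (t0 : 0 <= t) (mpsi : measurable_fun setT psi)
  (psi2 : (\int[mu]_x (psi x ^+ 2)%:E < +oo)%E).
Let mp : measurable_fun setT (fun z : R * R => p z.1 z.2) := sp.1.
Let l0 : 0 < l. Proof. exact: lt_le_trans l1. Qed.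

Lemma duh_at_L2_lty tau : (\int[mu]_x (duh_at c p t tau x ^+ 2)%:E < +oo)%E.
Proof.
rewrite /duh_at; case: (boolP (t < tau)) => [ttau|_].
  apply: rconv_L2_lty.
    by rewrite subr_eq0 lt_eqF.
  by apply: (source_in_L1L2 sp); exact: le_trans t0 (ltW ttau).
by under eq_integral do rewrite expr0n/=; rewrite integral0 ltry.
Qed.

Lemma integrable_duh_at_pairing tau :
  mu.-integrable setT (EFin \o (fun x => duh_at c p t tau x * psi x)).
Proof.
apply: integrable_mul_L2 => //; last exact: duh_at_L2_lty.
exact: (measurable_slice tau (measurable_duh_at_space c t mp)).
Qed.

Lemma integrable_duh_pairing :
  mu.-integrable setT (EFin \o (fun x => duh c p t x * psi x)).
Proof.
apply: integrable_mul_L2 => //.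
  exact: (measurable_slice t (measurable_duh c mp)).
exact: le_lt_trans (duh_L2 c A0 l1 sp t0) (ltry _).
Qed.

(* Absolute convergence, by the weighted inequality
   [g psi <= e g^2 + psi^2 / e] with [e = expR (l tau)]. *)
Let pairing_lty :
  (\int[mu]_tau \int[mu]_x `|duh_at c p t tau x * psi x|%:E < +oo)%E.
Proof.
pose w tau : R := if t < tau then expR (- (l * tau)) else 0.
have mw : measurable_fun setT w by rewrite /w; meas.
have w0 tau : 0 <= w tau by rewrite /w; case: ifP => // _; rewrite expR_ge0.
pose F (z : R * R) := expR (l * z.1) * duh_at c p t z.1 z.2 ^+ 2.
pose H (z : R * R) := w z.1 * psi z.2 ^+ 2.
have mD := measurable_duh_at_space c t mp.
have mF : measurable_fun setT F by apply: measurable_funM; [meas|exact: measurable_funX].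
have mH : measurable_fun setT H by rewrite /H; meas.
have F0 z : 0 <= F z by rewrite mulr_ge0 ?expR_ge0 ?sqr_ge0.
have H0 z : 0 <= H z by rewrite mulr_ge0 ?sqr_ge0.
have mFi : measurable_fun setT ((fun y => \int[mu]_x (F (y, x))%:E) : R -> \bar R)%E.
  exact: measurable_fun_ge0_integral.
have mHi : measurable_fun setT ((fun y => \int[mu]_x (H (y, x))%:E) : R -> \bar R)%E.
  exact: measurable_fun_ge0_integral.
have mP : measurable_fun setT (fun z : R * R => duh_at c p t z.1 z.2 * psi z.2) by meas.
apply: (@le_lt_trans _ _ (\int[mu]_tau (\int[mu]_x (F (tau, x))%:E + \int[mu]_x (H (tau, x))%:E))%E).
  apply: ge0_le_integral; first by [].
  - by move=> tau _; apply: integral_ge0.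
  - apply: (measurable_fun_ge0_integral (f := fun z => `|duh_at c p t z.1 z.2 * psi z.2|)) => //.
    exact: measurable_fun_normr.
  - exact: emeasurable_funD.
  move=> tau _; rewrite -ge0_integralD//; last 4 first.
  - by move=> x _; rewrite lee_fin.
  - by apply/measurable_EFinP; exact: measurable_slice mF.
  - by move=> x _; rewrite lee_fin.
  - by apply/measurable_EFinP; exact: measurable_slice mH.
  under [leRHS]eq_integral do rewrite -EFinD.
  apply: le_ge0_integral => //.
  - by apply: measurable_fun_normr; exact: (measurable_slice tau mP).
  - apply: measurable_funD; [exact: (measurable_slice tau mF)|exact: (measurable_slice tau mH)].
  move=> x _; rewrite normr_ge0/= /F /H /= /w /duh_at; case: ifP => [_|_]; last first.
    by rewrite mul0r normr0 expr0n/= mulr0 mul0r addr0.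
  set g := rconv _ _ _ _; rewrite normrM -(real_normK (num_real g)) -(real_normK (num_real (psi x))).
  rewrite expRN; have e0 : 0 < expR (l * tau) by exact: expR_gt0.
  move: (normr_ge0 g) (normr_ge0 (psi x)) e0; move: (expR _) => e.
  move: (`|g|) (`|psi x|) => a b a0 b0 e0.
  rewrite -subr_ge0 (_ : _ - _ = ((e * a - b / 2) ^+ 2 + b ^+ 2 * 3 / 4) / e); last first.
    by field; rewrite gt_eqF.
  by rewrite divr_ge0 ?(ltW e0)// addr_ge0 ?sqr_ge0// divr_ge0// mulr_ge0 ?sqr_ge0.
rewrite ge0_integralD//; last 2 first.
- by move=> tau _; apply: integral_ge0 => x _; rewrite lee_fin.
- by move=> tau _; apply: integral_ge0 => x _; rewrite lee_fin.
apply: lte_add_pinfty.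
  by apply: le_lt_trans (integral_duh_at_sqr c l1 sp t0) _; exact: ltry.
pose P := fine (\int[mu]_x (psi x ^+ 2)%:E).
have PE : (\int[mu]_x (psi x ^+ 2)%:E)%E = P%:E.
  by rewrite /P fineK// ge0_fin_numE// integral_sqr_ge0.
rewrite (_ : (\int[mu]_tau _)%E = (\int[mu]_tau (P%:E * (w tau)%:E))%E); last first.
  apply: eq_integral => tau _; rewrite /H/=; under eq_integral do rewrite EFinM.
  rewrite ge0_integralZl//; last 3 first.
  - by apply/measurable_EFinP; meas.
  - by move=> x _; rewrite lee_fin sqr_ge0.
  - by rewrite lee_fin.
  by rewrite PE muleC.
rewrite ge0_integralZl//; last 3 first.
- exact/measurable_EFinP.
- by move=> tau _; rewrite lee_fin.
- by rewrite -PE; exact: integral_sqr_ge0.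
by rewrite /w -(integral_tail_if (fun tau => expR (- (l * tau)))) integral_expR_tail// -EFinM ltry.
Qed.

Lemma measurable_pairing :
  measurable_fun setT (fun tau => \int[mu]_x (duh_at c p t tau x * psi x)).
Proof.
apply: (measurable_fun_Rintegral (f := fun z : R * R => duh_at c p t z.1 z.2 * psi z.2)).
by have mD := measurable_duh_at_space c t mp; meas.
Qed.

Lemma integrable_pairing :
  mu.-integrable setT (EFin \o (fun tau => \int[mu]_x (duh_at c p t tau x * psi x))).
Proof.
apply: integrable_lty; first exact: measurable_pairing.
have mD := measurable_duh_at_space c t mp.
have mP : measurable_fun setT (fun z : R * R => duh_at c p t z.1 z.2 * psi z.2) by meas.
apply: le_lt_trans pairing_lty; apply: ge0_le_integral; first by [].
- by [].
- by apply/measurable_EFinP; apply: measurable_fun_normr; exact: measurable_pairing.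
- apply: (measurable_fun_ge0_integral (f := fun z => `|duh_at c p t z.1 z.2 * psi z.2|)) => //.
  exact: measurable_fun_normr.
- by move=> tau _; apply: normr_Rintegral_le; exact: (measurable_slice tau mP).
Qed.

Lemma duh_pairing : \int[mu]_x (duh c p t x * psi x) =
  \int[mu]_tau \int[mu]_x (duh_at c p t tau x * psi x).
Proof.
have mD := measurable_duh_at_space c t mp.
rewrite (Rintegral_swap (f := fun z => duh_at c p t z.1 z.2 * psi z.2)) => [|//|].
- apply: eq_Rintegral => x _ /=; rewrite RintegralZr//.
  exact: (integrable_duh_at c A0 l1 sp).
- by meas.
- exact: pairing_lty.
Qed.

End Pairing.

Definition cduh (h : R -> R -> R[i]) (t x : R) : R[i] :=
  (duh 0 (fun t x => complex.Re (h t x)) t x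
   - duh (- (pi / 2)) (fun t x => complex.Im (h t x)) t x) +i*
  (duh 0 (fun t x => complex.Im (h t x)) t x
   + duh (- (pi / 2)) (fun t x => complex.Re (h t x)) t x).

End DuhamelL2Integral.

Section DuhamelIsL2Integral.
Variable R : realType.
Local Notation mu := (@lebesgue_measure R).

Lemma Lfun2_sqr_integrable (f : R -> R) : f \in Lfun mu 2%:E ->
  measurable_fun setT f /\ (\int[mu]_x (f x ^+ 2)%:E < +oo)%E.
Proof.
move=> Lf; split; first by move: Lf => /andP[]; rewrite inE.
have /integrableP[_] := Lfun2_integrable_sqr Lf.
by under eq_integral do rewrite /= ger0_norm ?sqr_ge0//.
Qed.

Lemma Re_mul_conj (z w : R[i]) : complex.Re (z * conjc w) =
  complex.Re z * complex.Re w + complex.Im z * complex.Im w.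
Proof. by case: z w => [? ?] [? ?] /=; ring. Qed.

Lemma Im_mul_conj (z w : R[i]) : complex.Im (z * conjc w) =
  complex.Im z * complex.Re w - complex.Re z * complex.Im w.
Proof. by case: z w => [? ?] [? ?] /=; ring. Qed.

Lemma integrable_sub (f g : R -> R) :
  mu.-integrable setT (EFin \o f) -> mu.-integrable setT (EFin \o g) ->
  mu.-integrable setT (EFin \o (fun x => f x - g x)).
Proof. by move=> fi gi; exact: (integrableB measurableT fi gi). Qed.

Lemma Rintegral_lin4 (f1 f2 f3 f4 : R -> R) :
  mu.-integrable setT (EFin \o f1) -> mu.-integrable setT (EFin \o f2) ->
  mu.-integrable setT (EFin \o f3) -> mu.-integrable setT (EFin \o f4) ->
  \int[mu]_x (f1 x - f2 x + (f3 x + f4 x)) =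
  \int[mu]_x f1 x - \int[mu]_x f2 x + (\int[mu]_x f3 x + \int[mu]_x f4 x).
Proof.
move=> i1 i2 i3 i4; rewrite RintegralD//; [|exact: integrable_sub|exact: integrable_add].
by rewrite RintegralB// RintegralD.
Qed.

Variables (A l : R) (h : R -> R -> R[i]) (t : R).
Let a := fun t x => complex.Re (h t x).
Let b := fun t x => complex.Im (h t x).
Hypotheses (A0 : 0 <= A) (l1 : 1 <= l) (sa : source A l a) (sb : source A l b).
Hypothesis t0 : 0 <= t.
Let l0 : 0 < l. Proof. exact: lt_le_trans l1. Qed.
Let c1 : R := - (pi / 2).

Let G tau x : R[i] :=
  (duh_at 0 a t tau x - duh_at c1 b t tau x) +i*
  (duh_at 0 b t tau x + duh_at c1 a t tau x).

Let GE tau : t < tau -> cconv (t - tau) (h tau) = G tau.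
Proof. by move=> ttau; apply/funext => x; rewrite /cconv /G /duh_at ttau. Qed.

Lemma cconv_free_evolution tau : t < tau ->
  is_free_evolution (t - tau) (h tau) (cconv (t - tau) (h tau)).
Proof.
move=> ttau; have tau0 : 0 <= tau by exact: le_trans t0 (ltW ttau).
apply: free_evolution_cconv; first by rewrite subr_eq0 lt_eqF.
  exact: (source_in_L1L2 sa).
exact: (source_in_L1L2 sb).
Qed.

Let inner_Re (u v u' v' : R -> R) (psi : R -> R[i]) :
  let p1 := fun x => complex.Re (psi x) in let p2 := fun x => complex.Im (psi x) in
  mu.-integrable setT (EFin \o (fun x => u x * p1 x)) ->
  mu.-integrable setT (EFin \o (fun x => v x * p1 x)) ->
  mu.-integrable setT (EFin \o (fun x => u' x * p2 x)) ->
  mu.-integrable setT (EFin \o (fun x => v' x * p2 x)) ->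
  complex.Re (L2inner (fun x => (u x - v x) +i* (u' x + v' x)) psi) =
  \int[mu]_x (u x * p1 x) - \int[mu]_x (v x * p1 x) +
  (\int[mu]_x (u' x * p2 x) + \int[mu]_x (v' x * p2 x)).
Proof.
move=> p1 p2 i1 i2 i3 i4; rewrite -Rintegral_lin4//.
by apply: eq_Rintegral => x _; rewrite Re_mul_conj /=; ring.
Qed.

Let inner_Im (u v u' v' : R -> R) (psi : R -> R[i]) :
  let p1 := fun x => complex.Re (psi x) in let p2 := fun x => complex.Im (psi x) in
  mu.-integrable setT (EFin \o (fun x => u' x * p1 x)) ->
  mu.-integrable setT (EFin \o (fun x => u x * p2 x)) ->
  mu.-integrable setT (EFin \o (fun x => v' x * p1 x)) ->
  mu.-integrable setT (EFin \o (fun x => v x * p2 x)) ->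
  complex.Im (L2inner (fun x => (u x - v x) +i* (u' x + v' x)) psi) =
  \int[mu]_x (u' x * p1 x) - \int[mu]_x (u x * p2 x) +
  (\int[mu]_x (v' x * p1 x) + \int[mu]_x (v x * p2 x)).
Proof.
move=> p1 p2 i1 i2 i3 i4; rewrite -Rintegral_lin4//.
by apply: eq_Rintegral => x _; rewrite Im_mul_conj /=; ring.
Qed.

Let pair c p (q : R -> R) tau := \int[mu]_x (duh_at c p t tau x * q x).

Let pair0 c p q tau : ~~ (t < tau) -> pair c p q tau = 0.
Proof.
move=> /negbTE nt; rewrite /pair /Rintegral; under eq_integral do rewrite /duh_at nt mul0r.
by rewrite integral0.
Qed.

Let tail_lin4 c2 c3 c4 c5 p2 p3 p4 p5 q2 q3 q4 q5 (f : R -> R) :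
  let J tau := pair c2 p2 q2 tau - pair c3 p3 q3 tau +
               (pair c4 p4 q4 tau + pair c5 p5 q5 tau) in
  mu.-integrable setT (EFin \o pair c2 p2 q2) ->
  mu.-integrable setT (EFin \o pair c3 p3 q3) ->
  mu.-integrable setT (EFin \o pair c4 p4 q4) ->
  mu.-integrable setT (EFin \o pair c5 p5 q5) ->
  (forall tau, t < tau -> f tau = J tau) ->
  mu.-integrable `]t, +oo[ (EFin \o f) /\
  \int[mu]_(tau in `]t, +oo[) f tau =
   \int[mu]_tau pair c2 p2 q2 tau - \int[mu]_tau pair c3 p3 q3 tau +
   (\int[mu]_tau pair c4 p4 q4 tau + \int[mu]_tau pair c5 p5 q5 tau).
Proof.
move=> J i2 i3 i4 i5 fJ.
have iJ : mu.-integrable setT (EFin \o J).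
  by apply: integrable_add; [exact: integrable_sub|exact: integrable_add].
split.
  apply: (@eq_integrable _ _ _ mu _ (measurable_itv _) (EFin \o J)).
    by move=> tau; rewrite inE/= in_itv/= andbT => ttau; rewrite /= fJ.
  exact: (@integrableS _ _ _ mu setT).
rewrite -Rintegral_lin4// Rintegral_tail_if; apply: eq_Rintegral => tau _.
case: ifPn => [ttau|nt]; first by rewrite fJ.
by rewrite !pair0// subrr !addr0.
Qed.

(** The Duhamel term is, in [L^2], the Bochner integral of the free evolutions
    of the source: tested against [psi], this is Fubini's theorem. *)
Lemma cduh_is_L2_integral :
  is_L2_integral `]t, +oo[ (fun tau => cconv (t - tau) (h tau)) (cduh h t).
Proof.
have ma := measurable_duh_at_space 0 t sa.1.
have ma1 := measurable_duh_at_space c1 t sa.1.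
have mb := measurable_duh_at_space 0 t sb.1.
have mb1 := measurable_duh_at_space c1 t sb.1.
split.
- apply: aeW => tau /=; rewrite in_itv/= andbT => ttau.
  by have [_ ?] := cconv_free_evolution ttau.
- pose N tau := (\int[mu]_x (complex.Re (G tau x) ^+ 2 + complex.Im (G tau x) ^+ 2)%:E)%E.
  have mN : measurable_fun setT (N : R -> \bar R).
    apply: (measurable_fun_ge0_integral (f := fun z : R * R =>
      complex.Re (G z.1 z.2) ^+ 2 + complex.Im (G z.1 z.2) ^+ 2)).
      by rewrite /G/=; meas.
    by move=> z; rewrite addr_ge0 ?sqr_ge0.
  apply: (@eq_integrable _ _ _ mu _ (measurable_itv _) (fun tau => (N tau `^ 2^-1)%E)).
    move=> tau; rewrite inE/= in_itv/= andbT => ttau.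
    by rewrite GE// cLnorm2E.
  apply: (@le_integrable _ _ _ mu _ (measurable_itv _) _
     (EFin \o (fun tau => 10 * A * expR (- (l * tau))))).
  + apply: measurable_funTS; apply: (measurableT_comp (measurable_poweR 2^-1) mN).
  + move=> tau /=; rewrite in_itv/= andbT => ttau.
    have tau0 : 0 <= tau by exact: le_trans t0 (ltW ttau).
    rewrite gee0_abs ?poweR_ge0// ger0_norm ?mulr_ge0 ?expR_ge0//.
    rewrite -cLnorm2E -GE//; apply: cLnorm2_le; first by rewrite !mulr_ge0 ?expR_ge0.
    have s0 : t - tau != 0 by rewrite subr_eq0 lt_eqF.
    apply: (le_trans (cconv_L2 s0 (source_in_L1L2 sa tau0) (source_in_L1L2 sb tau0))).
    have [_ ha] := sa.2 tau tau0; have [_ hb] := sb.2 tau tau0.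
    apply: (le_trans (lee_wpmul2l _ (leeD ha hb))) => //.
    rewrite -EFinD -EFinM lee_fin -mulrA [leRHS]exprMn.
    by have := sqr_ge0 (A * expR (- (l * tau))); lra.
  + apply: (@eq_integrable _ _ _ mu _ (measurable_itv _)
      (fun tau => ((10 * A)%:E * (expR (- (l * tau)))%:E)%E)) => //.
    apply: integrableZl => //; apply/integrableP; split.
      by apply/measurable_EFinP; apply: measurable_funTS; meas.
    under eq_integral do rewrite /= ger0_norm ?expR_ge0//.
    by rewrite integral_expR_tail// ltry.
- have L2d c p : source A l p -> (\int[mu]_x (duh c p t x ^+ 2)%:E < +oo)%E.
    by move=> sp; exact: le_lt_trans (duh_L2 c A0 l1 sp t0) (ltry _).
  have md c p : source A l p -> measurable_fun setT (duh c p t).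
    by move=> sp; exact: (measurable_slice t (measurable_duh c sp.1)).
  have L2add (u v : R -> R) : measurable_fun setT u -> measurable_fun setT v ->
      (\int[mu]_x (u x ^+ 2)%:E < +oo)%E -> (\int[mu]_x (v x ^+ 2)%:E < +oo)%E ->
      (fun x => u x + v x) \in Lfun mu 2%:E.
    move=> m_u m_v u2 v2; apply: Lfun2_sqr_lty; first by meas.
    apply: (le_lt_trans (integral_sqr_bound_add m_u m_v (lexx _) (lexx _))).
    apply: lte_mul_pinfty => //; exact: lte_add_pinfty.
  split; rewrite /cduh/=.
    apply: (L2add (duh 0 a t) (fun x => - duh c1 b t x)).
    + exact: md.
    + by apply: measurable_fun_oppr; exact: md.
    + exact: L2d.
    + by under eq_integral do rewrite sqrrN; exact: L2d.
  by apply: (L2add (duh 0 b t) (duh c1 a t)); [exact: md|exact: md|exact: L2d|exact: L2d].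
move=> psi [/Lfun2_sqr_integrable[m1 s1] /Lfun2_sqr_integrable[m2 s2]].
have ip c p (q : R -> R) : source A l p -> measurable_fun setT q ->
    (\int[mu]_x (q x ^+ 2)%:E < +oo)%E -> mu.-integrable setT (EFin \o pair c p q).
  by move=> sp mq q2; exact: (integrable_pairing c l1 sp t0 mq q2).
have ie c p (q : R -> R) tau : source A l p -> measurable_fun setT q ->
    (\int[mu]_x (q x ^+ 2)%:E < +oo)%E ->
    mu.-integrable setT (EFin \o (fun x => duh_at c p t tau x * q x)).
  by move=> sp mq q2; exact: (integrable_duh_at_pairing c sp t0 mq q2).
have id c p (q : R -> R) : source A l p -> measurable_fun setT q ->
    (\int[mu]_x (q x ^+ 2)%:E < +oo)%E ->
    mu.-integrable setT (EFin \o (fun x => duh c p t x * q x)).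
  by move=> sp mq q2; exact: (integrable_duh_pairing c A0 l1 sp t0 mq q2).
have dE c p (q : R -> R) : source A l p -> measurable_fun setT q ->
    (\int[mu]_x (q x ^+ 2)%:E < +oo)%E ->
    \int[mu]_x (duh c p t x * q x) = \int[mu]_tau pair c p q tau.
  by move=> sp mq q2; exact: (duh_pairing c A0 l1 sp t0 mq q2).
pose p1 x := complex.Re (psi x); pose p2 x := complex.Im (psi x).
have [iRe eRe] := tail_lin4 (ip 0 a p1 sa m1 s1) (ip c1 b p1 sb m1 s1)
  (ip 0 b p2 sb m2 s2) (ip c1 a p2 sa m2 s2)
  (f := fun tau => complex.Re (L2inner (cconv (t - tau) (h tau)) psi))
  (fun tau ttau => etrans (congr1 (fun g => complex.Re (L2inner g psi)) (GE ttau))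
    (inner_Re (ie 0 a p1 tau sa m1 s1) (ie c1 b p1 tau sb m1 s1)
    (ie 0 b p2 tau sb m2 s2) (ie c1 a p2 tau sa m2 s2))).
have [iIm eIm] := tail_lin4 (ip 0 b p1 sb m1 s1) (ip 0 a p2 sa m2 s2)
  (ip c1 a p1 sa m1 s1) (ip c1 b p2 sb m2 s2)
  (f := fun tau => complex.Im (L2inner (cconv (t - tau) (h tau)) psi))
  (fun tau ttau => etrans (congr1 (fun g => complex.Im (L2inner g psi)) (GE ttau))
    (inner_Im (ie 0 b p1 tau sb m1 s1) (ie 0 a p2 tau sa m2 s2)
    (ie c1 a p1 tau sa m1 s1) (ie c1 b p2 tau sb m2 s2))).
split; first by split.
apply/eqP; rewrite eq_complex; apply/andP; split; apply/eqP.
  apply: etrans (esym eRe).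
  apply: etrans (inner_Re (id 0 a p1 sa m1 s1) (id c1 b p1 sb m1 s1)
    (id 0 b p2 sb m2 s2) (id c1 a p2 sa m2 s2)) _.
  congr (_ - _ + (_ + _)); [exact: dE sa m1 s1|exact: dE sb m1 s1|exact: dE sb m2 s2|exact: dE sa m2 s2].
apply: etrans (esym eIm).
apply: etrans (inner_Im (id 0 b p1 sb m1 s1) (id 0 a p2 sa m2 s2)
  (id c1 a p1 sa m1 s1) (id c1 b p2 sb m2 s2)) _.
congr (_ - _ + (_ + _)); [exact: dE sb m1 s1|exact: dE sa m2 s2|exact: dE sa m1 s1|exact: dE sb m2 s2].
Qed.

End DuhamelIsL2Integral.

(** * Convergence of states *)

Section StateAlgebra.
Variable R : realType.
Local Notation mu := (@lebesgue_measure R).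
Implicit Types (p u v : R -> R -> R) (A B l : R).

Lemma state_eq B l u v : state B l u ->
  measurable_fun setT (fun z : R * R => v z.1 z.2) ->
  (forall t x, 0 <= t -> v t x = u t x) -> state B l v.
Proof.
move=> [_ su] mv uv; split => // t t0; have [h1 h2] := su t t0.
rewrite (_ : v t = u t) //.
by apply/funext => x; exact: uv.
Qed.

Lemma state_le B B' l u : 0 <= B -> B <= B' -> state B l u -> state B' l u.
Proof.
move=> B0 BB' [mu_ su]; split => // t t0; have [h1 h2] := su t t0.
have BBe : B * expR (- (l * t)) <= B' * expR (- (l * t)) by rewrite ler_wpM2r ?expR_ge0.
split; first by move=> x; exact: le_trans (h1 x) BBe.
apply: le_trans h2 _; rewrite lee_fin ler_sqr ?nnegrE//.
  by rewrite mulr_ge0 ?expR_ge0.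
by rewrite mulr_ge0 ?expR_ge0// (le_trans B0).
Qed.

Lemma state_opp B l u : state B l u -> state B l (fun t x => - u t x).
Proof.
move=> [mu_ su]; split=> [|t t0]; first by meas.
have [h1 h2] := su t t0; split; first by move=> x; rewrite normrN.
by under eq_integral do rewrite sqrrN.
Qed.

Let sqr_bound A B e : 0 <= A -> 0 <= B ->
  2 * ((A * e) ^+ 2 + (B * e) ^+ 2) <= (2 * (A + B) * e) ^+ 2.
Proof.
move=> A0 B0; rewrite !exprMn -mulrDl mulrA ler_wpM2r ?sqr_ge0//.
by have := mulr_ge0 A0 B0; have := sqr_ge0 A; have := sqr_ge0 B; nra.
Qed.

Lemma state_add A B l u v : 0 <= A -> 0 <= B -> state A l u -> state B l v ->
  state (2 * (A + B)) l (fun t x => u t x + v t x).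
Proof.
move=> A0 B0 [m_u su] [m_v sv]; split=> [|t t0]; first by meas.
have [h1 h2] := su t t0; have [k1 k2] := sv t t0; split.
  move=> x; rewrite (le_trans (ler_normD _ _))// (le_trans (lerD (h1 x) (k1 x)))//.
  by rewrite -mulrDl ler_wpM2r ?expR_ge0//; lra.
apply: (le_trans (integral_sqr_bound_add _ _ h2 k2)).
- exact: (measurable_slice t m_u).
- exact: (measurable_slice t m_v).
- by rewrite -EFinD -EFinM lee_fin sqr_bound.
Qed.

Lemma source_add A B l u v : 0 <= A -> 0 <= B -> source A l u -> source B l v ->
  source (2 * (A + B)) l (fun t x => u t x + v t x).
Proof.
move=> A0 B0 [m_u su] [m_v sv]; split=> [|t t0]; first by meas.
have [h1 h2] := su t t0; have [k1 k2] := sv t t0.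
have mut : measurable_fun setT (u t) by exact: (measurable_slice t m_u).
have mvt : measurable_fun setT (v t) by exact: (measurable_slice t m_v).
split; last first.
  apply: (le_trans (integral_sqr_bound_add mut mvt h2 k2)).
  by rewrite -EFinD -EFinM lee_fin sqr_bound.
apply: (@le_trans _ _ (\int[mu]_x (`|u t x|%:E + `|v t x|%:E))%E).
  under [leRHS]eq_integral do rewrite -EFinD.
  apply: le_ge0_integral => //; [by meas|by meas|] => x _.
  by rewrite normr_ge0 ler_normD.
rewrite ge0_integralD//; [|by apply/measurable_EFinP; meas|by apply/measurable_EFinP; meas].
apply: (le_trans (leeD h1 k1)); rewrite -EFinD lee_fin -mulrDl ler_wpM2r ?expR_ge0//.
by lra.
Qed.

Lemma le_limn_einf_cst (u : (\bar R)^nat) (B : \bar R) :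
  (forall n, (u n <= B)%E) -> (limn_einf u <= B)%E.
Proof.
move=> uB; rewrite limn_einf_lim; apply: lime_le; first exact: is_cvg_einfs.
apply: nearW => n; apply: (le_trans _ (uB n)).
by apply: ereal_inf_lbound; exists n => /=.
Qed.

(** The balls are closed under pointwise convergence, the [L^2] part being
    Fatou's lemma. *)
Lemma state_lim B l (v_ : nat -> R -> R -> R) v : (forall k, state B l (v_ k)) ->
  (forall t x, v_ k t x @[k --> \oo] --> v t x) -> state B l v.
Proof.
move=> sv cv; split=> [|t t0].
  apply: (measurable_fun_cvg (h := fun k (z : R * R) => v_ k z.1 z.2)).
    by move=> k; have [] := sv k.
  by move=> z _; exact: cv.
split=> [x|].
  have cn : `|v_ k t x| @[k --> \oo] --> `|v t x| by exact: cvg_norm.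
  rewrite -(cvg_lim _ cn)//; apply: limr_le; first exact: cvgP cn.
  by apply: nearW => k; have [_ /(_ t t0) []] := sv k.
have csq x : (v_ k t x ^+ 2)%:E @[k --> \oo] --> (v t x ^+ 2)%:E.
  apply: cvg_EFin; first exact: nearW.
  by apply: (cvg_comp (fun k => v_ k t x) (fun y => y ^+ 2)); [exact: cv|exact: exprn_continuous].
rewrite (_ : (\int[mu]_x _)%E = (\int[mu]_x limn_einf (fun k => (v_ k t x ^+ 2)%:E))%E); last first.
  apply: eq_integral => x _; rewrite is_cvg_limn_einfE; last exact: cvgP (csq x).
  by rewrite (cvg_lim _ (csq x)).
apply: (le_trans (fatou mu measurableT _ _)).
- move=> k; apply/measurable_EFinP; apply: measurable_funX.
  by have [m _] := sv k; exact: (measurable_slice t m).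
- by move=> k x _; rewrite lee_fin sqr_ge0.
by apply: le_limn_einf_cst => k; have [_ /(_ t t0) []] := sv k.
Qed.

(** A sequence with geometrically small tails converges: adding twice the
    tail bound makes it nonincreasing. *)
Lemma geometric_cvgn (a : nat -> R) (B : R) : 0 <= B ->
  (forall n k, `|a (n + k)%N - a n| <= B / 2 ^+ n) -> cvgn a.
Proof.
move=> B0 ha.
pose g n : R := 2 * B / 2 ^+ n.
have cg : g n @[n --> \oo] --> (0 : R).
  rewrite -[X in _ --> X](mulr0 (2 * B)); rewrite /g; apply: cvgMl_tmp.
  under eq_fun do rewrite -exprVn.
  by apply: cvg_expr; rewrite ger0_norm ?invr_ge0// invf_lt1// ltr1n.
have ag : cvgn (fun n => a n + g n).
  apply: nonincreasing_is_cvgn.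
    apply/nonincreasing_seqP => n; rewrite /g exprS.
    have := ha n 1%N; rewrite addn1 ler_norml => /andP[_].
    have e0 : 0 < 2 ^+ n :> R by rewrite exprn_gt0.
    have -> : 2 * B / (2 * 2 ^+ n) = B / 2 ^+ n by field; rewrite gt_eqF.
    by rewrite -[2 * B / _]mulrA; lra.
  exists (a 0%N - B) => _ [n _ <-].
  have := ha 0%N n; rewrite add0n expr0 divr1 ler_norml => /andP[+ _].
  have : 0 <= g n by rewrite /g divr_ge0 ?mulr_ge0.
  by lra.
rewrite (_ : a = fun n => (a n + g n) - g n); last by apply/funext => n; rewrite addrK.
by apply: is_cvgB => //; exact: cvgP cg.
Qed.

End StateAlgebra.

(** * The fixed point *)

Section IntegralBounds.
Variable R : realType.
Local Notation mu := (@lebesgue_measure R).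
Implicit Types (f g : R -> R) (a b r : R).

Definition ibound f a := [/\ measurable_fun setT f, forall x, 0 <= f x &
  (\int[mu]_x (f x)%:E <= a%:E)%E].

Lemma ibound_add f g a b : ibound f a -> ibound g b -> ibound (fun x => f x + g x) (a + b).
Proof.
move=> [mf f0 fa] [mg g0 gb]; split; [by meas|by move=> x; rewrite addr_ge0|].
under eq_integral do rewrite EFinD.
rewrite ge0_integralD//; last 4 first.
- by move=> x _; rewrite lee_fin.
- exact/measurable_EFinP.
- by move=> x _; rewrite lee_fin.
- exact/measurable_EFinP.
by rewrite EFinD leeD.
Qed.

Lemma ibound_scale r f a : 0 <= r -> ibound f a -> ibound (fun x => r * f x) (r * a).
Proof.
move=> r0 [mf f0 fa]; split; [by meas|by move=> x; rewrite mulr_ge0|].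
under eq_integral do rewrite EFinM.
rewrite ge0_integralZl//; last 2 first.
- exact/measurable_EFinP.
- by move=> x _; rewrite lee_fin.
by rewrite EFinM lee_wpmul2l.
Qed.

Lemma ibound_le f g a : measurable_fun setT f -> (forall x, 0 <= f x <= g x) ->
  ibound g a -> (\int[mu]_x (f x)%:E <= a%:E)%E.
Proof. by move=> mf fg [mg g0]; apply: le_trans; apply: le_ge0_integral. Qed.

End IntegralBounds.

Section ComplexModulus.
Variable R : realType.
Implicit Types z w : R[i].

Lemma normr_Re_le z : `|complex.Re z| <= cmod z.
Proof.
rewrite -ler_sqr ?nnegrE ?cmod_ge0// cmod_sqr real_normK ?num_real//.
by rewrite lerDl sqr_ge0.
Qed.

Lemma normr_Im_le z : `|complex.Im z| <= cmod z.
Proof.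
rewrite -ler_sqr ?nnegrE ?cmod_ge0// cmod_sqr real_normK ?num_real//.
by rewrite lerDr sqr_ge0.
Qed.

Lemma cmod_le z : cmod z <= `|complex.Re z| + `|complex.Im z|.
Proof.
rewrite -ler_sqr ?nnegrE ?cmod_ge0 ?addr_ge0// cmod_sqr sqrrD !real_normK ?num_real//.
by rewrite addrAC lerDl mulrn_wge0// mulr_ge0.
Qed.

Lemma Re_mulNi z : complex.Re (- 'i * z) = complex.Im z.
Proof. by case: z => a b /=; ring. Qed.

Lemma Im_mulNi z : complex.Im (- 'i * z) = - complex.Re z.
Proof. by case: z => a b /=; ring. Qed.

End ComplexModulus.

Section FixedPoint.
Variable R : realType.
Local Notation mu := (@lebesgue_measure R).
Variables (C K rho l : R) (W : R -> R -> R) (H : R -> R -> R[i] -> R[i]).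
Let B := rho / 2.
Let A1 := C * (2 * (K + 2 * rho) + (3 * K ^+ 2 + 3 * rho ^+ 2 + 2)).
Hypotheses (C0 : 0 <= C) (K0 : 0 <= K) (rho0 : 0 < rho) (l1 : 1 <= l).

Definition cmeasurable (eta : R -> R -> R[i]) :=
  measurable_fun setT (fun z : R * R => complex.Re (eta z.1 z.2)) /\
  measurable_fun setT (fun z : R * R => complex.Im (eta z.1 z.2)).

Definition cstate b (eta : R -> R -> R[i]) :=
  state b l (fun t x => complex.Re (eta t x)) /\
  state b l (fun t x => complex.Im (eta t x)).

Definition csource A (h : R -> R -> R[i]) :=
  source A l (fun t x => complex.Re (h t x)) /\
  source A l (fun t x => complex.Im (h t x)).

Hypotheses (mW : measurable_fun setT (fun z : R * R => W z.1 z.2))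
  (W0 : forall t x, 0 <= W t x)
  (WK : forall t x : R, 0 <= t -> W t x <= K)
  (WI : forall t : R, 0 <= t -> (\int[mu]_x (W t x)%:E <= K%:E)%E).
Hypothesis mH : forall eta, cmeasurable eta -> cmeasurable (fun t x => H t x (eta t x)).
Hypothesis Hlip : forall (t x : R) z w, 0 <= t -> cmod z <= rho -> cmod w <= rho ->
  cmod (H t x z - H t x w) <= C * (W t x + cmod z + cmod w) * cmod (z - w).
Hypothesis H0 : forall t x : R, 0 <= t -> cmod (H t x 0) <= C * expR (- (l * t)) * W t x.
(* By the first condition the Duhamel map preserves the ball of radius [B], by
   the second it halves distances. The radius is half of [rho] because it
   bounds the real and imaginary parts separately. *)
Hypothesis small_ball : 32 * (C * K + A1 * B) / Num.sqrt l <= B.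
Hypothesis small_lip : 16 * A1 / Num.sqrt l <= 2^-1.

Let l0 : 0 < l. Proof. exact: lt_le_trans l1. Qed.
Let B0 : 0 < B. Proof. by rewrite divr_gt0. Qed.
Let A10 : 0 <= A1.
Proof. by rewrite mulr_ge0// !addr_ge0 ?mulr_ge0 ?sqr_ge0 ?addr_ge0 ?(ltW rho0)// mulr_ge0// ltW. Qed.

Let exp_le1 (t : R) : 0 <= t -> expR (- (l * t)) <= 1.
Proof. by move=> t0; rewrite -expR0 ler_expR oppr_le0 mulr_ge0// ltW. Qed.

Let ibW (t : R) : 0 <= t -> ibound (W t) K.
Proof. by move=> t0; split => //; [exact: (measurable_slice t mW)|exact: WI]. Qed.

Lemma state_ibound (b : R) (u : R -> R -> R) (t : R) : 0 <= t -> state b l u ->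
  ibound (fun x => u t x ^+ 2) ((b * expR (- (l * t))) ^+ 2).
Proof.
move=> t0 [m_u su]; have [_ h] := su t t0; split => //.
  by apply: measurable_funX; exact: (measurable_slice t m_u).
by move=> x; exact: sqr_ge0.
Qed.

Lemma cstate_cmod (eta : R -> R -> R[i]) (t x : R) : 0 <= t -> cstate B eta -> cmod (eta t x) <= rho.
Proof.
move=> t0 [[_ s1] [_ s2]]; have [h1 _] := s1 t t0; have [h2 _] := s2 t t0.
apply: (le_trans (cmod_le _)); apply: (le_trans (lerD (h1 x) (h2 x))).
rewrite -mulrDl (_ : B + B = rho); last by rewrite /B; field.
by rewrite ler_piMr ?exp_le1 ?(ltW rho0).
Qed.

(** The source of the zero state: the potential carries the integrability, the
    exponential the decay. *)
Lemma base_source (q : R -> R -> R) : measurable_fun setT (fun z : R * R => q z.1 z.2) ->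
  (forall t x : R, 0 <= t -> `|q t x| <= C * expR (- (l * t)) * W t x) ->
  source (C * K) l q.
Proof.
move=> mq hq; split=> // t t0; set e := expR _.
have e0 : 0 <= e by exact: expR_ge0.
have mqt : measurable_fun setT (q t) by exact: (measurable_slice t mq).
split.
  rewrite (_ : C * K * e = C * e * K); last by ring.
  apply: (ibound_le _ _ (ibound_scale (mulr_ge0 C0 e0) (ibW t0))); first by meas.
  by move=> x; rewrite normr_ge0 hq.
rewrite (_ : (C * K * e) ^+ 2 = (C * e) ^+ 2 * K * K); last by ring.
have k0 : 0 <= (C * e) ^+ 2 * K by rewrite mulr_ge0 ?sqr_ge0.
apply: (ibound_le _ _ (ibound_scale k0 (ibW t0))); first by meas.
move=> x; rewrite sqr_ge0/= -(real_normK (num_real (q t x))).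
have h := hq t x t0; apply: (@le_trans _ _ ((C * e * W t x) ^+ 2)).
  by rewrite ler_sqr ?nnegrE// !mulr_ge0.
rewrite exprMn -mulrA ler_wpM2l ?sqr_ge0// expr2.
by rewrite ler_wpM2r ?WK.
Qed.

(** The source of a difference. Besides the bounded factor [K + 2 rho] for the
    [L^2] norm, the [L^1] norm needs the product of two square-integrable
    factors: it is split by the inequality between the arithmetic and geometric
    means, weighted by the size [be] of the difference so that the outcome is
    linear in [be]. *)
Lemma diff_source (b : R) (eta zeta : R -> R -> R[i]) (q : R -> R -> R) : measurable_fun setT (fun z : R * R => q z.1 z.2) ->
  (forall t x : R, 0 <= t -> `|q t x| <=
     C * (W t x + cmod (eta t x) + cmod (zeta t x)) * cmod (eta t x - zeta t x)) ->
  cstate B eta -> cstate B zeta -> 0 < b ->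
  cstate b (fun t x => eta t x - zeta t x) -> source (A1 * b) l q.
Proof.
move=> mq hq se sz b0 sd; split=> // t t0; set e := expR _.
have e0 : 0 < e by exact: expR_gt0.
have e1 : e <= 1 by exact: exp_le1.
have mqt : measurable_fun setT (q t) by exact: (measurable_slice t mq).
pose M x := W t x + cmod (eta t x) + cmod (zeta t x).
pose D x := complex.Re (eta t x - zeta t x) ^+ 2 + complex.Im (eta t x - zeta t x) ^+ 2.
have DE x : cmod (eta t x - zeta t x) ^+ 2 = D x by rewrite cmod_sqr.
have D0 x : 0 <= D x by rewrite addr_ge0 ?sqr_ge0.
have iD : ibound D (2 * (b * e) ^+ 2).
  by rewrite mulr_natl mulr2n; apply: ibound_add; [exact: (state_ibound t0 sd.1)|exact: (state_ibound t0 sd.2)].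
have hqt x : `|q t x| <= C * M x * cmod (eta t x - zeta t x) by exact: hq.
have M0 x : 0 <= M x by rewrite !addr_ge0 ?cmod_ge0.
have MK x : M x <= K + 2 * rho.
  rewrite mulr_natl mulr2n addrA; apply: lerD; last exact: cstate_cmod.
  by apply: lerD; [exact: WK|exact: cstate_cmod].
have KB : 0 <= K + 2 * rho by rewrite addr_ge0// mulr_ge0// ltW.
split; last first.
  have h1 : C * (2 * (K + 2 * rho)) <= A1.
    by rewrite /A1 ler_wpM2l// lerDl !addr_ge0// mulr_ge0 ?sqr_ge0.
  apply: (@le_trans _ _ ((C * (K + 2 * rho)) ^+ 2 * (2 * (b * e) ^+ 2))%:E); last first.
    rewrite lee_fin -mulrA [leRHS]exprMn mulrA ler_wpM2r ?sqr_ge0//.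
    apply: (@le_trans _ _ ((C * (2 * (K + 2 * rho))) ^+ 2)).
      rewrite [leRHS](_ : _ = 4 * (C * (K + 2 * rho)) ^+ 2); last by ring.
      by have := sqr_ge0 (C * (K + 2 * rho)); lra.
    by rewrite ler_sqr ?nnegrE// mulr_ge0// mulr_ge0.
  apply: (ibound_le _ _ (ibound_scale (sqr_ge0 _) iD)); first by meas.
  move=> x; rewrite sqr_ge0/= -(real_normK (num_real (q t x))) -DE -exprMn.
  rewrite ler_sqr ?nnegrE// ?mulr_ge0 ?cmod_ge0//.
  by apply: (le_trans (hqt x)); rewrite ler_wpM2r ?cmod_ge0// ler_wpM2l.
pose be := b * e; have be0 : 0 < be by exact: mulr_gt0.
pose S x := K * W t x + (complex.Re (eta t x) ^+ 2 + complex.Im (eta t x) ^+ 2)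
                      + (complex.Re (zeta t x) ^+ 2 + complex.Im (zeta t x) ^+ 2).
have iS : ibound S (K * K + (B ^+ 2 + B ^+ 2) + (B ^+ 2 + B ^+ 2)).
  have st (u : R -> R -> R) : state B l u -> ibound (fun x => u t x ^+ 2) (B ^+ 2).
    move=> su; have [m u0 hu] := state_ibound t0 su; split => //.
    have Be0 : 0 <= B * e by rewrite mulr_ge0 ?ltW.
    have BeB : B * e <= B by rewrite ler_piMr ?(ltW B0).
    apply: (le_trans hu); rewrite lee_fin -/e ler_sqr ?nnegrE ?(ltW B0)//.
  have i1 := ibound_scale K0 (ibW t0).
  have i2 := ibound_add (st _ se.1) (st _ se.2).
  have i3 := ibound_add (st _ sz.1) (st _ sz.2).
  exact: (ibound_add (ibound_add i1 i2) i3).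
have c1 : 0 <= C * be * 3 / 2 by rewrite divr_ge0// !mulr_ge0// ltW.
have c2 : 0 <= C / be / 2 by rewrite !divr_ge0// ltW.
apply: (@le_trans _ _ (C * be * 3 / 2 * (K * K + (B ^+ 2 + B ^+ 2) + (B ^+ 2 + B ^+ 2)) +
                       C / be / 2 * (2 * be ^+ 2))%:E).
  apply: (ibound_le _ _ (ibound_add (ibound_scale c1 iS) (ibound_scale c2 iD))); first by meas.
  move=> x; rewrite normr_ge0/=; apply: (le_trans (hqt x)).
  have M2 : M x ^+ 2 <= 3 * S x.
    rewrite /M /S -!cmod_sqr.
    have : W t x ^+ 2 <= K * W t x by rewrite expr2 ler_wpM2r ?WK.
    move: (W t x) (cmod (eta t x)) (cmod (zeta t x)) => w u v h.
    have := sqr_ge0 (w - u); have := sqr_ge0 (w - v); have := sqr_ge0 (u - v).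
    by nra.
  rewrite -DE; move: (cmod (eta t x - zeta t x)) => d.
  have h : M x * d <= be / 2 * M x ^+ 2 + d ^+ 2 / be / 2.
    rewrite -subr_ge0 (_ : _ - _ = (be * M x - d) ^+ 2 / (2 * be)).
      by rewrite divr_ge0 ?sqr_ge0// mulr_ge0// ltW.
    by field; rewrite gt_eqF.
  rewrite -mulrA; apply: (le_trans (ler_wpM2l C0 h)).
  rewrite mulrDr; apply: lerD.
    rewrite (_ : C * be * 3 / 2 * S x = C * (be / 2 * (3 * S x))); last by field.
    by rewrite !ler_wpM2l// divr_ge0// ltW.
  by rewrite le_eqVlt; apply/orP; left; apply/eqP; field; rewrite gt_eqF.
rewrite lee_fin -[leRHS]mulrA -/be.
rewrite [leLHS](_ : _ = C * ((3 * K ^+ 2 + 3 * rho ^+ 2 + 2) / 2) * be); last first.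
  by rewrite /B; field; rewrite gt_eqF.
rewrite ler_wpM2r ?(ltW be0)// /A1 ler_wpM2l//.
have : 0 <= 3 * K ^+ 2 + 3 * rho ^+ 2 + 2 by rewrite !addr_ge0// mulr_ge0 ?sqr_ge0.
by lra.
Qed.

Lemma cstate_measurable b eta : cstate b eta -> cmeasurable eta.
Proof. by move=> [[? _] [? _]]. Qed.

Lemma state0 b : 0 <= b -> state b l (fun _ _ => 0).
Proof.
move=> b0; split=> // t t0; split.
  by move=> x; rewrite normr0 mulr_ge0 ?expR_ge0.
under eq_integral do rewrite expr0n/=.
by rewrite integral0 lee_fin sqr_ge0.
Qed.

Lemma cduh_cstate A h : 0 <= A -> csource A h ->
  cstate (16 * A / Num.sqrt l) (fun t x => - 'i * cduh h t x).
Proof.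
move=> A0 [sa sb].
have AE : 16 * A / Num.sqrt l = 2 * (4 * A / Num.sqrt l + 4 * A / Num.sqrt l) by field; rewrite gt_eqF ?sqrtr_gt0.
have q0 : 0 <= 4 * A / Num.sqrt l by rewrite divr_ge0 ?sqrtr_ge0// mulr_ge0.
have d c p : source A l p -> state (4 * A / Num.sqrt l) l (duh c p).
  by move=> sp; exact: duh_state.
rewrite AE; split.
  rewrite (_ : (fun t x => _) = fun t x => complex.Im (cduh h t x)); last first.
    by apply/funext => t; apply/funext => x; rewrite Re_mulNi.
  exact: (state_add q0 q0 (d 0 _ sb) (d (- (pi / 2)) _ sa)).
rewrite (_ : (fun t x => _) = fun t x => - complex.Re (cduh h t x)); last first.
  by apply/funext => t; apply/funext => x; rewrite Im_mulNi.
apply: state_opp.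
exact: (state_add q0 q0 (d 0 _ sa) (state_opp (d (- (pi / 2)) _ sb))).
Qed.

Lemma cduhB A A' h h' t x : 0 <= A -> 0 <= A' -> csource A h -> csource A' h' -> 0 <= t ->
  cduh (fun t x => h t x - h' t x) t x = cduh h t x - cduh h' t x.
Proof.
move=> A0 A0' [sa sb] [sa' sb'] t0.
have Ea : (fun t x => complex.Re (h t x - h' t x)) =
    (fun t x => complex.Re (h t x) - complex.Re (h' t x)).
  by apply/funext => t'; apply/funext => x'; rewrite Re_sub.
have Eb : (fun t x => complex.Im (h t x - h' t x)) =
    (fun t x => complex.Im (h t x) - complex.Im (h' t x)).
  by apply/funext => t'; apply/funext => x'; rewrite Im_sub.
apply/eqP; rewrite eq_complex Re_sub Im_sub /cduh Ea Eb /=.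
rewrite !(duhB _ _ A0 A0' l1 sa sa' t0) !(duhB _ _ A0 A0' l1 sb sb' t0).
have sub4 (a b c d : R) : a - b - (c - d) = a - c - (b - d) by ring.
have add4 (a b c d : R) : a - b + (c - d) = a + c - (b + d) by ring.
by apply/andP; split; apply/eqP; [exact: sub4|exact: add4].
Qed.

Let Heta (eta : R -> R -> R[i]) t x := H t x (eta t x).

Lemma Heta_diff_source b eta zeta : cstate B eta -> cstate B zeta -> 0 < b ->
  cstate b (fun t x => eta t x - zeta t x) ->
  csource (A1 * b) (fun t x => Heta eta t x - Heta zeta t x).
Proof.
move=> se sz b0 sd.
have [m1 m2] := mH (cstate_measurable se); have [m1' m2'] := mH (cstate_measurable sz).
have hq t x : 0 <= t -> cmod (Heta eta t x - Heta zeta t x) <=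
    C * (W t x + cmod (eta t x) + cmod (zeta t x)) * cmod (eta t x - zeta t x).
  by move=> t0; apply: Hlip => //; exact: cstate_cmod.
split; apply: (diff_source _ _ se sz b0 sd).
- rewrite (_ : (fun z => _) = fun z : R * R =>
    complex.Re (Heta eta z.1 z.2) - complex.Re (Heta zeta z.1 z.2)); last first.
    by apply/funext => z; rewrite Re_sub.
  exact: measurable_funB.
- by move=> t x t0; apply: le_trans (normr_Re_le _) (hq t x t0).
- rewrite (_ : (fun z => _) = fun z : R * R =>
    complex.Im (Heta eta z.1 z.2) - complex.Im (Heta zeta z.1 z.2)); last first.
    by apply/funext => z; rewrite Im_sub.
  exact: measurable_funB.
- by move=> t x t0; apply: le_trans (normr_Im_le _) (hq t x t0).
Qed.

Let zero : R -> R -> R[i] := fun _ _ => 0.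

Let zero_state : cstate B zero.
Proof. by split; apply: state0; exact: ltW. Qed.

Let S0 := 2 * (C * K + A1 * B).
Let S00 : 0 <= S0.
Proof. by rewrite /S0 mulr_ge0// addr_ge0// mulr_ge0// ltW. Qed.

Lemma Heta_source eta : cstate B eta -> csource S0 (Heta eta).
Proof.
move=> se.
have sd : cstate B (fun t x => eta t x - zero t x).
  rewrite (_ : (fun t x => _) = eta)//.
  by apply/funext => t; apply/funext => x; rewrite subr0.
have [da db] := Heta_diff_source se zero_state B0 sd.
have [m1 m2] := mH (cstate_measurable zero_state).
have hz t x : 0 <= t -> cmod (Heta zero t x) <= C * expR (- (l * t)) * W t x by exact: H0.
have CK0 : 0 <= C * K by exact: mulr_ge0.
have AB0 : 0 <= A1 * B by rewrite mulr_ge0// ltW.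
split.
  rewrite (_ : (fun t x => _) = fun t x => complex.Re (Heta zero t x) +
      complex.Re (Heta eta t x - Heta zero t x)); last first.
    by apply/funext => t; apply/funext => x; rewrite Re_sub addrC subrK.
  apply: source_add => //; apply: base_source => // t x t0.
  exact: le_trans (normr_Re_le _) (hz t x t0).
rewrite (_ : (fun t x => _) = fun t x => complex.Im (Heta zero t x) +
    complex.Im (Heta eta t x - Heta zero t x)); last first.
  by apply/funext => t; apply/funext => x; rewrite Im_sub addrC subrK.
apply: source_add => //; apply: base_source => // t x t0.
exact: le_trans (normr_Im_le _) (hz t x t0).
Qed.

(** The Duhamel map. At negative times, where there is no estimate, it is cut
    off, so that its iterates converge everywhere. *)
Definition Phi (eta : R -> R -> R[i]) (t x : R) : R[i] :=
  if t < 0 then 0 else - 'i * cduh (Heta eta) t x.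

Lemma PhiE eta t x : 0 <= t -> Phi eta t x = - 'i * cduh (Heta eta) t x.
Proof. by move=> t0; rewrite /Phi ltNge t0. Qed.

Lemma cstate_eq b eta zeta : cstate b eta -> cmeasurable zeta ->
  (forall t x, 0 <= t -> zeta t x = eta t x) -> cstate b zeta.
Proof.
move=> [s1 s2] [m1 m2] ez; split.
  by apply: (state_eq s1) => // t x t0; rewrite ez.
by apply: (state_eq s2) => // t x t0; rewrite ez.
Qed.

Lemma Phi_measurable eta : cstate B eta -> cmeasurable (Phi eta).
Proof.
move=> se; have [m1 m2] := cstate_measurable (cduh_cstate S00 (Heta_source se)).
split.
  rewrite (_ : (fun z => _) = fun z : R * R => if z.1 < 0 then 0 else
      complex.Re (- 'i * cduh (Heta eta) z.1 z.2)); last first.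
    by apply/funext => z; rewrite /Phi; case: ifP.
  by apply: measurable_fun_ltr_if => //; meas.
rewrite (_ : (fun z => _) = fun z : R * R => if z.1 < 0 then 0 else
    complex.Im (- 'i * cduh (Heta eta) z.1 z.2)); last first.
  by apply/funext => z; rewrite /Phi; case: ifP.
by apply: measurable_fun_ltr_if => //; meas.
Qed.

Lemma Phi_ball eta : cstate B eta -> cstate B (Phi eta).
Proof.
move=> se; have [s1 s2] := cduh_cstate S00 (Heta_source se).
apply: (cstate_eq (eta := fun t x => - 'i * cduh (Heta eta) t x)).
- have h0 : 0 <= 16 * S0 / Num.sqrt l by rewrite divr_ge0 ?sqrtr_ge0// mulr_ge0.
  have hB : 16 * S0 / Num.sqrt l <= B.
    by apply: le_trans small_ball; rewrite /S0 mulrA -natrM.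
  by split; [exact: state_le h0 hB s1|exact: state_le h0 hB s2].
- exact: Phi_measurable.
- by move=> t x t0; rewrite PhiE.
Qed.

Lemma cmeasurableB eta zeta : cmeasurable eta -> cmeasurable zeta ->
  cmeasurable (fun t x => eta t x - zeta t x).
Proof.
move=> [m1 m2] [m1' m2']; split.
  rewrite (_ : (fun z => _) = fun z : R * R =>
    complex.Re (eta z.1 z.2) - complex.Re (zeta z.1 z.2)); last first.
    by apply/funext => z; rewrite Re_sub.
  exact: measurable_funB.
rewrite (_ : (fun z => _) = fun z : R * R =>
  complex.Im (eta z.1 z.2) - complex.Im (zeta z.1 z.2)); last first.
  by apply/funext => z; rewrite Im_sub.
exact: measurable_funB.
Qed.

Lemma Phi_contraction b eta zeta : cstate B eta -> cstate B zeta -> 0 < b ->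
  cstate b (fun t x => eta t x - zeta t x) ->
  cstate (b / 2) (fun t x => Phi eta t x - Phi zeta t x).
Proof.
move=> se sz b0 sd.
have sh := Heta_diff_source se sz b0 sd.
have Ab0 : 0 <= A1 * b by rewrite mulr_ge0// ltW.
have [s1 s2] := cduh_cstate Ab0 sh.
apply: (cstate_eq (eta := fun t x =>
   - 'i * cduh (fun t x => Heta eta t x - Heta zeta t x) t x)).
- have h0 : 0 <= 16 * (A1 * b) / Num.sqrt l by rewrite divr_ge0 ?sqrtr_ge0// mulr_ge0.
  have hB : 16 * (A1 * b) / Num.sqrt l <= b / 2.
    rewrite (_ : 16 * (A1 * b) / Num.sqrt l = b * (16 * A1 / Num.sqrt l)).
      by rewrite ler_wpM2l// ltW.
    by field; rewrite gt_eqF ?sqrtr_gt0.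
  by split; [exact: state_le h0 hB s1|exact: state_le h0 hB s2].
- by apply: cmeasurableB; exact: Phi_measurable.
- move=> t x t0; rewrite !PhiE//.
  by rewrite (cduhB x S00 S00 (Heta_source se) (Heta_source sz) t0) mulrBr.
Qed.

Let eta_ n := iter n Phi zero.

Let eta_ball n : cstate B (eta_ n).
Proof. by elim: n => //= n; exact: Phi_ball. Qed.

Let eta_diff n k : cstate (B / 2 ^+ n) (fun t x => eta_ (n + k)%N t x - eta_ n t x).
Proof.
elim: n => [|n IHn].
  rewrite expr0 divr1 add0n (_ : (fun t x => _) = eta_ k)//.
  by apply/funext => t; apply/funext => x; rewrite subr0.
have e0 : 0 < 2 ^+ n :> R by rewrite exprn_gt0.
have -> : B / 2 ^+ n.+1 = B / 2 ^+ n / 2 by rewrite exprS; field; rewrite gt_eqF.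
by apply: Phi_contraction => //; exact: divr_gt0.
Qed.

Let eta_neg n t x : t < 0 -> eta_ n t x = 0.
Proof. by case: n => //= n t0; rewrite /Phi t0. Qed.

Let eta_cauchy n k t x :
  `|complex.Re (eta_ (n + k)%N t x) - complex.Re (eta_ n t x)| <= B / 2 ^+ n /\
  `|complex.Im (eta_ (n + k)%N t x) - complex.Im (eta_ n t x)| <= B / 2 ^+ n.
Proof.
have B2 : 0 <= B / 2 ^+ n by rewrite divr_ge0 ?(ltW B0)// exprn_ge0.
have [t0|t0] := ltP t 0; first by rewrite !eta_neg// subrr normr0.
have [[_ s1] [_ s2]] := eta_diff n k.
have [h1 _] := s1 t t0; have [h2 _] := s2 t t0.
rewrite -Re_sub -Im_sub; split; [apply: (le_trans (h1 x))|apply: (le_trans (h2 x))].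
  by rewrite ler_piMr ?exp_le1.
by rewrite ler_piMr ?exp_le1.
Qed.

Let etaoo t x : R[i] := limn (fun n => complex.Re (eta_ n t x)) +i*
                        limn (fun n => complex.Im (eta_ n t x)).

Let etaoo_Re t x : complex.Re (eta_ n t x) @[n --> \oo] --> complex.Re (etaoo t x).
Proof.
by apply: (geometric_cvgn (ltW B0)) => n k; have [] := eta_cauchy n k t x.
Qed.

Let etaoo_Im t x : complex.Im (eta_ n t x) @[n --> \oo] --> complex.Im (etaoo t x).
Proof.
by apply: (geometric_cvgn (ltW B0)) => n k; have [] := eta_cauchy n k t x.
Qed.

Let etaoo_ball : cstate B etaoo.
Proof.
split.
  by apply: (state_lim (v_ := fun n t x => complex.Re (eta_ n t x))) => // n; case: (eta_ball n).
by apply: (state_lim (v_ := fun n t x => complex.Im (eta_ n t x))) => // n; case: (eta_ball n).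
Qed.

Let etaoo_diff n : cstate (B / 2 ^+ n) (fun t x => etaoo t x - eta_ n t x).
Proof.
have sh (u : nat -> R) (v : R) : u k @[k --> \oo] --> v -> u (n + k)%N - u n @[k --> \oo] --> v - u n.
  move=> uv; apply: cvgB; last exact: cvg_cst.
  rewrite (_ : (fun k => _) = fun k => u (k + n)%N); last by apply/funext => k; rewrite addnC.
  by rewrite -(cvg_shiftn n u) in uv.
split.
  apply: (state_lim (v_ := fun k t x => complex.Re (eta_ (n + k)%N t x - eta_ n t x))).
    by move=> k; case: (eta_diff n k).
  move=> t x; rewrite Re_sub; under eq_fun do rewrite Re_sub.
  exact: (sh (fun k => complex.Re (eta_ k t x))).
apply: (state_lim (v_ := fun k t x => complex.Im (eta_ (n + k)%N t x - eta_ n t x))).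
  by move=> k; case: (eta_diff n k).
move=> t x; rewrite Im_sub; under eq_fun do rewrite Im_sub.
exact: (sh (fun k => complex.Im (eta_ k t x))).
Qed.

(** Picard iteration from 0. The nonlinear term [H] is abstract: a Lipschitz
    constant [W + |z| + |w|], with a potential [W] bounded in [L^1] and [Loo], and
    an exponentially small value at 0. The limit is taken pointwise; it is a
    fixed point because its image and the next iterate are both within a
    geometrically small state of it. *)
Theorem duhamel_fixed_point : exists eta, [/\ cstate B eta,
  csource S0 (fun t x => H t x (eta t x)) &
  forall t x, 0 <= t ->
    eta t x = - 'i * cduh (fun t x => H t x (eta t x)) t x].
Proof.
exists etaoo; split; [exact: etaoo_ball|exact: (Heta_source etaoo_ball)|].
move=> t x t0; rewrite -PhiE//.
have cB : (fun n => 2 * B / 2 ^+ n) @ \oo --> (0 : R).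
  rewrite -[X in _ --> X](mulr0 (2 * B)); apply: cvgMl_tmp.
  under eq_fun do rewrite -exprVn.
  by apply: cvg_expr; rewrite ger0_norm ?invr_ge0// invf_lt1// ltr1n.
have small (y : R) : (forall n, `|y| <= 2 * B / 2 ^+ n) -> y = 0.
  move=> hy; apply/eqP; rewrite -normr_le0 -(cvg_lim _ cB)//.
  by apply: limr_ge; [exact: cvgP cB|exact: nearW].
have bnd n : let b := 2 * B / 2 ^+ n in
    `|complex.Re (etaoo t x) - complex.Re (Phi etaoo t x)| <= b /\
    `|complex.Im (etaoo t x) - complex.Im (Phi etaoo t x)| <= b.
  have e0 : 0 < 2 ^+ n :> R by rewrite exprn_gt0.
  have Bn0 : 0 < B / 2 ^+ n by exact: divr_gt0.
  have [[_ p1] [_ p2]] := Phi_contraction etaoo_ball (eta_ball n) Bn0 (etaoo_diff n).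
  have [[_ q1] [_ q2]] := etaoo_diff n.+1.
  have bE : B / 2 ^+ n.+1 = B / 2 ^+ n / 2 by rewrite exprS; field; rewrite gt_eqF.
  have le1 (y : R) : y <= B / 2 ^+ n / 2 * expR (- (l * t)) -> y <= B / 2 ^+ n.
    move=> /le_trans; apply; rewrite -mulrA ler_piMr ?(ltW Bn0)//.
    by have := exp_le1 t0; have := expR_ge0 (- (l * t)); lra.
  have [/(_ x) P1 _] := p1 t t0; have [/(_ x) P2 _] := p2 t t0.
  have [/(_ x) Q1 _] := q1 t t0; have [/(_ x) Q2 _] := q2 t t0.
  rewrite Re_sub in P1; rewrite Im_sub in P2; rewrite Re_sub in Q1; rewrite Im_sub in Q2.
  rewrite bE in Q1 Q2; move: P1 P2 Q1 Q2 => /le1 P1 /le1 P2 /le1 Q1 /le1 Q2.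
  have tri (a b c d : R) : `|a - b| <= d -> `|c - b| <= d -> `|a - c| <= 2 * d.
    move=> h1 h2; rewrite (_ : a - c = (a - b) - (c - b)); last by ring.
    by rewrite (le_trans (ler_normB _ _))// mulr_natl mulr2n lerD.
  by rewrite /= -mulrA; split; [exact: tri Q1 P1|exact: tri Q2 P2].
apply/eqP; rewrite eq_complex -subr_eq0 -[X in _ && X]subr_eq0.
by apply/andP; split; apply/eqP; apply: small => n; have [] := bnd n.
Qed.

End FixedPoint.

(** * The nonlinearity *)

Section Nonlinearity.
Variable R : realType.
Variables (f : R[i] -> R[i]) (alpha1 alpha2 : R).
Hypotheses (a1 : 1 <= alpha1) (a12 : alpha1 <= alpha2).

(** Up to a constant, [growth s] is the Lipschitz constant of the nonlinearity
    on the disc of radius [s], and [growth' s = growth s / s] the slope of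
    [r |-> g (r^2)] at [s]. *)
Definition growth (s : R) : R := s `^ alpha1 + s `^ alpha2.
Definition growth' (s : R) : R := s `^ (alpha1 - 1) + s `^ (alpha2 - 1).

Let a20 : 0 < alpha2. Proof. by apply: lt_le_trans a12; exact: lt_le_trans a1. Qed.
Let a10 : 0 < alpha1. Proof. exact: lt_le_trans a1. Qed.

Lemma growthE s : 0 <= s -> growth s = s * growth' s.
Proof. by move=> s0; rewrite /growth /growth' mulrDr !mulr_powRB1. Qed.

Lemma growth'_ge0 s : 0 <= growth' s.
Proof. by rewrite addr_ge0 ?powR_ge0. Qed.

Lemma growth_ge0 s : 0 <= growth s.
Proof. by rewrite addr_ge0 ?powR_ge0. Qed.

(** This is where [1 <= alpha1] enters: below 1 the slope would blow up at 0. *)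
Lemma growth'_le r s : 0 <= r -> r <= s -> growth' r <= growth' s.
Proof.
move=> r0 rs; have s0 := le_trans r0 rs.
by apply: lerD; apply: ge0_ler_powR; rewrite ?nnegrE// subr_ge0// (le_trans a1).
Qed.

Lemma growth_le r s : 0 <= r -> r <= s -> growth r <= growth s.
Proof.
move=> r0 rs; have s0 := le_trans r0 rs.
by apply: lerD; apply: ge0_ler_powR; rewrite ?nnegrE// ltW.
Qed.

(** At least linear decay under scaling: the growth at a soliton inherits its
    whole exponential profile. *)
Lemma growth_scale e s : 0 <= e <= 1 -> 0 <= s -> growth (s * e) <= e * growth s.
Proof.
move=> /andP[e0 e1] s0; rewrite !growthE ?mulr_ge0// mulrCA mulrA.
by rewrite ler_wpM2l ?mulr_ge0// growth'_le ?mulr_ge0// ler_piMr.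
Qed.

(** A sum is at most twice the larger term. *)
Lemma growth_add r s : 0 <= r -> 0 <= s ->
  growth (r + s) <= growth (2 * r) + growth (2 * s).
Proof.
move=> r0 s0; have [rs|sr] := leP r s.
  apply: (@le_trans _ _ (growth (2 * s))); last by rewrite lerDr growth_ge0.
  by apply: growth_le; [rewrite addr_ge0|lra].
apply: (@le_trans _ _ (growth (2 * r))); last by rewrite lerDl growth_ge0.
by apply: growth_le; [rewrite addr_ge0|lra].
Qed.

Lemma growth_small s : 0 < s <= 1 -> growth s <= 2 * s `^ alpha1.
Proof.
move=> s01; rewrite mulr_natl mulr2n lerD2l.
exact: (ger_powR s01).
Qed.

Variables (g : R -> R) (C0 : R).
Hypotheses (C00 : 0 < C0) (fE : forall z, f z = (g (cmod z ^+ 2))%:C * z)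
  (g_cont : {within `[0, +oo[, continuous g})
  (g_der : forall s : R, 0 < s -> derivable g s 1) (g00 : g 0 = 0)
  (C0P : forall s : R, 0 < s ->
    `|s * derive1 g s| <= C0 * (s `^ (alpha1 / 2) + s `^ (alpha2 / 2))).

(* [g] extended by its value at [0], so as to be continuous on the line. *)
Let gext (y : R) := g (Num.max 0 y).

Let gext_cont : continuous gext.
Proof.
have [gpos g0] := (continuous_within_itvcyP 0 g).1 g_cont.
have neg (y x : R) : x <= 0 -> y <= 0 -> gext x = gext y.
  by move=> x0 y0; rewrite /gext (max_idPl x0) (max_idPl y0).
have pos (x : R) : 0 <= x -> g x = gext x by move=> x0; rewrite /gext (max_idPr x0).
move=> y; have [y0|y0|->] := ltgtP y 0.
- apply: cvg_near_cst; near=> x; apply: neg; last exact: ltW.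
  by apply: ltW; near: x; exact: lt_nbhsl.
- apply: (@cvg_trans _ (g @ y)).
    apply: near_eq_cvg; near=> x; apply: pos; apply: ltW.
    by near: x; exact: lt_nbhsr.
  by rewrite -pos ?(ltW y0)//; apply: gpos; rewrite in_itv/= y0.
- apply/left_right_continuousP; split.
    by apply: cvg_near_cst; apply: filterS (nbhs_left_le 0) => x x0; exact: neg.
  apply: (@cvg_trans _ (g @ 0^'+)).
    by apply: near_eq_cvg; apply: filterS (nbhs_right_ge 0) => x x0; exact: pos.
  by rewrite -pos.
Unshelve. all: end_near. Qed.

Let gextE (s : R) : 0 <= s -> gext s = g s.
Proof. by move=> s0; rewrite /gext (max_idPr s0). Qed.

Let k (r : R) := gext (r ^+ 2).

Let k_cont : continuous k.
Proof.
move=> x; apply: (cvg_comp (fun r => r ^+ 2) gext); last exact: gext_cont.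
exact: exprn_continuous.
Qed.

Let k_der (r : R) : 0 < r -> is_derive r (1 : R) k (derive1 g (r ^+ 2) * (2 * r)).
Proof.
move=> r0; have r20 : 0 < r ^+ 2 by exact: exprn_gt0.
have dg : is_derive (r ^+ 2) (1 : R) g (derive1 g (r ^+ 2)).
  by rewrite derive1E; apply: DeriveDef => //; exact: g_der.
have dge : is_derive (r ^+ 2) (1 : R) gext (derive1 g (r ^+ 2)).
  apply: (@near_eq_is_derive _ _ _ g gext) => //.
  near=> x; rewrite gextE//; apply: ltW; near: x; exact: lt_nbhsr.
have dsq : is_derive r (1 : R) (fun r : R => r ^+ 2) (2 * r).
  by apply: is_derive_eq; rewrite /GRing.scale/= mulr1 mulr_natl mulr2n.
exact: (@is_derive1_comp R gext (fun r => r ^+ 2)).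
Unshelve. all: end_near. Qed.

Let k_slope (r : R) : 0 < r -> `|derive1 g (r ^+ 2) * (2 * r)| <= 2 * C0 * growth' r.
Proof.
move=> r0; have r20 : 0 < r ^+ 2 by exact: exprn_gt0.
have pw al : (r ^+ 2) `^ (al / 2) = r `^ al.
  by rewrite -(powR_mulrn 2 (ltW r0)) -powRrM mulrCA divff ?mulr1.
have h : r ^+ 2 * `|derive1 g (r ^+ 2)| <= C0 * (r * growth' r).
  have := C0P r20; rewrite !pw -/(growth r) growthE ?(ltW r0)//.
  by rewrite normrM ger0_norm ?sqr_ge0.
rewrite -(ler_pM2l r0).
rewrite normrM [`|2 * r|]gtr0_norm ?mulr_gt0//.
rewrite [leLHS](_ : _ = 2 * (r ^+ 2 * `|derive1 g (r ^+ 2)|)); last by ring.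
rewrite [leRHS](_ : _ = 2 * (C0 * (r * growth' r))); last by ring.
by rewrite ler_pM2l.
Qed.

Let k_lip (r r' s : R) : 0 <= r <= s -> 0 <= r' <= s ->
  `|k r - k r'| <= 2 * C0 * growth' s * `|r - r'|.
Proof.
wlog rr' : r r' / r <= r'.
  move=> hw h1 h2; have [le|lt] := leP r r'; first exact: hw.
  by rewrite distrC [X in _ * X]distrC; apply: hw => //; exact: ltW.
move=> /andP[r0 rs] /andP[r0' rs'].
have dk (x : R) : x \in `]r, r'[%R -> is_derive x (1 : R) k (derive1 g (x ^+ 2) * (2 * x)).
  by rewrite in_itv/= => /andP[rx _]; apply: k_der; exact: le_lt_trans rx.
have [rr|ltr] := eqVneq r r'.
  by rewrite rr !subrr normr0 mulr0.
have ltr' : r < r' by rewrite lt_neqAle ltr.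
have [c] := MVT ltr' dk (continuous_subspaceT k_cont).
rewrite in_itv/= => /andP[rc cr'] E.
have c0 : 0 < c by exact: le_lt_trans rc.
rewrite distrC E normrM [X in _ <= _ * X]distrC ler_wpM2r//.
apply: (le_trans (k_slope c0)); rewrite ler_wpM2l ?mulr_ge0 ?(ltW C00)//.
by apply: growth'_le; [exact: ltW|exact: le_trans (ltW cr') rs'].
Qed.

Let cmod_dist (z w : R[i]) : `|cmod z - cmod w| <= cmod (z - w).
Proof.
have h (x y : R[i]) : cmod x - cmod y <= cmod (x - y).
  by rewrite lerBlDr -[X in cmod X <= _](subrK y); exact: le_normcD.
rewrite ler_norml h andbT lerNl opprB; apply: le_trans (h w z) _.
by rewrite -[leRHS]normcN opprB.
Qed.

(** Write [f z - f w = k |z| (z - w) + (k |z| - k |w|) w] with [k r = g (r^2)];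
    both terms are controlled by the slope of [k]. *)
Lemma nonlinearity_lipschitz (z w : R[i]) (s : R) : cmod z <= s -> cmod w <= s ->
  cmod (f z - f w) <= 4 * C0 * growth s * cmod (z - w).
Proof.
move=> zs ws; have s0 : 0 <= s by exact: le_trans (cmod_ge0 z) zs.
have cR (r : R) : cmod r%:C = `|r| by rewrite /cmod/= expr0n/= addr0 sqrtr_sqr.
have gk (x : R[i]) : g (cmod x ^+ 2) = k (cmod x) by rewrite /k gextE ?sqr_ge0.
have kz0 : k 0 = 0 by rewrite /k expr0n/= gextE.
have L0 : 0 <= 2 * C0 * growth' s by rewrite !mulr_ge0 ?growth'_ge0// ltW.
have -> : f z - f w = (k (cmod z))%:C * (z - w) + (k (cmod z) - k (cmod w))%:C * w.
  by rewrite !fE !gk rmorphB /=; ring.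
apply: (le_trans (le_normcD _ _)); rewrite !Normc.normcM -!/(cmod _) !cR.
have h1 : `|k (cmod z)| <= 2 * C0 * growth' s * s.
  have := @k_lip (cmod z) 0 s; rewrite kz0 !subr0 (ger0_norm (cmod_ge0 z)) => h.
  apply: (le_trans (h _ _)); rewrite ?cmod_ge0 ?zs ?lexx ?s0//.
  by rewrite ler_wpM2l.
have h2 : `|k (cmod z) - k (cmod w)| * cmod w <= 2 * C0 * growth' s * s * cmod (z - w).
  apply: (@le_trans _ _ (2 * C0 * growth' s * cmod (z - w) * s)).
    rewrite ler_pM ?cmod_ge0//.
    apply: (le_trans (k_lip (s := s) _ _)); rewrite ?cmod_ge0 ?zs ?ws//.
    by rewrite ler_wpM2l.
  by rewrite -!mulrA [cmod _ * s]mulrC.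
apply: (le_trans (lerD (ler_wpM2r (cmod_ge0 (z - w)) h1) h2)).
by rewrite growthE// le_eqVlt; apply/orP; left; apply/eqP; ring.
Qed.

Lemma measurable_nonlinearity d (T : measurableType d) (u : T -> R[i]) :
  measurable_fun setT (fun x => complex.Re (u x)) ->
  measurable_fun setT (fun x => complex.Im (u x)) ->
  measurable_fun setT (fun x => complex.Re (f (u x))) /\
  measurable_fun setT (fun x => complex.Im (f (u x))).
Proof.
move=> m1 m2.
have mg : measurable_fun setT (fun x => gext (complex.Re (u x) ^+ 2 + complex.Im (u x) ^+ 2)).
  by apply: (measurableT_comp (continuous_measurable_fun gext_cont)); meas.
have gE x : g (cmod (u x) ^+ 2) = gext (complex.Re (u x) ^+ 2 + complex.Im (u x) ^+ 2).
  by rewrite -cmod_sqr gextE ?sqr_ge0.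
split.
  rewrite (_ : (fun x => _) = fun x => gext (complex.Re (u x) ^+ 2 + complex.Im (u x) ^+ 2)
     * complex.Re (u x)); first exact: measurable_funM.
  by apply/funext => x; rewrite fE Re_mul gE /= mul0r subr0.
rewrite (_ : (fun x => _) = fun x => gext (complex.Re (u x) ^+ 2 + complex.Im (u x) ^+ 2)
   * complex.Im (u x)); first exact: measurable_funM.
by apply/funext => x; rewrite fE Im_mul gE /= mul0r addr0.
Qed.

End Nonlinearity.

Section NonlinearityAssumption.
Variable R : realType.

(** The existence proof sees the nonlinearity only through these properties. *)
Lemma assumption_F_nonlinearity (f : R[i] -> R[i]) (alpha1 alpha2 : R) :
  1 <= alpha1 -> assumption_F f alpha1 alpha2 ->
  exists2 C0 : R, 0 < C0 & [/\ f 0 = 0,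
    forall (z w : R[i]) (s : R), cmod z <= s -> cmod w <= s ->
      cmod (f z - f w) <= C0 * growth alpha1 alpha2 s * cmod (z - w) &
    forall eta : R -> R -> R[i], cmeasurable eta -> cmeasurable (fun t x => f (eta t x))].
Proof.
move=> a1 [_ a12 [g [fE g_cont g_der g00 [C0 C00 hC]]]].
have gd s : 0 < s -> derivable g s 1 by move=> /g_der[].
have hC' s : 0 < s -> `|s * derive1 g s| <= C0 * (s `^ (alpha1 / 2) + s `^ (alpha2 / 2)).
  by move=> s0; apply: le_trans (hC s s0); rewrite lerDl.
exists (4 * C0); first by rewrite mulr_gt0.
split.
- by rewrite fE mulr0.
- by move=> z w s zs ws; exact: (nonlinearity_lipschitz a1 a12 C00 fE g_cont gd g00 hC' zs ws).
- move=> eta [m1 m2].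
  exact: (measurable_nonlinearity fE g_cont (u := fun z : R * R => eta z.1 z.2) m1 m2).
Qed.

End NonlinearityAssumption.

(** * The soliton train *)

Section SeriesBounds.
Variable R : realType.
Local Notation mu := (@lebesgue_measure R).

Lemma geometric_sum_le2 (q : R) n : 0 <= q <= 2^-1 -> \sum_(0 <= j < n) q ^+ j <= 2.
Proof.
move=> /andP[q0 q1].
suff : \sum_(0 <= j < n) q ^+ j + 2 * q ^+ n <= 2.
  by apply: le_trans; rewrite lerDl mulr_ge0// exprn_ge0.
elim: n => [|n IHn]; first by rewrite big_geq// add0r expr0 mulr1.
apply: le_trans IHn; rewrite big_nat_recr//= -addrA lerD2l exprS.
have : 0 <= q ^+ n by exact: exprn_ge0.
by nra.
Qed.

Lemma cvgn_series_geometric (a : nat -> R) (M q : R) : 0 <= q <= 2^-1 -> 0 <= M ->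
  (forall j, `|a j| <= M * q ^+ j) -> cvgn (series a).
Proof.
move=> /andP[q0 q1] M0 aM.
apply: normed_cvg.
apply: (@series_le_cvg R (fun j => `|a j|) (fun j => M * q ^+ j)) => [n|n||].
- exact: normr_ge0.
- by apply: mulr_ge0 => //; exact: exprn_ge0.
- exact: aM.
apply: is_cvg_geometric_series; rewrite ger0_norm//; lra.
Qed.

Lemma series_lim_le (a : nat -> R) (L B : R) : series a @ \oo --> L ->
  (forall n, \sum_(0 <= j < n) `|a j| <= B) -> `|L| <= B.
Proof.
move=> aL aB; have nL : `|series a n| @[n --> \oo] --> `|L| by exact: cvg_norm.
rewrite -(cvg_lim _ nL)//; apply: limr_le; first exact: cvgP nL.
by apply: nearW => n; apply: le_trans (aB n); rewrite /series/= ler_norm_sum.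
Qed.

Lemma series_lim_minus_le (a : nat -> R) (L B : R) k : series a @ \oo --> L ->
  (forall n, \sum_(0 <= j < n | j != k) `|a j| <= B) -> `|L - a k| <= B.
Proof.
move=> aL aB.
pose b j := if j == k then 0 else a j.
apply: (@series_lim_le b) => [|n]; last first.
  apply: le_trans (aB n); rewrite [leRHS]big_mkcond/= le_eqVlt; apply/orP; left; apply/eqP.
  by apply: eq_bigr => j _; rewrite /b; case: eqVneq => //; rewrite normr0.
have : (fun n => series a n - a k) @ \oo --> L - a k by apply: cvgB => //; exact: cvg_cst.
apply: cvg_trans; apply: near_eq_cvg; near=> n.
have kn : (k < n)%N by near: n; exact: nbhs_infty_gt.
rewrite /series/= [X in X - _](bigD1_seq k) ?mem_index_iota ?iota_uniq//=.
rewrite addrAC subrr add0r [LHS]big_mkcond/=.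
by apply: eq_bigr => j _; rewrite /b; case: eqVneq.
Unshelve. all: end_near. Qed.

(** By Fatou's lemma. *)
Lemma ibound_lim (g_ : nat -> R -> R) (g : R -> R) (B : R) :
  (forall n, ibound (g_ n) B) -> (forall x, g_ n x @[n --> \oo] --> g x) -> ibound g B.
Proof.
move=> gB cv; have mg : measurable_fun setT g.
  by apply: (measurable_fun_cvg (h := g_)) => [n|x _]; [case: (gB n)|exact: cv].
have cE x : (g_ n x)%:E @[n --> \oo] --> (g x)%:E.
  by apply: cvg_EFin; [exact: nearW|exact: cv].
split => //.
  move=> x; rewrite -(cvg_lim _ (cv x))//; apply: limr_ge; first exact: cvgP (cv x).
  by apply: nearW => n; case: (gB n).
rewrite (_ : (\int[mu]_x _)%E = (\int[mu]_x limn_einf (fun n => (g_ n x)%:E))%E); last first.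
  apply: eq_integral => x _; rewrite is_cvg_limn_einfE; last exact: cvgP (cE x).
  by rewrite (cvg_lim _ (cE x)).
apply: (le_trans (fatou mu measurableT _ _)).
- by move=> n; apply/measurable_EFinP; case: (gB n).
- by move=> n x _; rewrite lee_fin; case: (gB n).
by apply: le_limn_einf_cst => n; case: (gB n).
Qed.

End SeriesBounds.

Section Train.
Variable R : realType.
Local Notation mu := (@lebesgue_measure R).
Variables (alpha1 alpha2 a D omega_star u0 l : R) (phi : R -> R -> R).
Hypotheses (a1 : 1 <= alpha1) (a12 : alpha1 <= alpha2) (a0 : 0 < a) (D0 : 0 < D).
Hypothesis hphi : forall omega, 0 < omega < omega_star ->
  (forall x, derivable (phi omega) x 1) /\
  (forall x, `|phi omega x| <=
     D * omega `^ alpha1^-1 * expR (- (a * omega `^ 2^-1 * `|x|))).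
Hypotheses (u00 : 0 < u0) (u01 : u0 <= 1) (u0o : u0 < omega_star)
  (u0D : 16 * D * u0 <= 1) (u0D2 : 256 * D ^+ 2 * u0 <= 1) (l0 : 0 < l).

(** The amplitudes, of order [amp j], decrease geometrically, and with them the
    inverse widths [wid j]. The speeds grow like the widths, so that two solitons
    separate at a rate at least [2 l], measured in the larger of the two widths. *)
Definition amp (j : nat) : R := u0 * 16^-1 ^+ j.
Definition freq (j : nat) : R := amp j `^ alpha1.
Definition wid (j : nat) : R := amp j `^ (alpha1 / 2).
Definition vel (j : nat) : R := 4 * l / a / wid j.
Definition env (j : nat) (t x : R) : R := expR (- (a * wid j * `|x - vel j * t|)).
Definition sol (j : nat) (t x : R) : R[i] := soliton_train phi freq vel (fun=> 0) j t x.

Let pow_le1 (q : R) n : 0 <= q <= 1 -> q ^+ n <= 1.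
Proof. by move=> /andP[q0 q1]; exact: exprn_ile1. Qed.

Let a10 : 0 < alpha1. Proof. exact: lt_le_trans a1. Qed.

Lemma amp_gt0 j : 0 < amp j.
Proof. by rewrite mulr_gt0// exprn_gt0. Qed.

Lemma amp_le_u0 j : amp j <= u0.
Proof. by rewrite ler_piMr ?(ltW u00)// pow_le1//; lra. Qed.

Lemma amp_le1 j : amp j <= 1.
Proof. exact: le_trans (amp_le_u0 j) u01. Qed.

Lemma freq_in j : 0 < freq j < omega_star.
Proof.
rewrite powR_gt0 ?amp_gt0//= (le_lt_trans _ u0o)// (le_trans _ (amp_le_u0 j))//.
by apply: ge1r_powR => //; rewrite amp_gt0 amp_le1.
Qed.

Lemma freq_root j : freq j `^ alpha1^-1 = amp j.
Proof. by rewrite -powRrM divff ?gt_eqF// powRr1// ltW// amp_gt0. Qed.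

Lemma freq_sqrt j : freq j `^ 2^-1 = wid j.
Proof. by rewrite -powRrM. Qed.

Lemma wid_gt0 j : 0 < wid j.
Proof. by rewrite powR_gt0// amp_gt0. Qed.

(** As [alpha1 / 2 >= 1 / 2], the inverse widths decrease at least like the square
    roots of the amplitudes. *)
Lemma powR_half_le (y q : R) : 0 <= q <= 1 -> 0 < y -> y <= q ^+ 2 -> y `^ (alpha1 / 2) <= q.
Proof.
move=> /andP[q0 q1] y0 yq.
have y1 : y <= 1 by apply: (le_trans yq); exact: exprn_ile1.
apply: (@le_trans _ _ (y `^ 2^-1)).
  apply: ger_powR; first by rewrite y0 y1.
  by rewrite -[leLHS]mul1r ler_wpM2r.
by rewrite powR12_sqrt ?(ltW y0)// -[leRHS](ger0_norm q0) -sqrtr_sqr ler_wsqrtr.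
Qed.

Lemma wid_le i j : (i < j)%N -> wid j <= wid i / 2.
Proof.
move=> ij; rewrite /wid.
have -> : amp j = 16^-1 ^+ (j - i) * amp i.
  by rewrite /amp mulrCA -exprD subnK// ltnW.
rewrite powRM ?exprn_ge0 ?(ltW (amp_gt0 i))// mulrC ler_wpM2l ?powR_ge0//.
apply: powR_half_le; [lra|by rewrite exprn_gt0|].
apply: (@le_trans _ _ 16^-1); last by lra.
by rewrite -[leRHS]expr1; apply: ler_wiXn2l; rewrite ?subn_gt0//; lra.
Qed.

Lemma vel_inj : injective vel.
Proof.
move=> i j vij; apply/eqP; apply/negP => /negP nij.
have wij : wid i = wid j.
  move: vij; rewrite /vel => /mulfI h; apply: invr_inj; apply: h.
  by rewrite mulf_neq0 ?invr_neq0 ?gt_eqF// mulr_gt0.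
have [ij|] := ltnP i j.
  by have := wid_le ij; rewrite wij; have := wid_gt0 j; lra.
rewrite leq_eqVlt eq_sym (negbTE nij)/= => ji.
by have := wid_le ji; rewrite wij; have := wid_gt0 j; lra.
Qed.

Lemma env_gt0 j t x : 0 < env j t x. Proof. exact: expR_gt0. Qed.

Lemma env_le1 j t x : env j t x <= 1.
Proof. by rewrite -expR0 ler_expR oppr_le0 !mulr_ge0// ltW// wid_gt0. Qed.

(** The distances from a point to the two centres add up to at least the gap
    between the centres, so that one of them is at least half of it; this half,
    in units of the larger width, is at least [l t / a]. *)
Lemma env_separation i j t x : i != j -> 0 <= t ->
  env i t x <= expR (- (l * t)) \/ env j t x <= expR (- (l * t)).
Proof.
wlog ij : i j / (i < j)%N.
  move=> hw nij t0; have [lt|] := ltnP i j; first exact: hw.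
  rewrite leq_eqVlt eq_sym (negbTE nij)/= => ji.
  by have [h|h] := hw j i ji (contra_neq esym nij) t0; [right|left].
move=> _ t0.
have [|e1] := leP (env i t x) (expR (- (l * t))); first by left.
have [|e2] := leP (env j t x) (expR (- (l * t))); first by right.
exfalso; move: e1 e2; rewrite !ltr_expR !ltrN2.
have wj0 := wid_gt0 j; have wi0 := wid_gt0 i; have wji := wid_le ij.
set di := `|x - vel i * t|; set dj := `|x - vel j * t|.
have di0 : 0 <= di by exact: normr_ge0.
have tri : (vel j - vel i) * t <= di + dj.
  rewrite (_ : (vel j - vel i) * t = (x - vel i * t) - (x - vel j * t)); last by ring.
  by rewrite (le_trans (ler_norm _))// ler_normB.
have vE : a * wid j * (vel j - vel i) = 4 * l - 4 * l * (wid j / wid i).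
  by rewrite /vel; field; rewrite !gt_eqF.
have wr : wid j / wid i <= 2^-1 by rewrite ler_pdivrMr// mulrC.
have lower : 2 * l * t <= a * wid j * (di + dj).
  apply: (@le_trans _ _ (a * wid j * ((vel j - vel i) * t))).
    rewrite mulrA vE ler_wpM2r//.
    have : 4 * l * (wid j / wid i) <= 4 * l * 2^-1 by rewrite ler_wpM2l// mulr_ge0// ltW.
    by lra.
  by rewrite ler_wpM2l// mulr_ge0// ltW.
have : a * wid j * di <= a * wid i * di.
  by rewrite ler_wpM2r// ler_wpM2l ?(ltW a0)//; lra.
by move: lower; rewrite mulrDr; lra.
Qed.

Lemma dominant_soliton t x : 0 <= t ->
  exists k, forall j, j != k -> env j t x <= expR (- (l * t)).
Proof.
move=> t0; have [[k hk]|none] := pselect (exists k, expR (- (l * t)) < env k t x).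
  exists k => j jk; have [//|] := env_separation x jk t0.
  by rewrite leNgt hk.
by exists 0%N => j _; rewrite leNgt; apply/negP => h; apply: none; exists j.
Qed.

Lemma cmod_cexpi (theta : R) : cmod (cexpi theta) = 1.
Proof. by rewrite /cmod /cexpi /= cos2Dsin2 sqrtr1. Qed.

Definition csol (j : nat) (t x : R) : R := D * amp j * env j t x.

Lemma csol_gt0 j t x : 0 < csol j t x.
Proof. by rewrite !mulr_gt0 ?amp_gt0 ?env_gt0. Qed.

Lemma cmod_sol j t x : cmod (sol j t x) <= csol j t x.
Proof.
rewrite /sol /soliton_train /soliton /cmod Normc.normcM -!/(cmod _) cmod_cexpi mul1r.
rewrite [cmod _](_ : _ = `|phi (freq j) (x - vel j * t)|); last first.
  by rewrite /cmod/= expr0n/= addr0 sqrtr_sqr.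
by have [_ /(_ (x - vel j * t))] := hphi (freq_in j); rewrite freq_root freq_sqrt.
Qed.

Lemma measurable_phi j : measurable_fun setT (phi (freq j)).
Proof.
apply: continuous_measurable_fun => x.
have [/(_ x) /derivable1_diffP dphi _] := hphi (freq_in j).
exact: (differentiable_continuous dphi).
Qed.

Lemma cmeasurable_sol j : cmeasurable (sol j).
Proof.
have mphi := measurable_phi j.
have m1 : measurable_fun setT (fun z : R * R => phi (freq j) (z.2 - vel j * z.1)) by meas.
split.
  rewrite (_ : (fun z => _) = fun z : R * R =>
    cos (freq j * z.1 + 2^-1 * vel j * z.2 - 4^-1 * vel j ^+ 2 * z.1 + 0) *
    phi (freq j) (z.2 - vel j * z.1)); first by meas.
  by apply/funext => z; rewrite /sol /soliton_train /soliton Re_mul/= mulr0 subr0.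
rewrite (_ : (fun z => _) = fun z : R * R =>
  sin (freq j * z.1 + 2^-1 * vel j * z.2 - 4^-1 * vel j ^+ 2 * z.1 + 0) *
  phi (freq j) (z.2 - vel j * z.1)); first by meas.
by apply/funext => z; rewrite /sol /soliton_train /soliton Im_mul/= mulr0 add0r.
Qed.

Lemma csol_le j t x : csol j t x <= D * u0 * 16^-1 ^+ j.
Proof.
rewrite /csol -mulrA [leRHS](_ : _ = D * amp j); last by rewrite /amp; ring.
by rewrite ler_pM2l// ler_piMr ?env_le1// ltW ?amp_gt0.
Qed.

(** [beta j] is the Lipschitz constant of the nonlinearity at [16 * 2 ^ j] times
    the amplitude of the soliton: the factor [2 ^ j] pays for the sum over the
    train, and 16 for the numerical constants in the use of the potential. *)
Definition beta (j : nat) : R := growth alpha1 alpha2 (16 * 2 ^+ j * D * amp j).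

Let s_gt0 j : 0 < 16 * 2 ^+ j * D * amp j.
Proof. by rewrite !mulr_gt0 ?amp_gt0 ?exprn_gt0. Qed.

Let s_le j : 16 * 2 ^+ j * D * amp j <= 8^-1 ^+ j.
Proof.
have -> : 16 * 2 ^+ j * D * amp j = 16 * D * u0 * (2 * 16^-1) ^+ j.
  by rewrite /amp exprMn; ring.
rewrite (_ : 2 * 16^-1 = 8^-1); last by lra.
by rewrite ler_piMl// exprn_ge0.
Qed.

Let s_le1 j : 16 * 2 ^+ j * D * amp j <= 1.
Proof. by apply: (le_trans (s_le j)); rewrite pow_le1//; lra. Qed.

Lemma beta_ge0 j : 0 <= beta j.
Proof. exact: growth_ge0. Qed.

Let beta_powR j : beta j <= 2 * (16 * 2 ^+ j * D * amp j) `^ alpha1.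
Proof. by apply: growth_small => //; rewrite s_gt0 s_le1. Qed.

Lemma beta_le j : beta j <= 2 * 2^-1 ^+ j.
Proof.
apply: (le_trans (beta_powR j)); rewrite ler_wpM2l//.
apply: (@le_trans _ _ (16 * 2 ^+ j * D * amp j)).
  by apply: ge1r_powR => //; rewrite s_gt0 s_le1.
by apply: (le_trans (s_le j)); rewrite lerXn2r ?nnegrE ?invr_ge0//; lra.
Qed.

(** The integral of the [j]-th term of the potential. The Lipschitz constant
    scales like [amp j `^ alpha1] and the width like [amp j `^ (- alpha1 / 2)], so
    that the former wins. *)
Lemma beta_wid_le j : beta j / wid j <= 2 * 2^-1 ^+ j.
Proof.
rewrite ler_pdivrMr ?wid_gt0//; apply: (le_trans (beta_powR j)).
rewrite -[leRHS]mulrA ler_wpM2l//; set s := 16 * 2 ^+ j * D * amp j.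
have -> : s `^ alpha1 = (s ^+ 2) `^ (alpha1 / 2).
  have s0 : 0 <= s by exact: ltW (s_gt0 j).
  by rewrite -(powR_mulrn 2 s0) -powRrM mulrCA divff ?mulr1.
pose y := 256 * D ^+ 2 * u0 * 4^-1 ^+ j.
have y0 : 0 < y by rewrite !mulr_gt0 ?exprn_gt0.
have -> : s ^+ 2 = y * amp j.
  have e : 4^-1 ^+ j = (2 ^+ j) ^+ 2 * 16^-1 ^+ j :> R.
    by rewrite exprAC -exprMn; congr (_ ^+ j); lra.
  by rewrite /s /y e /amp; ring.
rewrite powRM ?(ltW y0) ?(ltW (amp_gt0 j))// ler_wpM2r ?powR_ge0//.
apply: powR_half_le => //; first by rewrite exprn_ge0//= pow_le1//; lra.
rewrite exprAC (_ : 2^-1 ^+ 2 = 4^-1); last by lra.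
by rewrite /y ler_piMl// exprn_ge0.
Qed.

Lemma growth_csol j t x (m : R) : 0 <= m -> m <= 16 * 2 ^+ j * csol j t x ->
  growth alpha1 alpha2 m <= beta j * env j t x.
Proof.
move=> m0 hm; rewrite [leRHS]mulrC /beta.
apply: le_trans (growth_scale a1 a12 _ (ltW (s_gt0 j))); last first.
  by rewrite env_le1 (ltW (env_gt0 _ _ _)).
by apply: growth_le => //; apply: (le_trans hm); rewrite /csol !mulrA.
Qed.

Definition potential (t x : R) : R := limn (series (fun j => beta j * env j t x)).

Let bterm_ge0 j t x : 0 <= beta j * env j t x.
Proof. by rewrite mulr_ge0 ?beta_ge0// ltW ?env_gt0. Qed.

Let bterm_le j t x : beta j * env j t x <= 2 * 2^-1 ^+ j.
Proof. by apply: le_trans (beta_le j); rewrite ler_piMr ?beta_ge0 ?env_le1. Qed.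

Lemma potential_cvg t x :
  series (fun j => beta j * env j t x) @ \oo --> potential t x.
Proof.
apply: (cvgn_series_geometric (M := 2) (q := 2^-1)) => //; first by lra.
by move=> j; rewrite ger0_norm ?bterm_ge0 ?bterm_le.
Qed.

Lemma potential_ge_term j t x : beta j * env j t x <= potential t x.
Proof.
have cv := @potential_cvg t x.
apply: limr_ge; first exact: cvgP cv.
near=> n; rewrite /series/= (bigD1_seq j) ?mem_index_iota ?iota_uniq//=.
  by rewrite lerDl sumr_ge0.
by near: n; exact: nbhs_infty_gt.
Unshelve. all: end_near. Qed.

Lemma potential_ge0 t x : 0 <= potential t x.
Proof. exact: le_trans (bterm_ge0 0 t x) (potential_ge_term 0 t x). Qed.

Let sum_half n : \sum_(0 <= j < n) 2 * 2^-1 ^+ j <= 4 :> R.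
Proof.
rewrite -mulr_sumr (_ : 4 = 2 * 2 :> R); last by lra.
by rewrite ler_wpM2l//; apply: geometric_sum_le2; lra.
Qed.

Lemma potential_le4 t x : potential t x <= 4.
Proof.
rewrite -[leLHS](ger0_norm (potential_ge0 t x)); apply: (series_lim_le (@potential_cvg t x)) => n.
apply: le_trans (sum_half n); apply: ler_sum => j _.
by rewrite ger0_norm ?bterm_ge0 ?bterm_le.
Qed.

Lemma measurable_env j : measurable_fun setT (fun z : R * R => env j z.1 z.2).
Proof. by rewrite /env; meas. Qed.

Lemma measurable_potential : measurable_fun setT (fun z : R * R => potential z.1 z.2).
Proof.
apply: (measurable_fun_cvg (h := fun n z => series (fun j => beta j * env j z.1 z.2) n)).
  move=> n; rewrite /series/=; apply: measurable_sum => j.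
  by apply: measurable_funM => //; exact: measurable_env.
by move=> z _; exact: potential_cvg.
Qed.

Lemma ibound_potential t : ibound (potential t) (8 / a).
Proof.
apply: (ibound_lim (g_ := fun n x => series (fun j => beta j * env j t x) n)); last first.
  by move=> x; exact: potential_cvg.
move=> n.
have ibe j : ibound (env j t) (2 / (a * wid j)).
  have aw : 0 < a * wid j by rewrite mulr_gt0 ?wid_gt0.
  split; [exact: (measurable_slice t (measurable_env j))|by move=> x; rewrite ltW ?env_gt0|].
  by rewrite /env integral_expR_abs.
have ibs : ibound (fun x => series (fun j => beta j * env j t x) n)
                  (\sum_(0 <= j < n) beta j * (2 / (a * wid j))).
  elim: n => [|n IHn].
    rewrite big_geq// (_ : (fun x => _) = cst 0); last first.
      by apply/funext => x; rewrite /series/= big_geq.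
    by split => //; rewrite integral0.
  rewrite big_nat_recr//= (_ : (fun x => _) = fun x =>
      series (fun j => beta j * env j t x) n + beta n * env n t x); last first.
    by apply/funext => x; rewrite /series/= big_nat_recr.
  by apply: ibound_add => //; apply: ibound_scale; rewrite ?beta_ge0.
have [h1 h2 h3] := ibs; split => //; apply: (le_trans h3); rewrite lee_fin.
apply: (@le_trans _ _ (\sum_(0 <= j < n) 2 / a * (2 * 2^-1 ^+ j))).
  apply: ler_sum => j _.
  rewrite (_ : beta j * (2 / (a * wid j)) = 2 / a * (beta j / wid j)); last first.
    by field; rewrite !gt_eqF ?wid_gt0.
  by rewrite ler_wpM2l ?beta_wid_le// divr_ge0// ltW.
rewrite -mulr_sumr (_ : 8 / a = 2 / a * 4); last by field; rewrite gt_eqF.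
by rewrite ler_wpM2l// divr_ge0// ltW.
Qed.

Let q16 : 0 <= (16^-1 : R) <= 2^-1.
Proof. by apply/andP; split; lra. Qed.
Let Du0 : 0 <= D * u0. Proof. by rewrite mulr_ge0 ?ltW. Qed.

Let sol_Re_le j t x : `|complex.Re (sol j t x)| <= csol j t x.
Proof. exact: le_trans (normr_Re_le _) (cmod_sol j t x). Qed.

Let sol_Im_le j t x : `|complex.Im (sol j t x)| <= csol j t x.
Proof. exact: le_trans (normr_Im_le _) (cmod_sol j t x). Qed.

Definition train (t x : R) : R[i] :=
  limn (series (fun j => complex.Re (sol j t x))) +i*
  limn (series (fun j => complex.Im (sol j t x))).

Lemma train_cvg t x : cseries_cvg (fun j => sol j t x) (train t x).
Proof.
split; apply: (cvgn_series_geometric (M := D * u0) (q := 16^-1)) => // j.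
  exact: le_trans (sol_Re_le j t x) (csol_le j t x).
exact: le_trans (sol_Im_le j t x) (csol_le j t x).
Qed.

Lemma cmeasurable_series (u : nat -> R -> R -> R[i]) (v : R -> R -> R[i]) :
  (forall j, cmeasurable (u j)) ->
  (forall t x, cseries_cvg (fun j => u j t x) (v t x)) -> cmeasurable v.
Proof.
move=> mu_ cv; split.
  apply: (measurable_fun_cvg (h := fun n z => series (fun j => complex.Re (u j z.1 z.2)) n)).
    by move=> n; rewrite /series/=; apply: measurable_sum => j; have [] := mu_ j.
  by move=> z _; have [] := cv z.1 z.2.
apply: (measurable_fun_cvg (h := fun n z => series (fun j => complex.Im (u j z.1 z.2)) n)).
  by move=> n; rewrite /series/=; apply: measurable_sum => j; have [] := mu_ j.
by move=> z _; have [] := cv z.1 z.2.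
Qed.

Lemma cmeasurable_train : cmeasurable train.
Proof. exact: cmeasurable_series cmeasurable_sol train_cvg. Qed.

Definition csum (t x : R) : R := limn (series (fun j => csol j t x)).

Let csum_cvg t x : series (fun j => csol j t x) @ \oo --> csum t x.
Proof.
apply: (cvgn_series_geometric (M := D * u0) (q := 16^-1)) => // j.
by rewrite ger0_norm ?csol_le// ltW ?csol_gt0.
Qed.

Lemma csol_partial_le n t x : \sum_(0 <= j < n) csol j t x <= csum t x.
Proof.
apply: nondecreasing_cvgn_le; last exact: cvgP (@csum_cvg t x).
by apply: nondecreasing_series => j _; rewrite ltW ?csol_gt0.
Qed.

Lemma csol_le_csum j t x : csol j t x <= csum t x.
Proof.
apply: le_trans (csol_partial_le j.+1 t x); rewrite big_nat_recr//= lerDr.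
by apply: sumr_ge0 => i _; rewrite ltW ?csol_gt0.
Qed.

Lemma csum_gt0 t x : 0 < csum t x.
Proof. exact: lt_le_trans (csol_gt0 0 t x) (csol_le_csum 0 t x). Qed.

(** A sum of positive numbers is at most [4 * 2 ^ j] times its [j]-th term for
    some [j], for otherwise the terms would be too small to add up to it. The
    growth at the sum is then one term of the potential. *)
Lemma growth_csum t x : growth alpha1 alpha2 (4 * csum t x) <= potential t x.
Proof.
have c0 := csum_gt0 t x.
have [[j hj]|none] := pselect (exists j, csum t x <= 4 * 2 ^+ j * csol j t x).
  apply: le_trans (potential_ge_term j t x); apply: growth_csol.
    by rewrite mulr_ge0// ltW.
  rewrite (_ : 16 * 2 ^+ j * csol j t x = 4 * (4 * 2 ^+ j * csol j t x)); last by ring.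
  by rewrite ler_wpM2l.
have hlt j : csol j t x <= csum t x / 4 * 2^-1 ^+ j.
  have /negP := fun h => none (ex_intro _ j h); rewrite -ltNge => /ltW h.
  rewrite exprVn ler_pdivlMr ?exprn_gt0// ler_pdivlMr//.
  by apply: le_trans h; rewrite le_eqVlt; apply/orP; left; apply/eqP; ring.
exfalso.
have : `|csum t x| <= csum t x / 4 * 2.
  apply: (series_lim_le (@csum_cvg t x)) => n.
  apply: (@le_trans _ _ (\sum_(0 <= j < n) csum t x / 4 * 2^-1 ^+ j)).
    by apply: ler_sum => j _; rewrite ger0_norm ?hlt// ltW ?csol_gt0.
  rewrite -mulr_sumr ler_wpM2l//; first by rewrite divr_ge0// ltW.
  by apply: geometric_sum_le2; lra.
by rewrite gtr0_norm//; lra.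
Qed.

Let cmod_2 (z : R[i]) (B : R) : `|complex.Re z| <= B -> `|complex.Im z| <= B -> cmod z <= 2 * B.
Proof. by move=> h1 h2; apply: le_trans (cmod_le z) _; rewrite mulr_natl mulr2n lerD. Qed.

Lemma cmod_train t x : cmod (train t x) <= 2 * csum t x.
Proof.
have [cR cI] := train_cvg t x.
apply: cmod_2; [apply: (series_lim_le cR)|apply: (series_lim_le cI)] => n;
  apply: le_trans (csol_partial_le n t x); apply: ler_sum => j _; [exact: sol_Re_le|exact: sol_Im_le].
Qed.

Let rest_le k t x n : (forall j, j != k -> env j t x <= expR (- (l * t))) ->
  \sum_(0 <= j < n | j != k) csol j t x <= 2 * (D * u0) * expR (- (l * t)).
Proof.
move=> hk.
apply: (@le_trans _ _ (\sum_(0 <= j < n | j != k) D * u0 * expR (- (l * t)) * 16^-1 ^+ j)).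
  apply: ler_sum => j jk; rewrite /csol /amp.
  rewrite [leRHS](_ : _ = D * (u0 * 16^-1 ^+ j) * expR (- (l * t))); last by ring.
  by rewrite ler_wpM2l ?hk// !mulr_ge0 ?exprn_ge0 ?ltW.
rewrite big_mkcond/=.
apply: (@le_trans _ _ (\sum_(0 <= j < n) D * u0 * expR (- (l * t)) * 16^-1 ^+ j)).
  apply: ler_sum => j _; case: ifP => // _.
  by rewrite !mulr_ge0 ?exprn_ge0 ?expR_ge0 ?ltW.
rewrite -mulr_sumr [leRHS](_ : _ = D * u0 * expR (- (l * t)) * 2); last by ring.
rewrite ler_wpM2l//; first by rewrite mulr_ge0 ?expR_ge0.
exact: geometric_sum_le2.
Qed.

Section Interaction.
Variables (f : R[i] -> R[i]) (C0 rho : R).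
Hypotheses (C00 : 0 < C0) (rho0 : 0 < rho) (f0 : f 0 = 0)
  (fL : forall (z w : R[i]) (s : R), cmod z <= s -> cmod w <= s ->
      cmod (f z - f w) <= C0 * growth alpha1 alpha2 s * cmod (z - w))
  (fm : forall eta : R -> R -> R[i], cmeasurable eta -> cmeasurable (fun t x => f (eta t x))).

Let cmod0 : cmod (0 : R[i]) = 0. Proof. exact: Normc.normc0. Qed.

Let f_sol_le j t x : cmod (f (sol j t x)) <= C0 * potential t x * csol j t x.
Proof.
have := fL (cmod_sol j t x) (_ : cmod 0 <= csol j t x); rewrite f0 !subr0 cmod0 => h.
apply: (le_trans (h (ltW (csol_gt0 _ _ _)))).
apply: ler_pM; [by rewrite mulr_ge0 ?growth_ge0// ltW|exact: cmod_ge0| |exact: cmod_sol].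
rewrite ler_wpM2l ?(ltW C00)//.
apply: le_trans (growth_csum t x); apply: (growth_le a1 a12); first by rewrite ltW ?csol_gt0.
by have := csol_le_csum j t x; have := csum_gt0 t x; lra.
Qed.

Definition fsum (t x : R) : R[i] :=
  limn (series (fun j => complex.Re (f (sol j t x)))) +i*
  limn (series (fun j => complex.Im (f (sol j t x)))).

Lemma fsum_cvg t x : cseries_cvg (fun j => f (sol j t x)) (fsum t x).
Proof.
have P0 : 0 <= C0 * potential t x by rewrite mulr_ge0 ?potential_ge0// ltW.
have M0 : 0 <= C0 * potential t x * (D * u0) by rewrite mulr_ge0.
have h j : cmod (f (sol j t x)) <= C0 * potential t x * (D * u0) * 16^-1 ^+ j.
  by apply: (le_trans (f_sol_le j t x)); rewrite -[leRHS]mulrA ler_wpM2l// csol_le.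
split; apply: (cvgn_series_geometric (M := C0 * potential t x * (D * u0)) (q := 16^-1)) => // j; apply: le_trans (h j).
  exact: normr_Re_le.
exact: normr_Im_le.
Qed.

Lemma cmeasurable_fsum : cmeasurable fsum.
Proof. by apply: (cmeasurable_series _ fsum_cvg) => j; apply: fm; exact: cmeasurable_sol. Qed.

(** With [z] the perturbation, the nonlinear term of the Duhamel equation. *)
Definition interaction (t x : R) (z : R[i]) : R[i] := f (train t x + z) - fsum t x.

Lemma cmeasurable_interaction eta : cmeasurable eta ->
  cmeasurable (fun t x => interaction t x (eta t x)).
Proof.
move=> [m1 m2]; apply: cmeasurableB; last exact: cmeasurable_fsum.
apply: (fm (eta := fun t x => train t x + eta t x)).
have [n1 n2] := cmeasurable_train; split.
  by under eq_fun do rewrite Re_add; exact: measurable_funD.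
by under eq_fun do rewrite Im_add; exact: measurable_funD.
Qed.

Let C1 := C0 * (1 + 2 * growth' alpha1 alpha2 (4 * rho)).

(** The growth at [train + z] splits into the growth at the train, which the
    potential dominates, and the growth at [z], linear in the modulus of [z] on
    bounded sets. *)
Lemma interaction_lipschitz (t x : R) z w : cmod z <= rho -> cmod w <= rho ->
  cmod (interaction t x z - interaction t x w) <=
  C1 * (potential t x + cmod z + cmod w) * cmod (z - w).
Proof.
move=> zr wr; have z0 := cmod_ge0 z; have w0 := cmod_ge0 w; have c0 := csum_gt0 t x.
have -> : interaction t x z - interaction t x w = f (train t x + z) - f (train t x + w).
  by rewrite /interaction opprB addrA subrK.
pose s := 2 * csum t x + (cmod z + cmod w).
have hz : cmod (train t x + z) <= s.
  by apply: (le_trans (le_normcD _ _)); rewrite -!/(cmod _) /s; have := cmod_train t x; lra.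
have hw : cmod (train t x + w) <= s.
  by apply: (le_trans (le_normcD _ _)); rewrite -!/(cmod _) /s; have := cmod_train t x; lra.
apply: (le_trans (fL hz hw)).
rewrite (_ : train t x + z - (train t x + w) = z - w); last by ring.
rewrite ler_wpM2r ?cmod_ge0// /C1 -mulrA ler_wpM2l ?(ltW C00)//.
apply: (@le_trans _ _ (growth alpha1 alpha2 (2 * (2 * csum t x)) +
                       growth alpha1 alpha2 (2 * (cmod z + cmod w)))).
  by apply: growth_add => //; [rewrite mulr_ge0// ltW|rewrite addr_ge0].
have hG : growth alpha1 alpha2 (2 * (cmod z + cmod w)) <=
    2 * growth' alpha1 alpha2 (4 * rho) * (cmod z + cmod w).
  rewrite growthE ?mulr_ge0 ?addr_ge0//.
  have hh : growth' alpha1 alpha2 (2 * (cmod z + cmod w)) <= growth' alpha1 alpha2 (4 * rho).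
    by apply: growth'_le => //; [rewrite mulr_ge0// addr_ge0|lra].
  by rewrite [leRHS]mulrAC ler_wpM2l// mulr_ge0// addr_ge0.
have hP : growth alpha1 alpha2 (2 * (2 * csum t x)) <= potential t x.
  by rewrite mulrA (_ : 2 * 2 = 4); [exact: growth_csum|lra].
apply: (le_trans (lerD hP hG)).
have := growth'_ge0 alpha1 alpha2 (4 * rho); have := potential_ge0 t x.
move: (potential t x) (growth' _ _ _) (cmod z) (cmod w) z0 w0 => p G b c b0 c0' p0 G0.
have : 0 <= 2 * G * p by rewrite !mulr_ge0.
by lra.
Qed.

(** At every point all solitons but one, the [k]-th, are exponentially small, and
    without them the interaction would vanish. The errors of replacing the train
    and the sum of the nonlinear terms by the [k]-th soliton are both linear in
    the remaining ones. *)
Lemma interaction_source (t x : R) : 0 <= t ->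
  cmod (interaction t x 0) <= C1 * expR (- (l * t)) * potential t x.
Proof.
move=> t0; have [k hk] := dominant_soliton x t0; have c0 := csum_gt0 t x.
set e := expR (- (l * t)) in hk *; have e0 : 0 <= e by exact: expR_ge0.
have P0 := potential_ge0 t x; have CP0 : 0 <= C0 * potential t x by rewrite mulr_ge0// ltW.
pose d := D * u0 * e; have d0 : 0 <= d by rewrite mulr_ge0.
have [tR tI] := train_cvg t x; have [fR fI] := fsum_cvg t x.
have rest n : \sum_(0 <= j < n | j != k) csol j t x <= 2 * d.
  by rewrite /d mulrA; exact: rest_le.
have h1 : cmod (train t x - sol k t x) <= 4 * d.
  rewrite (_ : 4 * d = 2 * (2 * d)); last by ring.
  apply: cmod_2; rewrite ?Re_sub ?Im_sub.
    apply: (series_lim_minus_le tR) => n; apply: le_trans (rest n).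
    by apply: ler_sum => j _; exact: sol_Re_le.
  apply: (series_lim_minus_le tI) => n; apply: le_trans (rest n).
  by apply: ler_sum => j _; exact: sol_Im_le.
have h2 : cmod (fsum t x - f (sol k t x)) <= 2 * (C0 * potential t x * (2 * d)).
  apply: cmod_2; rewrite ?Re_sub ?Im_sub.
    apply: (series_lim_minus_le fR) => n.
    apply: (@le_trans _ _ (C0 * potential t x * \sum_(0 <= j < n | j != k) csol j t x)).
      rewrite mulr_sumr; apply: ler_sum => j _.
      by apply: le_trans (f_sol_le j t x); exact: normr_Re_le.
    by rewrite ler_wpM2l.
  apply: (series_lim_minus_le fI) => n.
  apply: (@le_trans _ _ (C0 * potential t x * \sum_(0 <= j < n | j != k) csol j t x)).
    rewrite mulr_sumr; apply: ler_sum => j _.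
    by apply: le_trans (f_sol_le j t x); exact: normr_Im_le.
  by rewrite ler_wpM2l.
have h3 : cmod (f (train t x) - f (sol k t x)) <= C0 * potential t x * (4 * d).
  have hs : cmod (sol k t x) <= 2 * csum t x.
    by apply: (le_trans (cmod_sol k t x)); have := csol_le_csum k t x; lra.
  apply: (le_trans (fL (cmod_train t x) hs)); apply: ler_pM => //.
  - by rewrite mulr_ge0 ?growth_ge0// ltW.
  - exact: cmod_ge0.
  rewrite ler_wpM2l ?(ltW C00)//; apply: le_trans (growth_csum t x).
  by apply: growth_le => //; lra.
rewrite /interaction addr0.
rewrite (_ : f (train t x) - fsum t x =
   (f (train t x) - f (sol k t x)) - (fsum t x - f (sol k t x))); last by ring.
apply: (le_trans (le_normcD _ _)); rewrite normcN -!/(cmod _).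
apply: (le_trans (lerD h3 h2)).
apply: (@le_trans _ _ (C0 * potential t x * e)).
  rewrite [leLHS](_ : _ = C0 * potential t x * (8 * d)); last by ring.
  rewrite ler_wpM2l// /d.
  have h8 : 8 * (D * u0) <= 1 by have := Du0; have := u0D; rewrite -mulrA; lra.
  by rewrite mulrA ler_piMl.
rewrite [leRHS](_ : _ = C0 * potential t x * e * (1 + 2 * growth' alpha1 alpha2 (4 * rho))).
  have pe0 : 0 <= C0 * potential t x * e by exact: mulr_ge0.
  have g0 := growth'_ge0 alpha1 alpha2 (4 * rho).
  by apply: ler_peMr pe0 _; lra.
by rewrite /C1; ring.
Qed.

End Interaction.

End Train.

(** * Existence of the solution *)

Section NormBound.
Variable R : realType.
Local Notation mu := (@lebesgue_measure R).

Lemma cLnormy_le (h : R -> R[i]) (B : R) : 0 <= B -> (forall x, cmod (h x) <= B) ->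
  (cLnorm +oo%E h <= B%:E)%E.
Proof.
move=> B0 hB; rewrite /cLnorm unlock /Lnorm; case: ifPn => _; last by rewrite lee_fin.
by apply/ess_supP/aeW => x /=; rewrite lee_fin ger0_norm ?cmod_ge0.
Qed.

Lemma cstate_normL2Loo (l b t : R) (eta : R -> R -> R[i]) : 0 <= b -> 0 <= t ->
  cstate l b eta -> (normL2Loo (eta t) <= (2 * b * expR (- (l * t)))%:E)%E.
Proof.
move=> b0 t0 [[mr hr] [mi hi]]; have [r1 r2] := hr t t0; have [i1 i2] := hi t t0.
have e0 := expR_ge0 (- (l * t)); set e := expR _ in r1 r2 i1 i2 e0 *.
have B0 : 0 <= 2 * b * e by rewrite !mulr_ge0.
have m1 := measurable_slice t mr; have m2 := measurable_slice t mi.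
rewrite /normL2Loo ge_max; apply/andP; split; last first.
  apply: cLnormy_le => // x; apply: (le_trans (cmod_le _)).
  by rewrite -mulrA mulr_natl mulr2n lerD.
apply: cLnorm2_le => //.
under eq_integral do rewrite EFinD.
rewrite ge0_integralD//=.
- apply: (le_trans (leeD r2 i2)); rewrite -EFinD lee_fin.
  have : 0 <= (b * e) ^+ 2 by exact: sqr_ge0.
  by rewrite -mulrA exprMn; lra.
- by move=> x _; rewrite lee_fin sqr_ge0.
- by apply/measurable_EFinP; meas.
- by move=> x _; rewrite lee_fin sqr_ge0.
- by apply/measurable_EFinP; meas.
Qed.

Lemma cstate_in_L2 (l b t : R) (eta : R -> R -> R[i]) : 0 <= t ->
  cstate l b eta -> in_L2 (eta t).
Proof.
move=> t0 [[mr hr] [mi hi]]; have [r1 r2] := hr t t0; have [i1 i2] := hi t t0.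
split; apply: Lfun2_sqr_lty.
- exact: (measurable_slice t mr).
- by apply: (le_lt_trans r2); rewrite ltry.
- exact: (measurable_slice t mi).
- by apply: (le_lt_trans i2); rewrite ltry.
Qed.

End NormBound.

Theorem theorem3p7 (R : realType) (f : R[i] -> R[i]) (alpha1 alpha2 : R)
    (omega_star a D : R) (phi : R -> R -> R)
    (hF : assumption_F f alpha1 alpha2)
    (hT : assumption_T f alpha1 omega_star a D phi)
    (halpha1 : 1 <= alpha1) (rho : R) (hrho : 0 < rho) :
  exists2 lambda0 : R, 0 < lambda0 &
    forall lambda : R, lambda0 <= lambda ->
    exists (omega v gamma : nat -> R) (T eta : R -> R -> R[i]),
      [/\ infinite_soliton_profile omega_star phi omega v gamma T,
          duhamel_solution f (soliton_train phi omega v gamma) T eta &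
          (ereal_sup [set (expR (lambda * t))%:E * normL2Loo (eta t)
                     | t in `[0%R, +oo[] <= rho%:E)%E].
Proof.
have [_ a12 _] := hF.
have [C0 C00 [f0 fL fm]] := assumption_F_nonlinearity halpha1 hF.
have [os0 /andP[a0 _] D0 hbound] := hT.
have hphi omega : 0 < omega < omega_star ->
    (forall x, derivable (phi omega) x 1) /\
    (forall x, `|phi omega x| <=
       D * omega `^ alpha1^-1 * expR (- (a * omega `^ 2^-1 * `|x|))).
  move=> /hbound[_ _ _ der bnd]; split => // x.
  by apply: le_trans (bnd x); rewrite lerDl mulr_ge0// powR_ge0.
(* The amplitude [m^-1] of the train meets the four smallness conditions. *)
pose m := 1 + omega_star^-1 + 16 * D + 256 * D ^+ 2.
have i0 : 0 < omega_star^-1 by rewrite invr_gt0.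
have d20 : 0 < D ^+ 2 by rewrite exprn_gt0.
have m0 : 0 < m by rewrite /m; lra.
have um c : c <= m -> c * m^-1 <= 1 by rewrite ler_pdivrMr// mul1r.
have u00 : 0 < m^-1 by rewrite invr_gt0.
have u01 : m^-1 <= 1 by rewrite -[leLHS]mul1r; apply: um; rewrite /m; lra.
have u0o : m^-1 < omega_star.
  by rewrite -[ltRHS]invrK ltf_pV2 ?posrE//; rewrite /m; lra.
have u0D : 16 * D * m^-1 <= 1 by apply: um; rewrite /m; lra.
have u0D2 : 256 * D ^+ 2 * m^-1 <= 1 by apply: um; rewrite /m; lra.
pose K := 4 + 8 / a.
have a80 : 0 < 8 / a by rewrite divr_gt0.
have K0 : 0 <= K by rewrite /K; lra.
pose C := C0 * (1 + 2 * growth' alpha1 alpha2 (4 * rho)).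
have Cge0 : 0 <= C.
  by rewrite mulr_ge0 ?(ltW C00)// addr_ge0// mulr_ge0// growth'_ge0.
pose A1 := C * (2 * (K + 2 * rho) + (3 * K ^+ 2 + 3 * rho ^+ 2 + 2)).
have A10 : 0 <= A1.
  have := sqr_ge0 K; have := sqr_ge0 rho => r2 k2.
  by apply: mulr_ge0 => //; lra.
have B0 : 0 < rho / 2 by rewrite divr_gt0.
(* The threshold [s ^+ 2]: above it the gain [(sqrt l)^-1] beats all constants. *)
pose s := 1 + 32 * (C * K + A1 * (rho / 2)) / (rho / 2) + 32 * A1.
have CK0 : 0 <= C * K by exact: mulr_ge0.
have AB0 : 0 <= A1 * (rho / 2) by rewrite mulr_ge0// ltW.
have sB0 : 0 <= 32 * (C * K + A1 * (rho / 2)) / (rho / 2).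
  by rewrite divr_ge0 ?(ltW B0)// mulr_ge0// addr_ge0.
have s1 : 1 <= s by rewrite /s; lra.
exists (s ^+ 2); first by rewrite exprn_gt0// (lt_le_trans _ s1).
move=> l sl.
have l1 : 1 <= l by apply: le_trans sl; rewrite exprn_ege1.
have l0 : 0 < l by lra.
have sq : s <= Num.sqrt l.
  have s0 : 0 <= s by lra.
  by rewrite -[leLHS](ger0_norm s0) -sqrtr_sqr ler_wsqrtr.
have sq0 : 0 < Num.sqrt l by rewrite sqrtr_gt0.
have small_ball : 32 * (C * K + A1 * (rho / 2)) / Num.sqrt l <= rho / 2.
  rewrite ler_pdivrMr// [leRHS]mulrC -ler_pdivrMr//; apply: le_trans sq.
  by rewrite /s; lra.
have small_lip : 16 * A1 / Num.sqrt l <= 2^-1.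
  by rewrite ler_pdivrMr//; move: sq; rewrite /s; lra.
pose W := potential alpha1 alpha2 a D m^-1 l.
pose H := interaction alpha1 a m^-1 l phi f.
have bW t : ibound (W t) (8 / a) by exact: (ibound_potential l halpha1 a12 a0 D0 u00 u0D u0D2).
have mW := measurable_potential l halpha1 a12 a0 D0 u00 u0D.
have W0 t x : 0 <= W t x by exact: (potential_ge0 l halpha1 a12 a0 D0 u00 u0D).
have WK (t x : R) : 0 <= t -> W t x <= K.
  by move=> _; apply: (le_trans (potential_le4 l halpha1 a12 a0 D0 u00 u0D t x)); rewrite /K; lra.
have WI (t : R) : 0 <= t -> (\int[lebesgue_measure]_x (W t x)%:E <= K%:E)%E.
  by move=> _; have [_ _ /le_trans] := bW t; apply; rewrite lee_fin /K; lra.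
have mH eta : cmeasurable eta -> cmeasurable (fun t x => H t x (eta t x)).
  exact: (cmeasurable_interaction l halpha1 a12 a0 D0 hphi u00 u01 u0o u0D C00 f0 fL fm).
have Hlip (t x : R) z w : 0 <= t -> cmod z <= rho -> cmod w <= rho ->
    cmod (H t x z - H t x w) <= C * (W t x + cmod z + cmod w) * cmod (z - w).
  by move=> _; exact: (interaction_lipschitz l halpha1 a12 a0 D0 hphi u00 u01 u0o u0D C00 fL).
have H0 (t x : R) : 0 <= t -> cmod (H t x 0) <= C * expR (- (l * t)) * W t x.
  exact: (interaction_source halpha1 a12 a0 D0 hphi u00 u01 u0o u0D l0 rho C00 f0 fL).
have [eta [eta_state eta_source eta_fix]] :=
  duhamel_fixed_point Cge0 K0 hrho l1 mW W0 WK WI mH Hlip H0 small_ball small_lip.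
exists (freq alpha1 m^-1), (vel alpha1 a m^-1 l), (fun=> 0),
  (train alpha1 a m^-1 l phi), eta; split.
- split.
  + by move=> j; exact: (freq_in halpha1 u00 u01 u0o).
  + exact: (vel_inj halpha1 a0 u00 l0).
  + exact: (train_cvg l halpha1 a0 D0 hphi u00 u01 u0o).
- exists (fsum alpha1 a m^-1 l phi f); split=> [t x _|t t0].
    exact: (fsum_cvg l halpha1 a12 a0 D0 hphi u00 u01 u0o u0D C00 f0 fL).
  have [sR sI] := eta_source.
  pose h (t x : R) := H t x (eta t x).
  exists (fun tau => cconv (t - tau) (h tau)), (cduh h t); split.
  + by apply: aeW => tau ttau; exact: (cconv_free_evolution sR sI t0).
  + by apply: (cduh_is_L2_integral _ l1 sR sI t0); rewrite mulr_ge0// addr_ge0.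
  + by split; [exact: cstate_in_L2 eta_state|apply: aeW => x; exact: eta_fix].
- apply: ge_ereal_sup => y [t /=]; rewrite in_itv/= andbT => t0 <-.
  have hn := cstate_normL2Loo (ltW B0) t0 eta_state.
  apply: (@le_trans _ _ ((expR (l * t))%:E * (2 * (rho / 2) * expR (- (l * t)))%:E)%E).
    by rewrite lee_pmul2l// lte_fin expR_gt0.
  rewrite -EFinM lee_fin expRN mulrCA divff ?gt_eqF ?expR_gt0//.
  by rewrite mulr1 mulrC divfK.
Qed.
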